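(* Let $X\subset\mathbb{R}^k$ be a nonempty compact set with $X=\mathrm{cl}(\mathrm{int}(X))$. Let $(S_j)_{j\ge 1}$ be a countably infinite family of contractive similarity mappings $S_j:X\to X$ with similarity ratios $s_j\in(0,1)$ and $\sup_{j\ge 1}s_j<1$, satisfying the strong separation condition. Let $(p_1,p_2,\dots)$ be an infinite probability vector with $p_j>0$ for all $j\ge 1$, and let $\mu$ be the associated self-similar measure, i.e. the unique Borel probability measure with $\mu=\sum_{j=1}^\infty p_j\,\mu\circ S_j^{-1}$. Assume that the series $\sum_{j=1}^\infty p_j\log s_j$ converges. Then the quantization dimension $D(\mu)$ of $\mu$ with respect to the geometric mean error exists, and $$D(\mu)=\dim_{\mathrm H}^\ast(\mu),$$ where $\dim_{\mathrm H}^\ast(\mu)$ is the Hausdorff dimension of the measure $\mu$.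
   Context: Let $d$ be the metric induced by a fixed norm on $\mathbb{R}^k$, and $d(x,\alpha)=\inf_{a\in\alpha}d(x,a)$. A map $S_j$ is a similarity with ratio $s_j$ if $d(S_j(x),S_j(y))=s_j\,d(x,y)$ for all $x,y\in X$. Limit set: for $\omega=\omega_1\omega_2\cdots\in\mathbb{N}^{\infty}$ put $\omega|_n=\omega_1\cdots\omega_n$ and $S_{\omega|_n}=S_{\omega_1}\circ\cdots\circ S_{\omega_n}$; the set $\bigcap_{n\ge1}S_{\omega|_n}(X)$ is a single point $\pi(\omega)$. The limit set is $J=\pi(\mathbb{N}^\infty)$ (not necessarily compact). It satisfies $J=\bigcup_{j\ge1}S_j(J)$. The measure $\mu$ equals $\nu\circ\pi^{-1}$, where $\nu$ is the infinite product of $(p_1,p_2,\dots)$ on $\mathbb{N}^\infty$. Strong separation condition: $S_i(J)\cap S_j(J)=\emptyset$ for all $i\ne j$. Quantization: for a Borel probability measure $\mu$ on $\mathbb{R}^k$ and $n\ge 1$, $$\hat e_n(\mu)=\inf\Big\{\int\log d(x,\alpha)\,d\mu(x):\alpha\subset\mathbb{R}^k,\ 1\le\mathrm{Card}(\alpha)\le n\Big\}.$$ The lower and upper quantization dimensions of $\mu$ (of order zero) are $$\underline D(\mu)=\liminf_{n\to\infty}\frac{\log n}{-\hat e_n(\mu)},\qquad \overline D(\mu)=\limsup_{n\to\infty}\frac{\log n}{-\hat e_n(\mu)}.$$ If they coincide, the quantization dimension $D(\mu)$ exists and is their common value. Hausdorff dimension of a measure: $\dim_{\mathrm H}^\ast(\mu)=\inf\{\dim_{\mathrm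 H}B: B\text{ Borel},\ \mu(B)=1\}$. The paper recalls from earlier work that in this setting $\dim_{\mathrm H}^\ast(\mu)=\frac{\sum_{j}p_j\log p_j}{\sum_{j}p_j\log s_j}$. *)

(* Defs.v *)
From HB Require Import structures.
From mathcomp Require Import all_boot all_order all_algebra.
From mathcomp Require Import all_classical all_reals all_analysis.

Set Implicit Arguments.
Unset Strict Implicit.
Unset Printing Implicit Defensive.

Import Order.TTheory GRing.Theory Num.Theory.
Import numFieldNormedType.Exports.

Local Open Scope classical_set_scope.
Local Open Scope ring_scope.

(* R^k with its Borel sigma-algebra.  All norms on R^k induce the topology of
   'rV[R]_k, so this does not depend on the norm chosen below. *)
Notation borelRk R k := (g_sigma_algebraType (@open 'rV[R]_k)).

Section Metric.
Context {R : realType} {k : nat}.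
Implicit Types (N : 'rV[R]_k -> R) (x y : 'rV[R]_k) (A U : set 'rV[R]_k).

Definition is_norm N : Prop :=
  [/\ forall x y, N (x + y) <= N x + N y,
      forall (a : R) x, N (a *: x) = `|a| * N x
    & forall x, N x = 0 -> x = 0].

Definition dist N x y : R := N (x - y).

Definition dist_set N x A : R := inf [set dist N x a | a in A].

(* Equal to -oo on the empty set. *)
Definition diam N U : \bar R :=
  ereal_sup [set (dist N z.1 z.2)%:E | z in U `*` U].

(* diam(U)^t, where the empty set contributes 0 even for t = 0; since
   0 `^ 0 = 1, the resulting 0-dimensional measure is the counting measure. *)
Definition diam_pow N (t : R) U : \bar R :=
  if U == set0 then 0%E else poweR (diam N U) t.

Definition hausdorff_content N (t delta : R) A : \bar R :=
  ereal_inf [set (\sum_(0 <= i <oo) diam_pow N t (U i))%E |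
    U in [set U : nat -> set 'rV[R]_k |
           A `<=` \bigcup_i U i /\ forall i, (diam N (U i) <= delta%:E)%E]].

Definition hausdorff_measure N (t : R) A : \bar R :=
  ereal_sup [set hausdorff_content N t delta A |
    delta in [set delta : R | 0 < delta]].

Definition hausdorff_dim N A : \bar R :=
  ereal_inf [set t%:E |
    t in [set t : R | 0 <= t /\ hausdorff_measure N t A = 0%E]].

End Metric.

Section IteratedFunctionSystem.
Context {R : realType} {k : nat}.
Implicit Types (N : 'rV[R]_k -> R) (X : set 'rV[R]_k).
Implicit Types (S : nat -> 'rV[R]_k -> 'rV[R]_k) (w : nat -> nat).

(* The maps of the system are total functions; only their values on X matter. *)
Definition similarity_on N X (f : 'rV[R]_k -> 'rV[R]_k) (r : R) : Prop :=
  {in X &, forall x y, dist N (f x) (f y) = r * dist N x y}.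

(* word_map S w n = S (w 0) \o ... \o S (w n.-1) *)
Fixpoint word_map S w (n : nat) : 'rV[R]_k -> 'rV[R]_k :=
  if n is m.+1 then word_map S w m \o S (w m) else id.

(* For a uniformly contractive system on a nonempty compact X the intersection
   is a singleton, and xget returns its unique element. *)
Definition coding_map S X w : 'rV[R]_k :=
  xget 0 (\bigcap_(n in [set n | (1 <= n)%N]) (word_map S w n @` X)).

Definition limit_set S X : set 'rV[R]_k := range (coding_map S X).

Definition strong_separation S X : Prop :=
  forall i j, i <> j ->
    (S i @` limit_set S X) `&` (S j @` limit_set S X) = set0.

(* As S j maps X to X, the preimage of B under S j is X `&` S j @^-1` B. *)
Definition self_similar_measure S X (p : nat -> R)
    (mu : probability (borelRk R k) R) : Prop :=
  forall B : set (borelRk R k), measurable B ->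
    mu B = (\sum_(0 <= j <oo) (p j)%:E * mu (X `&` S j @^-1` B))%E.

End IteratedFunctionSystem.

Section Quantization.
Context {R : realType} {k : nat}.
Variables (N : 'rV[R]_k -> R) (mu : probability (borelRk R k) R).

(* lne 0 = -oo *)
Definition quant_error (n : nat) : \bar R :=
  ereal_inf [set (\int[mu]_x lne (dist_set N x alpha)%:E)%E |
    alpha in [set alpha : set 'rV[R]_k | alpha !=set0 /\ (alpha #<= `I_n)%card]].

Definition quant_ratio (n : nat) : \bar R :=
  ((ln (n%:R : R))%:E / (- quant_error n))%E.

Definition lower_quant_dim : \bar R := limn_einf quant_ratio.

Definition upper_quant_dim : \bar R := limn_esup quant_ratio.

Definition has_quant_dim (D : \bar R) : Prop :=
  lower_quant_dim = D /\ upper_quant_dim = D.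

Definition hausdorff_dim_measure : \bar R :=
  ereal_inf [set hausdorff_dim N B |
    B in [set B : set (borelRk R k) | measurable B /\ mu B = 1%E]].

End Quantization.

(* Main.v *)
(* Put h = - sum_j p_j ln p_j, possibly infinite, and chi = - sum_j p_j ln s_j;
   both dimensions equal h / chi.  A word w of m independent letters of law p
   carries the weight p_w and the contraction ratio s_w, and mu is the average
   over w of the images of mu under S_w.

   Upper bounds.  By the weak law of large numbers, most words of length m have
   p_w >= exp(- m (h + e)) and s_w <= exp(- m (chi - e)); there are at most
   exp(m (h + e)) of these.  One point in each S_w X gives a good quantizer, and
   the upper limit of the union of the S_w X is a set of full measure and of
   dimension at most h / chi.  When h is infinite only
   the finiteness of the quotients log n / (- e_n) has to be checked.

   Lower bounds.  The pieces S_j X may overlap, and even the pieces S_j J of the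
   limit set J have no uniform gap.  By compactness, however, there is c > 0 such
   that d(S_i S_u x, S_j S_v y) >= c as soon as i <> j are below M and the first L
   letters of u and v are bounded by fixed constants.  Hence, among words that
   differ only in such positions, at most one comes closer than (c / 2) s_w to a
   given point.  Keeping one word of each class divides the weight by
   (p_0 + ... + p_(M-1)) / p_j at every such position, so for each b < h the
   words of length m near a given point have probability at most exp(C - m b),
   up to an exceptional event handled by a maximal inequality for random walks.
   For n points the probability is at most n exp(C - m b), and self-similarity at
   level m ~ ln n / b bounds the integral of ln^+ (1 / d(x, alpha)) by about
   m chi.  Stopping instead at the first length at which s_w is of order r yields
   a Frostman-type bound r^t, t < h / chi, on the balls of radius r, along a set
   of words of positive probability. *)
Require Import Defs.
From HB Require Import structures.
From mathcomp Require Import all_boot all_order all_algebra.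
From mathcomp Require Import all_classical all_reals all_analysis.
From mathcomp Require Import measurable_realfun.
From mathcomp Require Import zify ring lra.

Set Implicit Arguments.
Unset Strict Implicit.
Unset Printing Implicit Defensive.

Import Order.TTheory GRing.Theory Num.Theory.
Import numFieldNormedType.Exports.

Local Open Scope classical_set_scope.
Local Open Scope ring_scope.

(** * Expectations over random words *)

Section WordExpectation.
Context {R : realType} (p : nat -> R).
Hypothesis p_ge0 : forall j, 0 <= p j.

Local Open Scope ereal_scope.

Definition lexp (f : nat -> \bar R) : \bar R := \sum_(0 <= j <oo) (p j)%:E * f j.

(** Iterated series replace an integral over the product space: only finitely many letters occur at
    a time, and inductions peel off the first one. *)
Fixpoint wexp (m : nat) (f : seq nat -> \bar R) : \bar R :=
  if m is n.+1 then lexp (fun j => wexp n (fun w => f (j :: w))) else f [::].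

Definition wprob m (Q : pred (seq nat)) : \bar R :=
  wexp m (fun w => (Q w)%:R%:E).

Let pE_ge0 j : 0 <= (p j)%:E. Proof. by rewrite lee_fin. Qed.

Lemma lexp_ge0 f : (forall j, 0 <= f j) -> 0 <= lexp f.
Proof. by move=> f0; apply: nneseries_ge0 => j _ _; exact: mule_ge0. Qed.

Lemma le_lexp f g : (forall j, 0 <= f j) -> (forall j, f j <= g j) ->
  lexp f <= lexp g.
Proof.
move=> f0 fg; apply: lee_nneseries => j _; first by move=> _; exact: mule_ge0.
exact: lee_wpmul2l.
Qed.

Lemma eq_lexp f g : f =1 g -> lexp f = lexp g.
Proof. by move=> /funext ->. Qed.

Lemma lexpD f g : (forall j, 0 <= f j) -> (forall j, 0 <= g j) ->
  lexp (fun j => f j + g j) = lexp f + lexp g.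
Proof.
move=> f0 g0; rewrite -nneseriesD; [|by move=> *; exact: mule_ge0..].
by apply: eq_eseriesr => j _; rewrite ge0_muleDr.
Qed.

Lemma lexpZ (c : R) f : (forall j, 0 <= f j) ->
  lexp (fun j => c%:E * f j) = c%:E * lexp f.
Proof.
move=> f0; rewrite -nneseriesZl; last by move=> *; exact: mule_ge0.
by apply: eq_eseriesr => j _; rewrite muleCA.
Qed.

Lemma le_wexp m f g : (forall w, size w = m -> 0 <= f w) ->
  (forall w, size w = m -> f w <= g w) -> wexp m f <= wexp m g.
Proof.
suff H : forall f g, (forall w, size w = m -> 0 <= f w) ->
    (forall w, size w = m -> f w <= g w) -> 0 <= wexp m f /\ wexp m f <= wexp m g.
  by move=> f0 fg; have [] := H _ _ f0 fg.
elim: m => [|m IH] {}f {}g f0 fg /=; first by split; [exact: f0|exact: fg].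
have {}IH j : 0 <= wexp m (fun w => f (j :: w)) /\
    wexp m (fun w => f (j :: w)) <= wexp m (fun w => g (j :: w)).
  by apply: IH => w sw; [apply: f0|apply: fg]; rewrite /= sw.
split; first by apply: lexp_ge0 => j; have [] := IH j.
by apply: le_lexp => j; have [] := IH j.
Qed.

Lemma wexp_ge0 m f : (forall w, size w = m -> 0 <= f w) -> 0 <= wexp m f.
Proof.
elim: m f => [|m IH] f f0 /=; first exact: f0.
by apply: lexp_ge0 => j; apply: IH => w sw; apply: f0; rewrite /= sw.
Qed.

Lemma eq_wexp m f g : (forall w, size w = m -> f w = g w) -> wexp m f = wexp m g.
Proof.
elim: m f g => [|m IH] f g fg /=; first exact: fg.
by apply: eq_lexp => j; apply: IH => w sw; apply: fg; rewrite /= sw.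
Qed.

Lemma wexpD m f g : (forall w, 0 <= f w) -> (forall w, 0 <= g w) ->
  wexp m (fun w => f w + g w) = wexp m f + wexp m g.
Proof.
elim: m f g => [//|m IH] f g f0 g0 /=.
rewrite -lexpD; [|by move=> j; exact: wexp_ge0..].
by apply: eq_lexp => j; rewrite IH.
Qed.

Lemma wexpZ m (c : R) f : (forall w, 0 <= f w) ->
  wexp m (fun w => c%:E * f w) = c%:E * wexp m f.
Proof.
elim: m f => [//|m IH] f f0 /=.
rewrite -lexpZ; last by move=> j; exact: wexp_ge0.
by apply: eq_lexp => j; rewrite IH.
Qed.

Lemma wexp_sum m (I : Type) (r : seq I) (f : I -> seq nat -> \bar R) :
  (forall i w, 0 <= f i w) ->
  wexp m (fun w => \sum_(i <- r) f i w) = \sum_(i <- r) wexp m (f i).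
Proof.
move=> f0; elim: r => [|i r IH].
  rewrite big_nil (eq_wexp (g := fun=> 0%:E * 0)); last first.
    by move=> w _; rewrite big_nil mul0e.
  by rewrite wexpZ// mul0e.
rewrite big_cons -IH -wexpD//; last by move=> w; exact: sume_ge0.
by apply: eq_wexp => w _; rewrite big_cons.
Qed.

Hypothesis p_sum1 : \sum_(0 <= j <oo) (p j)%:E = 1.

Lemma lexp_cst (c : R) : (0 <= c)%R -> lexp (fun=> c%:E) = c%:E.
Proof.
move=> c0; rewrite -[RHS]mule1 -p_sum1 -nneseriesZl//.
by apply: eq_eseriesr => j _; rewrite muleC.
Qed.

Lemma wexp_cst m (c : R) : (0 <= c)%R -> wexp m (fun=> c%:E) = c%:E.
Proof.
by move=> c0; elim: m => [//|m IH] /=; rewrite IH lexp_cst.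
Qed.

Lemma wexp_le_cst m f (c : R) : (forall w, size w = m -> 0 <= f w) -> (0 <= c)%R ->
  (forall w, size w = m -> f w <= c%:E) -> wexp m f <= c%:E.
Proof. by move=> f0 c0 fc; rewrite -(wexp_cst m c0); exact: le_wexp. Qed.

Lemma wexp_take m k f : (k <= m)%N -> (forall w, 0 <= f w) ->
  (forall w, f w \is a fin_num) ->
  wexp m (fun w => f (take k w)) = wexp k f.
Proof.
move=> km f0 ff; elim: m k f km f0 ff => [|m IH] [|k] f // km f0 ff.
- rewrite (eq_wexp (g := fun=> (fine (f [::]))%:E)); last first.
    by move=> w _; rewrite take0 fineK.
  by rewrite wexp_cst ?fineK// fine_ge0.
- by rewrite [LHS]/= [RHS]/=; apply: eq_lexp => j; rewrite -(IH k).
Qed.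

Lemma wexp_sum_letters m (f : nat -> R) (l : R) : (forall j, 0 <= f j)%R ->
  lexp (EFin \o f) = l%:E ->
  wexp m (fun w => (\sum_(j <- w) f j)%:E) = (m%:R * l)%:E.
Proof.
move=> f0 lE; elim: m => [|m IH] /=; first by rewrite big_nil mul0r.
have s0 w : 0 <= (\sum_(j <- w) f j)%:E by rewrite lee_fin sumr_ge0.
have l0 : (0 <= l)%R.
  by rewrite -lee_fin -lE; apply: lexp_ge0 => j; rewrite lee_fin.
transitivity (lexp (fun j => (f j)%:E + (m%:R * l)%:E)).
  apply: eq_lexp => j; rewrite -IH -(wexp_cst m (f0 j)) -wexpD//; last first.
    by move=> w; rewrite lee_fin.
  by apply: eq_wexp => w _; rewrite big_cons EFinD.
rewrite lexpD//; [|by move=> j; rewrite lee_fin// mulr_ge0..].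
rewrite lexp_cst ?mulr_ge0// -[lexp _]/(lexp (EFin \o f)) lE -EFinD.
by rewrite -[m.+1]add1n natrD mulrDl mul1r.
Qed.

Lemma wprob_all m (P : pred nat) (l : R) :
  lexp (fun j => (P j)%:R%:E) = l%:E -> wprob m (all P) = (l ^+ m)%:E.
Proof.
move=> lE; rewrite /wprob; elim: m => [//|m IH] /=.
have l0 : (0 <= l)%R.
  by rewrite -lee_fin -lE; apply: lexp_ge0 => j; rewrite lee_fin.
transitivity (lexp (fun j => (l ^+ m)%:E * (P j)%:R%:E)).
  apply: eq_lexp => j; rewrite muleC -IH -wexpZ; last by move=> w; rewrite lee_fin.
  by apply: eq_wexp => w _; rewrite -EFinM -natrM mulnb.
by rewrite lexpZ ?lE -?EFinM -?exprSr// => j; rewrite lee_fin.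
Qed.

Lemma wprob_ge0 m Q : 0 <= wprob m Q.
Proof. by apply: wexp_ge0 => w _; rewrite lee_fin. Qed.

Lemma wprob_le1 m Q : wprob m Q <= 1.
Proof.
by apply: wexp_le_cst => // w _; rewrite lee_fin// lern1 leq_b1.
Qed.

Lemma wprob_fin_num m Q : wprob m Q \is a fin_num.
Proof.
by rewrite ge0_fin_numE ?wprob_ge0// (le_lt_trans (wprob_le1 m Q))// ltry.
Qed.

Lemma le_wprob m (Q1 Q2 : pred (seq nat)) :
  (forall w, size w = m -> Q1 w -> Q2 w) -> wprob m Q1 <= wprob m Q2.
Proof.
move=> Q12; apply: le_wexp => w sw; rewrite lee_fin// ler_nat.
by case: (Q1 w) (Q12 w sw) => // ->.
Qed.

Lemma wprobU m (Q1 Q2 : pred (seq nat)) :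
  wprob m (predU Q1 Q2) <= wprob m Q1 + wprob m Q2.
Proof.
rewrite /wprob -wexpD; [|by move=> w; rewrite lee_fin..].
apply: le_wexp => w _; first by rewrite lee_fin.
rewrite -EFinD lee_fin -natrD ler_nat /=.
by case: (Q1 w) => //=; case: (Q2 w).
Qed.

(** Inclusion-exclusion in additive form: two events whose probabilities add up to more than 1 must
    occur together. *)
Lemma wprobI m (Q1 Q2 : pred (seq nat)) :
  wprob m Q1 + wprob m Q2 <= 1 + wprob m (predI Q1 Q2).
Proof.
have -> : 1 + wprob m (predI Q1 Q2) =
    wexp m (fun w => 1%:E + (predI Q1 Q2 w)%:R%:E).
  by rewrite wexpD ?(wexp_cst m ler01)// => w; rewrite lee_fin.
rewrite /wprob -wexpD; [|by move=> w; rewrite lee_fin..].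
apply: le_wexp => w _; first by rewrite -EFinD lee_fin addr_ge0.
rewrite -!EFinD lee_fin.
by rewrite /=; case: (Q1 w); case: (Q2 w) => /=; rewrite ?mulr1n ?mulr0n; lra.
Qed.

Lemma wprob_has m (I : Type) (r : seq I) (Q : I -> pred (seq nat)) :
  wprob m (fun w => has (Q^~ w) r) <= \sum_(i <- r) wprob m (Q i).
Proof.
elim: r => [|i r IH].
  by rewrite big_nil; apply: (wexp_le_cst (c := 0%R)) => // w _; rewrite lee_fin.
by rewrite big_cons (le_trans (wprobU _ _ _))// leeD2l.
Qed.

Lemma wexp_markov m (f : seq nat -> R) (c : R) : (0 < c)%R ->
  (forall w, 0 <= f w)%R ->
  c%:E * wprob m (fun w => c <= f w)%R <= wexp m (fun w => (f w)%:E).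
Proof.
move=> c0 f0; rewrite -wexpZ; last by move=> w; rewrite lee_fin.
apply: le_wexp => w _; first by rewrite mule_ge0// lee_fin// ltW.
rewrite -EFinM lee_fin; by case: (leP c (f w)) => h; rewrite ?mulr1// mulr0.
Qed.

End WordExpectation.

(** * Random walks *)

Section Walks.
Context {R : realType}.
Implicit Types xi tau z : nat -> R.

(* The maximum of the partial sums of - xi along w. *)
Fixpoint wmax xi (w : seq nat) : R :=
  if w is j :: u then Num.max 0 (wmax xi u - xi j) else 0.

Lemma wmax_ge0 xi w : 0 <= wmax xi w.
Proof. by case: w => //= j w; rewrite le_max lexx. Qed.

Lemma wmax_take xi w k : - (\sum_(j <- take k w) xi j) <= wmax xi w.
Proof.
elim: w k => [|i w IH] [|k] /=; rewrite ?big_nil ?oppr0//.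
  by rewrite le_max lexx.
by rewrite big_cons opprD addrC le_max lerB ?IH ?orbT.
Qed.

Lemma wmax_take_le xi w k : wmax xi (take k w) <= wmax xi w.
Proof.
elim: w k => [|i w IH] [|k] //=; first by rewrite le_max lexx.
by rewrite ge_max !le_max lexx /= lerB ?orbT// IH.
Qed.

(** Since exp(x) >= 1 + x, it suffices that (1 - x + 2 x^2) (1 + x) >= 1, and this product equals 1
    + x^2 (1 + 2 x). *)
Lemma expRN_le_quadratic (x : R) : - 2^-1 <= x ->
  expR (- x) <= 1 - x + 2 * x ^+ 2.
Proof.
move=> hx; have x1 : 0 < 1 + x by lra.
rewrite expRN -div1r ler_pdivrMr ?expR_gt0//.
apply: (@le_trans _ _ ((1 - x + 2 * x ^+ 2) * (1 + x))).
  have -> : (1 - x + 2 * x ^+ 2) * (1 + x) = 1 + x ^+ 2 * (1 + 2 * x) by ring.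
  by rewrite lerDl mulr_ge0 ?sqr_ge0//; lra.
rewrite ler_wpM2l ?expR_ge1Dx//.
have -> : 1 - x + 2 * x ^+ 2 = 2 * (x - 4^-1) ^+ 2 + 7 / 8 by field.
by rewrite addr_ge0// mulr_ge0// sqr_ge0.
Qed.

Context (p : nat -> R).
Hypothesis p_ge0 : forall j, 0 <= p j.
Hypothesis p_sum1 : (\sum_(0 <= j <oo) (p j)%:E = 1)%E.

(** The hypothesis says that z has mean at least m; adding Z makes the averaged function
    nonnegative. To second order E exp(- theta z) <= 1 - theta m + 2 theta^2 Z^2, and theta = m / (2
    Z^2) cancels the last two terms. *)
Lemma exponential_moment_le1 z (Z m : R) : (forall j, `|z j| <= Z) -> 0 < m ->
  ((Z + m)%:E <= lexp p (fun j => (z j + Z)%:E))%E ->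
  exists2 theta, 0 < theta & (lexp p (fun j => (expR (- (theta * z j)))%:E) <= 1)%E.
Proof.
move=> zZ m0 mean.
have zZ0 j : 0 <= z j + Z by have := zZ j; rewrite ler_norml => /andP[]; lra.
have Zge0 : 0 <= Z by exact: le_trans (normr_ge0 _) (zZ 0%N).
have Zm : m <= Z.
  suff : ((Z + m)%:E <= (Z + Z)%:E)%E by rewrite lee_fin; lra.
  rewrite (le_trans mean)// -[leRHS](lexp_cst p_ge0 p_sum1); last by lra.
  apply: le_lexp => // j; rewrite lee_fin ?zZ0//.
  by have := zZ j; rewrite ler_norml => /andP[]; lra.
have Z0 : 0 < Z by lra.
pose t := m / (2 * Z ^+ 2); have t0 : 0 < t by rewrite divr_gt0 ?mulr_gt0 ?exprn_gt0.
have tZ : t * Z <= 2^-1.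
  have -> : t * Z = m / Z / 2 by rewrite /t; field; lra.
  by rewrite ler_pdivrMr// mulVf// ler_pdivrMr// mul1r.
exists t => //.
have tze j : expR (- (t * z j)) + t * (z j + Z) <= 1 + t * m + t * Z.
  have /andP[h1 h2] : - Z <= z j <= Z by rewrite -ler_norml.
  have tz : `|t * z j| <= t * Z by rewrite normrM gtr0_norm// ler_wpM2l// ltW.
  have sq : (t * z j) ^+ 2 <= (t * Z) ^+ 2.
    by rewrite -[leLHS]real_normK ?num_real// lerXn2r// nnegrE mulr_ge0// ltW.
  have : expR (- (t * z j)) <= 1 - t * z j + 2 * (t * z j) ^+ 2.
    apply: expRN_le_quadratic; move: tz; rewrite ler_norml => /andP[]; lra.
  have tm : 2 * (t * Z) ^+ 2 = t * m by rewrite /t; field; lra.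
  by move=> h; nra.
have T0 j : (0 <= (t * (z j + Z))%:E)%E by rewrite lee_fin mulr_ge0// ltW.
have E0 j : (0 <= (expR (- (t * z j)))%:E)%E by rewrite lee_fin expR_ge0.
have cst0 : 0 <= 1 + t * m + t * Z by rewrite !addr_ge0// mulr_ge0// ltW.
have key : (lexp p (fun j => (expR (- (t * z j)))%:E) +
    t%:E * lexp p (fun j => (z j + Z)%:E) <= (1 + t * m + t * Z)%:E)%E.
  rewrite -lexpZ//.
  rewrite -lexpD// -[leRHS](lexp_cst p_ge0 p_sum1 cst0); apply: le_lexp => // j.
  by rewrite adde_ge0// mule_ge0// lee_fin ?zZ0// ltW.
have h : ((t * (Z + m))%:E <= t%:E * lexp p (fun j => (z j + Z)%:E))%E.
  by rewrite EFinM lee_pmul2l.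
rewrite -(@leeD2rE _ (t * (Z + m))%:E)//.
apply: le_trans (leeD2l _ h) _; apply: (le_trans key).
by rewrite -EFinD lee_fin; lra.
Qed.

(** A Cramer-Lundberg bound, uniform in the length. Conditioning on the first letter j turns the
    level kappa into kappa + xi j, and the exponential moment absorbs the shift. For kappa < 0 the
    bound exceeds 1. *)
Lemma wprob_wmax_gt xi (theta kappa : R) m : 0 < theta ->
  (lexp p (fun j => (expR (- (theta * xi j)))%:E) <= 1)%E ->
  (wprob p m (fun w => kappa < wmax xi w)%R <= (expR (- (theta * kappa)))%:E)%E.
Proof.
move=> t0 E1; elim: m kappa => [|m IH] kappa.
  rewrite /wprob /=; case: ltP => // k0; last by rewrite lee_fin expR_ge0.
  by rewrite lee_fin -expR0 ler_expR oppr_ge0 nmulr_lle0// ltW.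
have [k0|k0] := ltP kappa 0.
  apply: le_trans (wprob_le1 p_ge0 p_sum1 _ _) _.
  by rewrite lee_fin -expR0 ler_expR oppr_ge0 nmulr_lle0// ltW.
have -> : wprob p m.+1 (fun w => kappa < wmax xi w) =
    lexp p (fun j => wprob p m (fun w => kappa + xi j < wmax xi w)).
  apply: eq_lexp => j; apply: eq_wexp => w _ /=.
  by rewrite lt_max ltNge k0 /= ltrBrDr.
apply: (@le_trans _ _ (lexp p (fun j =>
    (expR (- (theta * kappa)))%:E * (expR (- (theta * xi j)))%:E)%E)).
  apply: le_lexp => // j; first exact: wprob_ge0.
  by rewrite -EFinM -expRD -opprD -mulrDr IH.
rewrite lexpZ//.
by rewrite -[leRHS]mule1; apply: lee_wpmul2l => //; rewrite lee_fin expR_ge0.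
Qed.

(* With W the running maximum of the walk and W' an independent copy shifted by
   one letter, E W' >= E W and (W + tau - c)^+ = W + tau - c + (c - tau - W)^+
   force c - chi <= E (c - tau - W)^+ <= c * P(W < c). *)
Lemma wprob_wmax_lt tau (chi c : R) m : (forall j, 0 <= tau j) ->
  lexp p (EFin \o tau) = chi%:E -> chi < c ->
  (((c - chi) / c)%:E <= wprob p m (fun w => wmax (fun j => c - tau j) w < c)%R)%E.
Proof.
move=> tau0 tauE chic.
have chi0 : 0 <= chi by rewrite -lee_fin -tauE lexp_ge0// => j; rewrite lee_fin.
have c0 : 0 < c by exact: le_lt_trans chic.
set W := wmax _; set P := wprob _ _ _.
have W0 w : 0 <= W w by exact: wmax_ge0.
have Wle w : W w <= \sum_(j <- w) tau j.
  elim: w => [|j w IH]; rewrite ?big_nil// big_cons /W /= -/W.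
  rewrite ge_max addr_ge0 ?sumr_ge0//=.
  by move: IH (tau0 j); lra.
have EW k : wexp p k (EFin \o W) \is a fin_num.
  rewrite ge0_fin_numE; last by apply: wexp_ge0 => // w _; rewrite lee_fin.
  apply: (@le_lt_trans _ _ (k%:R * chi)%:E); last by rewrite ltry.
  rewrite -(wexp_sum_letters p_ge0 p_sum1 k tau0 tauE).
  by apply: le_wexp => // w _; rewrite lee_fin.
have incr : (wexp p m (EFin \o W) <= wexp p m.+1 (EFin \o W))%E.
  rewrite -(@wexp_take _ p p_ge0 p_sum1 m.+1 m (EFin \o W))//.
  apply: le_wexp => // w _; rewrite lee_fin; [exact: W0|exact: wmax_take_le].
have Pf : P \is a fin_num by exact: wprob_fin_num.
have step : (wexp p m.+1 (EFin \o W) + c%:E <=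
    wexp p m (EFin \o W) + chi%:E + c%:E * P)%E.
  rewrite -(fineK (EW m)) -(fineK Pf).
  set e := fine (wexp _ _ _); set q := fine P.
  have e0 : 0 <= e by rewrite fine_ge0// wexp_ge0// => w _; rewrite lee_fin.
  have q0 : 0 <= q by rewrite fine_ge0// wprob_ge0.
  have -> : (e%:E + chi%:E + c%:E * q%:E)%E =
      lexp p (fun j => (e + tau j + c * q)%:E).
    have E2 : lexp p (fun j => (e + tau j)%:E) = (e + chi)%:E.
      by rewrite (EFinD e) -tauE -[e%:E](lexp_cst p_ge0 p_sum1 e0) -lexpD.
    have cq0 : 0 <= c * q by rewrite mulr_ge0// ltW.
    rewrite -EFinM -[(e%:E + chi%:E)%E]/((e + chi)%:E) -E2.
    rewrite -[(c * q)%:E](lexp_cst p_ge0 p_sum1 cq0) -lexpD// => j.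
    by rewrite lee_fin addr_ge0.
  have c0' : (0 <= c%:E)%E by rewrite lee_fin ltW.
  have W0' w : (0 <= (W w)%:E)%E by rewrite lee_fin.
  have tau0' j : (0 <= (tau j)%:E)%E by rewrite lee_fin.
  have V0 j : (0 <= wexp p m (fun w => (W (j :: w))%:E))%E.
    by apply: wexp_ge0 => // w _.
  rewrite -[c%:E in leLHS](lexp_cst p_ge0 p_sum1 (ltW c0)) /= -lexpD//.
  apply: le_lexp => // [j|j]; first exact: adde_ge0.
  rewrite -[c%:E](wexp_cst p_ge0 p_sum1 m (ltW c0)) -wexpD//.
  have -> : ((e + tau j + c * q)%:E = wexp p m (fun w =>
      ((W w)%:E + (tau j)%:E) + c%:E * (W w < c)%R%:R%:E))%E.
    rewrite !wexpD//; last 2 first.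
    - by move=> w; exact: adde_ge0.
    - by move=> w; rewrite mule_ge0// lee_fin.
    rewrite wexp_cst// wexpZ//.
    by rewrite !EFinD EFinM /e /q !fineK.
  apply: le_wexp => // w _; first by rewrite adde_ge0.
  rewrite -EFinM -!EFinD lee_fin /W /= -/W.
  have := W0 w; have := tau0 j.
  by case: ltP => h; case: (leP 0 (W w - (c - tau j))) => h'; rewrite ?mulr1 ?mulr0; lra.
have cP : (c%:E <= chi%:E + c%:E * P)%E.
  rewrite -(@leeD2lE _ (wexp p m (EFin \o W)))//.
  by apply: le_trans (leeD2r _ incr) _; rewrite addeA.
rewrite -(fineK Pf) lee_fin ler_pdivrMr//.
by move: cP; rewrite -(fineK Pf) -EFinM -EFinD lee_fin; lra.
Qed.

End Walks.

(** * Interchangeable letters *)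

Section Overlap.
Context {R : realType} (p : nat -> R).
Hypothesis p_ge0 : forall j, 0 <= p j.

Lemma lexp_finite (M : nat) (f : nat -> \bar R) : (forall j, 0 <= f j)%E ->
  (forall j, (M <= j)%N -> f j = 0%E) ->
  (lexp p f = \sum_(0 <= j < M) (p j)%:E * f j)%E.
Proof.
move=> f0 fM; rewrite /lexp (nneseries_split _ M) ?add0n; last first.
  by move=> j _; rewrite mule_ge0// lee_fin.
by rewrite eseries0 ?adde0// => j Mj _; rewrite fM// mule0.
Qed.

Variables (M L : nat) (N : nat -> nat) (g : nat -> R).
Hypothesis MN : forall l, (M <= N l)%N.
Hypothesis pg : forall j, (j < M)%N -> p j * expR (g j) = \sum_(0 <= i < M) p i.

(** The first L letters range over a finite set; after such continuations, distinct first letters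
    below M will be uniformly separated. *)
Definition box (w : seq nat) :=
  (L <= size w)%N && all (fun l => nth 0 w l < N l)%N (iota 0 L).

(* A letter is interchangeable when it is one of the first M letters and the
   letters that follow it lie in the box. *)
Fixpoint sim (w v : seq nat) : bool :=
  match w, v with
  | [::], [::] => true
  | i :: w', j :: v' => sim w' v' && ((i == j) || [&& i < M, j < M & box w'])%N
  | _, _ => false
  end.

(* The logarithm of the weight saved by keeping one word per class of [sim]. *)
Fixpoint lgain (w : seq nat) : R :=
  if w is j :: u then lgain u + (if (j < M)%N && box u then g j else 0) else 0.

Lemma sim_refl w : sim w w.
Proof. by elim: w => //= j w ->; rewrite eqxx. Qed.

Lemma sim_size w v : sim w v -> size w = size v.
Proof. by elim: w v => [|i w IH] [|j v]//= /andP[/IH ->]. Qed.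

(** Where the two words differ, both letters are below M, hence below every bound used in a box; so
    [sim] preserves membership in a box. *)
Lemma sim_nth w v l K : (M <= K)%N -> sim w v ->
  (nth 0 w l < K)%N = (nth 0 v l < K)%N.
Proof.
move=> MK; elim: w v l => [|i w IH] [|j v]//= [|l] /andP[wv] /=.
  by move=> /orP[/eqP -> //|/and3P[iM jM _]]; rewrite !(leq_trans _ MK).
by move=> _; exact: IH.
Qed.

Lemma sim_box w v : sim w v -> box w = box v.
Proof.
move=> wv; rewrite /box (sim_size wv); congr (_ && _).
by apply: eq_all => l; exact: sim_nth (MN l) wv.
Qed.

(** Induction on the first letter. If it is not interchangeable, each of its values is treated
    separately. If it is, a tail admits at most one first letter below M, and p j * expR (g j) is
    the same for all of them, namely the mass of the M letters that the right side collects. The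
    class function [phi] is arbitrary because the induction multiplies it by indicators of boxes. *)
Lemma overlap_weight m (W : pred (seq nat)) (phi : seq nat -> R) :
  (forall w v, W w -> W v -> sim w v -> w = v) ->
  (forall w, 0 <= phi w) -> (forall w v, sim w v -> phi w = phi v) ->
  (wexp p m (fun w => (expR (lgain w) * phi w * (W w)%:R)%:E) <=
   wexp p m (fun w => (phi w)%:E))%E.
Proof.
elim: m W phi => [|m IH] W phi Wuniq phi0 phisim /=.
  by rewrite expR0 mul1r lee_fin; case: (W _); rewrite ?mulr1// mulr0.
pose fr j w := (j < M)%N && box w.
pose psi w := phi (0%N :: w) * (box w)%:R.
pose A j := wexp p m (fun w =>
  (expR (lgain w) * (phi (j :: w) * (~~ fr j w)%:R) * (W (j :: w))%:R)%:E).
pose A' j := wexp p m (fun w => (phi (j :: w) * (~~ fr j w)%:R)%:E).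
pose B j := wexp p m (fun w => (expR (lgain w) * psi w * (W (j :: w))%:R)%:E).
pose B' := wexp p m (fun w => (psi w)%:E).
have psi0 w : 0 <= psi w by rewrite mulr_ge0.
have e0 w : 0 <= expR (lgain w) by exact: expR_ge0.
have A0 j : (0 <= A j)%E.
  by apply: wexp_ge0 => // w _; rewrite lee_fin !mulr_ge0.
have A'0 j : (0 <= A' j)%E by apply: wexp_ge0 => // w _; rewrite lee_fin mulr_ge0.
have B0 j : (0 <= B j)%E by apply: wexp_ge0 => // w _; rewrite lee_fin !mulr_ge0.
have B'0 : (0 <= B')%E by apply: wexp_ge0 => // w _; rewrite lee_fin.
have psiE j w : (j < M)%N -> phi (j :: w) * (fr j w)%:R = psi w.
  move=> jM; rewrite /fr /psi jM /=; case: (boolP (box w)) => bw; rewrite ?mulr0// !mulr1.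
  by apply: phisim => /=; rewrite sim_refl bw jM (leq_trans _ jM) ?orbT.
have fr0 j w : (M <= j)%N -> fr j w = false by rewrite /fr ltnNge => ->.
pose iM j : R := (j < M)%:R.
have LHS j : wexp p m (fun w =>
      (expR (lgain w + (if (j < M)%N && box w then g j else 0)) *
       phi (j :: w) * (W (j :: w))%:R)%:E) =
    (A j + (iM j * expR (g j))%:E * B j)%E.
  rewrite -wexpZ//; last by move=> w; rewrite lee_fin !mulr_ge0.
  rewrite /A -wexpD//; last 2 first.
  - by move=> w; rewrite lee_fin !mulr_ge0.
  - by move=> w; rewrite -EFinM lee_fin !mulr_ge0// expR_ge0.
  apply: eq_wexp => w _; rewrite -EFinM -EFinD; congr (_%:E).
  rewrite -/(fr j w) /iM; have [jM|jM] := ltnP j M; last first.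
    by rewrite fr0//= addr0 mulr1 !mul0r addr0.
  rewrite -(psiE j)//; case: (fr j w) => /=; last by rewrite addr0; ring.
  by rewrite expRD; ring.
have RHS j : wexp p m (fun w => (phi (j :: w))%:E) = (A' j + (iM j)%:E * B')%E.
  rewrite -wexpZ//.
  rewrite /A' -wexpD//; last 2 first.
  - by move=> w; rewrite lee_fin mulr_ge0.
  - by move=> w; rewrite -EFinM lee_fin mulr_ge0.
  apply: eq_wexp => w _; rewrite -EFinM -EFinD; congr (_%:E).
  rewrite /iM; have [jM|jM] := ltnP j M; last by rewrite fr0// mulr1 mul0r addr0.
  by rewrite -(psiE j)// mul1r -mulrDr -natrD; case: (fr j w); rewrite mulr1.
rewrite (eq_lexp _ LHS) (eq_lexp _ RHS) !lexpD//; last 2 first.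
- by move=> j; rewrite mule_ge0// lee_fin.
- by move=> j; rewrite mule_ge0// lee_fin mulr_ge0// expR_ge0.
apply: leeD.
  apply: le_lexp => // j; apply: (IH (fun w => W (j :: w))).
  - by move=> w v Ww Wv wv; have := Wuniq _ _ Ww Wv; rewrite /= wv eqxx => /(_ isT)[].
  - by move=> w; rewrite mulr_ge0.
  - move=> w v wv; rewrite /fr (sim_box wv); congr (_ * _).
    by apply: phisim; rewrite /= wv eqxx.
have iM0 j : (M <= j)%N -> iM j = 0 by rewrite /iM ltnNge => ->.
rewrite !(lexp_finite (M := M)); last 4 first.
- by move=> j; rewrite mule_ge0// lee_fin.
- by move=> j /iM0 ->; rewrite mul0e.
- by move=> j; rewrite mule_ge0// lee_fin mulr_ge0// expR_ge0.
- by move=> j /iM0 ->; rewrite mul0r mul0e.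
pose PM := \sum_(0 <= i < M) p i.
have -> : (\sum_(0 <= j < M) (p j)%:E * ((iM j)%:E * B'))%E = (PM%:E * B')%E.
  rewrite /PM -sumEFin ge0_sume_distrl; last by move=> j _; rewrite lee_fin.
  apply: congr_big_nat => // j /= jM.
  by rewrite /iM jM mul1e.
have -> : (\sum_(0 <= j < M) (p j)%:E * ((iM j * expR (g j))%:E * B j))%E =
    (PM%:E * \sum_(0 <= j < M) B j)%E.
  rewrite ge0_sume_distrr//; apply: congr_big_nat => // j /= jM.
  by rewrite muleA -EFinM /iM jM mul1r pg.
have PM0 : 0 <= PM by rewrite /PM sumr_ge0.
rewrite lee_wpmul2l ?lee_fin// /B -wexp_sum//; last first.
  by move=> j w; rewrite lee_fin !mulr_ge0.
(* Tails of words of [W] with an interchangeable first letter. Each occurs in only one of the [B j],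
   and again there is at most one of them per class. *)
pose U w := box w && has (fun j => W (j :: w)) (index_iota 0 M).
apply: (@le_trans _ _ (wexp p m (fun w => (expR (lgain w) * psi w * (U w)%:R)%:E))).
  apply: le_wexp => // w _.
    by apply: sume_ge0 => j _; rewrite lee_fin !mulr_ge0.
  rewrite sumEFin lee_fin -mulr_sumr /U /psi.
  have [bw|] := boolP (box w); last by rewrite !(mulr0, mul0r).
  rewrite ler_wpM2l ?mulr_ge0//=; have [|nW] := boolP (has _ _); last first.
    rewrite big_seq big1// => j jM; apply/eqP; rewrite pnatr_eq0 eqb0.
    by apply: contra nW => Wj; apply/hasP; exists j.
  move=> /hasP[j jM Wj]; rewrite (bigD1_seq j) ?iota_uniq//= Wj.
  rewrite big_seq_cond big1 ?addr0// => i /andP[iM' ij].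
  apply/eqP; rewrite pnatr_eq0 eqb0; apply: contra ij => Wi; apply/eqP.
  move: jM iM'; rewrite !mem_index_iota /= => jM iM'.
  by have := Wuniq _ _ Wi Wj; rewrite /= sim_refl iM' jM bw orbT => /(_ isT)[].
apply: IH => //.
- move=> w v /andP[bw /hasP[i + Wi]] /andP[_ /hasP[j + Wj]] wv.
  rewrite !mem_index_iota /= => iM' jM.
  by have := Wuniq _ _ Wi Wj; rewrite /= wv iM' jM bw orbT => /(_ isT)[].
- move=> w v wv; rewrite /psi (sim_box wv); congr (_ * _).
  by apply: phisim; rewrite /= wv.
Qed.

End Overlap.

(** * Linear growth of the saved weight along a word *)

Section GainWalk.
Context {R : realType} (p : nat -> R).
Hypothesis p_ge0 : forall j, 0 <= p j.
Hypothesis p_sum1 : (\sum_(0 <= j <oo) (p j)%:E = 1)%E.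

Fixpoint nbad (L : nat) (N : nat -> nat) (w : seq nat) : nat :=
  if w is j :: u then (nbad L N u + ~~ box L N u)%N else 0%N.

(** A tail is outside the box either because it has fewer than L letters, which happens L times at
    most, or because its letter at some offset l is at least N l. A letter is charged at most once
    for each offset. *)
Lemma nbad_le L N w :
  (nbad L N w <= L + \sum_(j <- w) \sum_(0 <= l < L) (N l <= j))%N.
Proof.
pose c w := (\sum_(0 <= l < L) count (leq (N l)) (drop l.+1 w))%N.
have nbad_size u : (nbad L N u <= size u)%N.
  by elim: u => //= j u IH; case: (box L N u) => /=; lia.
have H u : (nbad L N u <= minn (size u) L + c u)%N.
  elim: u => [//|j u IH]; have [uL|uL] := ltnP (size u) L.
    by have := nbad_size (j :: u) => /= h; lia.
  suff : (~~ box L N u + c u <= c (j :: u))%N by move: IH => /=; lia.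
  have cE l : (0 <= l < L)%N ->
    count (leq (N l)) (drop l.+1 (j :: u)) =
    ((N l <= nth 0 u l) + count (leq (N l)) (drop l.+1 u))%N.
    by move=> /= lL; rewrite /= (drop_nth 0%N) ?(leq_trans lL).
  rewrite {2}/c (eq_big_nat _ _ cE) big_split /= leq_add2r /box uL /=.
  case: allPn => // -[l]; rewrite mem_iota add0n /= => lL.
  rewrite -leqNgt => h; rewrite (bigD1_seq l) ?mem_index_iota ?iota_uniq//= h.
  by [].
apply: leq_trans (H w) _; apply: leq_add; first exact: geq_minr.
rewrite exchange_big /= /c; apply: leq_sum => l _.
have -> : (\sum_(j <- w) (N l <= j) = count (leq (N l)) w)%N.
  by rewrite -sum1_count [RHS]big_mkcond; apply: eq_bigr => j _; case: leqP.
by rewrite -{2}(cat_take_drop l.+1 w) count_cat leq_addl.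
Qed.

(** The bounds [N] are fixed before L, since L will come from a compactness argument that depends on
    [N]; summable tail probabilities make the loss uniform in L. Each letter earns its g and pays G
    for every offset at which it may spoil the gain of an earlier letter; the mean net gain still
    exceeds b. *)
Lemma gain_walk (M : nat) (b : R) (g : nat -> R) :
  (forall j, (j < M)%N -> 0 <= g j) ->
  b < \sum_(0 <= j < M) p j * g j ->
  exists2 N : nat -> nat, forall l, (M <= N l)%N &
    forall L, exists xi : nat -> R, exists theta : R, exists C : R,
      [/\ 0 < theta, (lexp p (fun j => (expR (- (theta * xi j)))%:E) <= 1)%E &
        forall w, (size w)%:R * b - wmax xi w - C <= lgain M L N g w].
Proof.
move=> g0 bH; set H := \sum_(_ <= _ < _) _ in bH.
pose G := \sum_(0 <= j < M) g j.
have G0 : 0 <= G by rewrite /G big_nat sumr_ge0// => j /andP[_]; exact: g0.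
have gG j : (j < M)%N -> g j <= G.
  move=> jM; rewrite /G (bigD1_seq j) ?mem_index_iota ?iota_uniq//= lerDl.
  rewrite big_seq_cond sumr_ge0// => i /andP[]; rewrite mem_index_iota => /andP[_].
  by move=> iM _; exact: g0.
(* The mean loss per letter is then at most G e < (H - b) / 2; adding 1 to G covers the case G =
   0. *)
pose e := (H - b) / (2 * (G + 1)).
have e0 : 0 < e by rewrite divr_gt0 ?subr_gt0// mulr_gt0//; lra.
have tail (l : nat) : exists2 n, (M <= n)%N &
    (lexp p (fun j => (n <= j)%N%:R%:E) <= (e * 2^-1 ^+ l.+1)%:E)%E.
  have := @nneseries_tail_cvg R (fun j => (p j)%:E) xpredT.
  rewrite p_sum1 ltry => /(_ isT) H0.
  have {H0} : (\sum_(n <= k <oo) (p k)%:E)%E @[n --> \oo] --> (0 : \bar R)%E.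
    by apply: H0 => j _; rewrite lee_fin.
  move=> /fine_cvgP[_ /cvgrPdist_lt /(_ (e * 2^-1 ^+ l.+1))].
  rewrite mulr_gt0 ?exprn_gt0 ?invr_gt0// => /(_ isT).
  move=> [n _ /(_ (maxn n M)) /=]; rewrite leq_maxl => /(_ isT).
  set t := limn _; rewrite sub0r normrN => tl.
  exists (maxn n M); first exact: leq_maxr.
  have t0 : (0 <= t)%E by apply: nneseries_ge0 => *; rewrite lee_fin.
  have tf : t \is a fin_num.
    rewrite ge0_fin_numE// (le_lt_trans _ (ltry 1))// -p_sum1.
    by rewrite /t eseries_cond; apply: subset_lee_nneseries => // j; rewrite lee_fin.
  have -> : lexp p (fun j => (maxn n M <= j)%N%:R%:E) = t.
    rewrite /t eseries_cond eseries_mkcond; apply: eq_eseriesr => j _ /=.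
    by case: leqP => _; rewrite ?mule1 ?mule0.
  by rewrite -(fineK tf) lee_fin (le_trans (ler_norm _))// ltW.
have [N NM Ntail] : exists2 N : nat -> nat, forall l, (M <= N l)%N &
    forall l, (lexp p (fun j => (N l <= j)%N%:R%:E) <= (e * 2^-1 ^+ l.+1)%:E)%E.
  have /choice[N HN] l : exists n, (M <= n)%N /\
      (lexp p (fun j => (n <= j)%N%:R%:E) <= (e * 2^-1 ^+ l.+1)%:E)%E.
    by have [n ? ?] := tail l; exists n.
  by exists N => l; have [] := HN l.
exists N => // L.
pose v j : R := (\sum_(0 <= l < L) (N l <= j)%N)%:R.
pose g1 j : R := if (j < M)%N then g j else 0.
pose xi j := g1 j - G * v j - b.
pose Z := G + G * L%:R + `|b|.
have v0 j : 0 <= v j by [].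
have vL j : v j <= L%:R.
  rewrite ler_nat (leq_trans (n := \sum_(0 <= l < L) 1)%N)//.
    by apply: leq_sum => l _; exact: leq_b1.
  by rewrite sum_nat_const_nat muln1 subn0.
have g1_ge0 j : 0 <= g1 j by rewrite /g1; case: ifPn => // /g0.
have g1G j : g1 j <= G by rewrite /g1; case: ifPn => // /gG.
have GvL j : 0 <= G * v j <= G * L%:R by rewrite mulr_ge0//= ler_wpM2l.
have xiZ j : `|xi j| <= Z.
  rewrite ler_norml /xi /Z; have := GvL j; have := g1_ge0 j; have := g1G j.
  by move=> h1 h2 /andP[h3 h4]; have := ler_norm (- b); rewrite normrN; have := ler_norm b; lra.
have lv : (lexp p (EFin \o v) <= e%:E)%E.
  have -> : lexp p (EFin \o v) =
      (\sum_(0 <= l < L) lexp p (fun j => (N l <= j)%N%:R%:E))%E.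
    have := @wexp_sum R p p_ge0 1 nat (index_iota 0 L)
      (fun l w => (N l <= head 0 w)%N%:R%:E) => /= <-; last first.
      by move=> l w; rewrite lee_fin.
    by apply: eq_lexp => j /=; rewrite sumEFin /v natr_sum.
  apply: (@le_trans _ _ (\sum_(0 <= l < L) (e * 2^-1 ^+ l.+1)%:E)%E).
    exact: lee_sum.
  rewrite sumEFin lee_fin -mulr_sumr ler_piMr// ?(ltW e0)//.
  elim: L {v v0 vL xi Z GvL xiZ} => [|L]; first by rewrite big_nil.
  suff H2 n : \sum_(0 <= i < n) (2^-1 : R) ^+ i.+1 = 1 - 2^-1 ^+ n.
    by move=> _; rewrite H2 gerBl exprn_ge0// invr_ge0.
  elim: n => [|n IH]; first by rewrite big_nil expr0 subrr.
  by rewrite big_nat_recr//= IH exprS; lra.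
have Z0 : 0 <= Z by exact: le_trans (xiZ 0%N).
have lg1 : lexp p (EFin \o g1) = H%:E.
  rewrite (@lexp_finite _ _ p_ge0 M).
  - rewrite /H -sumEFin; apply: congr_big_nat => // j /= jM.
    by rewrite /g1 jM.
  - by move=> j; rewrite lee_fin.
  - by move=> j; rewrite /g1 /= ltnNge => ->.
have Zb : 0 <= Z - b by rewrite /Z; have := ler_norm b; have := GvL 0%N; lra.
have xiZ0 j : 0 <= xi j + Z by have := xiZ j; rewrite ler_norml => /andP[]; lra.
have mean : ((Z + (H - b) / 2)%:E <= lexp p (fun j => (xi j + Z)%:E))%E.
  have E : ((H + (Z - b))%:E = lexp p (fun j => (xi j + Z)%:E) +
      G%:E * lexp p (EFin \o v))%E.
    rewrite EFinD -lg1 -[(Z - b)%:E](lexp_cst p_ge0 p_sum1 Zb) -lexpD// -lexpZ//.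
    rewrite -lexpD//; last by move=> j; rewrite -EFinM lee_fin mulr_ge0.
    apply: eq_lexp => j; rewrite -EFinM -!EFinD; congr (_%:E).
    by rewrite /xi /=; ring.
  have Ge : (G%:E * lexp p (EFin \o v) <= ((H - b) / 2)%:E)%E.
    apply: (@le_trans _ _ (G%:E * e%:E)%E); first by rewrite lee_wpmul2l ?lee_fin.
    rewrite -EFinM lee_fin /e mulrA ler_pdivrMr ?mulr_gt0//; last by lra.
    by have := bH; nra.
  rewrite -(@leeD2rE _ ((H - b) / 2)%:E)// -EFinD.
  have -> : Z + (H - b) / 2 + (H - b) / 2 = H + (Z - b) by field.
  by rewrite E leeD2l.
have Hb : 0 < (H - b) / 2 by rewrite divr_gt0 ?subr_gt0.
have [t t0 tE] := exponential_moment_le1 p_ge0 p_sum1 xiZ Hb mean.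
(* The constant G L pays for the last L positions, which have too few letters after them. *)
exists xi, t, (G * L%:R); split => // w.
have sxi : - \sum_(j <- w) xi j <= wmax xi w by have := wmax_take xi w (size w); rewrite take_size.
have sE : \sum_(j <- w) xi j =
    \sum_(j <- w) g1 j - G * \sum_(j <- w) v j - (size w)%:R * b.
  elim: w {sxi} => [|j w IH]; first by rewrite !big_nil /=; lra.
  by rewrite !big_cons IH /= -[(size w).+1]addn1 natrD /xi; ring.
have lgE u : \sum_(j <- u) g1 j - G * (nbad L N u)%:R <= lgain M L N g u.
  elim: u => [|j u IH] /=; first by rewrite big_nil mulr0 subrr.
  rewrite big_cons natrD mulrDr {1}/g1.
  by case: (ltnP j M) => [/gG|] jM; case: (box L N u) => /=; move: IH; lra.
have : (nbad L N w)%:R <= L%:R + \sum_(j <- w) v j.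
  have := nbad_le L N w; rewrite -(ler_nat R) natrD natr_sum => /le_trans; apply.
  by rewrite lerD2l.
by move=> /(ler_wpM2l G0); rewrite mulrDr; have := lgE w; lra.
Qed.

End GainWalk.

(** * Norms and similarities *)

Lemma lipschitz_within_continuous (R : realType) (V W : normedModType R)
    (X : set V) (f : V -> W) (C : R) :
  (forall x y, X x -> X y -> `|f x - f y| <= C * `|x - y|) ->
  {within X, continuous f}.
Proof.
move=> fC; apply/subspace_continuousP => x Xx; apply/cvgrPdist_le => e e0.
near=> y; have Xy : X y by near: y; exact: withinT.
apply: (le_trans (fC _ _ Xx Xy)).
apply: (@le_trans _ _ ((`|C| + 1) * `|x - y|)).
  by rewrite ler_wpM2r//; have := ler_norm C; lra.
rewrite mulrC -ler_pdivlMr ?ltr_wpDl//.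
near: y; apply: cvg_within; apply: cvgr_dist_le => //.
by rewrite divr_gt0// ltr_wpDl.
Unshelve. all: by end_near. Qed.

Section Norm.
Context {R : realType} {k : nat} (N : 'rV[R]_k -> R).
Hypothesis normN : is_norm N.

Let ND : forall x y, N (x + y) <= N x + N y. Proof. by case: normN. Qed.
Let NZ : forall (a : R) x, N (a *: x) = `|a| * N x. Proof. by case: normN. Qed.

Lemma vnorm0 : N 0 = 0.
Proof. by rewrite -(scale0r (0 : 'rV[R]_k)) NZ normr0 mul0r. Qed.

Lemma vnormN x : N (- x) = N x.
Proof. by rewrite -scaleN1r NZ normrN1 mul1r. Qed.

Lemma vnorm_ge0 x : 0 <= N x.
Proof. by have := ND x (- x); rewrite subrr vnorm0 vnormN; lra. Qed.

Lemma distC x y : dist N x y = dist N y x.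
Proof. by rewrite /dist -vnormN opprB. Qed.

Lemma dist_ge0 x y : 0 <= dist N x y. Proof. exact: vnorm_ge0. Qed.

Lemma distxx x : dist N x x = 0. Proof. by rewrite /dist subrr vnorm0. Qed.

Lemma dist_eq0 x y : dist N x y = 0 -> x = y.
Proof. by case: normN => _ _ N0 /N0 /eqP; rewrite subr_eq0 => /eqP. Qed.

Lemma dist_triangle y x z : dist N x z <= dist N x y + dist N y z.
Proof. by have := ND (x - y) (y - z); rewrite addrA subrK. Qed.

Lemma vnorm_sum (I : Type) (r : seq I) (f : I -> 'rV[R]_k) :
  N (\sum_(i <- r) f i) <= \sum_(i <- r) N (f i).
Proof.
elim: r => [|i r IH]; first by rewrite !big_nil vnorm0.
by rewrite !big_cons (le_trans (ND _ _))// lerD2l.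
Qed.

Lemma vnorm_le_norm : exists2 C, 0 < C & forall x, N x <= C * `|x|.
Proof.
pose C := \sum_(i <- enum 'I_k) N (delta_mx 0 i).
have C0 : 0 <= C by apply: sumr_ge0 => i _; exact: vnorm_ge0.
exists (C + 1) => [|x]; first by lra.
rewrite {1}(row_sum_delta x) -big_enum /=.
apply: le_trans (vnorm_sum _ _) _.
apply: (@le_trans _ _ (C * `|x|)); last by rewrite ler_wpM2r//; lra.
rewrite /C mulr_suml; apply: ler_sum => i _.
rewrite NZ mulrC ler_wpM2l ?vnorm_ge0//.
rewrite [leRHS]/Num.norm /= mx_normrE; apply/bigmax_geP; right => /=.
by exists (ord0, i).
Qed.

Lemma vnorm_continuous : continuous N.
Proof.
have [C C0 NC] := vnorm_le_norm.
apply/continuous_subspace_setT.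
apply: (@lipschitz_within_continuous R 'rV[R]_k R _ _ C) => x y _ _.
rewrite ler_norml; have := ND (x - y) y; have := ND (y - x) x.
rewrite !subrK; have := NC (x - y); have := NC (y - x).
by rewrite distrC; lra.
Qed.

Lemma norm_le_vnorm : exists2 c, 0 < c & forall x, c * `|x| <= N x.
Proof.
pose A : set 'rV[R]_k := [set x | `|x| = 1].
(* The unit sphere is empty when k = 0; then 0 is the only vector. *)
have [A0|/set0P/negP/negPn/eqP A0] := pselect (A !=set0); last first.
  exists 1 => // x; have [->|x0] := eqVneq x 0.
    by rewrite normr0 mulr0 vnorm_ge0.
  suff : A (`|x|^-1 *: x) by rewrite A0.
  by rewrite /A /= normrZ normfV normr_id mulVf// normr_eq0.
have Ac : compact A.
  apply: bounded_closed_compact.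
    by exists 1; split => // M M1 x /= ->; exact: ltW.
  rewrite (_ : A = (fun x : 'rV[R]_k => `|x|) @^-1` [set 1]); last by [].
  apply: preimage_closed; last exact: closed_eq.
  by move=> x _; exact: norm_continuous.
have [a] := @EVT_min_rV R k N A A0 Ac (continuous_subspaceT vnorm_continuous).
rewrite inE => Aa amin.
exists (N a) => [|x].
  rewrite lt_neqAle vnorm_ge0 andbT; apply/eqP => /esym Na.
  case: normN => _ _ /(_ _ Na) a0; move: Aa; rewrite /A /= a0 normr0.
  by move/eqP; rewrite eq_sym oner_eq0.
have [->|x0] := eqVneq x 0; first by rewrite normr0 mulr0 vnorm_ge0.
have nx : 0 < `|x| by rewrite normr_gt0.
have := amin (`|x|^-1 *: x); rewrite inE /A /= normrZ normfV normr_id mulVf ?gt_eqF//.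
by move=> /(_ erefl); rewrite NZ normfV normr_id mulrC ler_pdivlMr.
Qed.

Lemma dist_continuous a : continuous (dist N a).
Proof.
have [C C0 NC] := vnorm_le_norm.
apply/continuous_subspace_setT.
apply: (@lipschitz_within_continuous R 'rV[R]_k R _ _ C) => x y _ _.
apply: le_trans (NC (x - y)); rewrite -/(dist N x y) ler_norml.
have := dist_triangle x a y; have := dist_triangle y a x.
by rewrite (distC y x); lra.
Qed.

Lemma closed_dball a (r : R) : closed [set x | dist N a x <= r].
Proof.
rewrite (_ : mkset _ = dist N a @^-1` [set y | y <= r])//.
by apply: preimage_closed; [move=> x _; exact: dist_continuous|exact: closed_le].
Qed.

Section Similarity.
Variables (X : set 'rV[R]_k) (f : 'rV[R]_k -> 'rV[R]_k) (r : R).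
Hypothesis simf : similarity_on N X f r.

Lemma similarity_continuous : {within X, continuous f}.
Proof.
have [C C0 NC] := vnorm_le_norm; have [c c0 cN] := norm_le_vnorm.
apply: (@lipschitz_within_continuous R 'rV[R]_k 'rV[R]_k _ _ (c^-1 * (`|r| * C))).
move=> x y Xx Xy; rewrite -mulrA ler_pdivlMl// (le_trans (cN _))//.
have := simf (mem_set Xx) (mem_set Xy); rewrite /dist => ->.
rewrite -mulrA (le_trans (ler_wpM2r (vnorm_ge0 _) (ler_norm r)))//.
by rewrite ler_wpM2l.
Qed.

End Similarity.

Lemma compact_dist_bounded X : compact X ->
  exists2 D, 0 < D & forall x y, X x -> X y -> dist N x y <= D.
Proof.
have [C C0 NC] := vnorm_le_norm.
move=> /compact_bounded [M [_ HM]].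
have {}HM x : X x -> `|x| <= `|M| + 1.
  by move=> Xx; apply: (HM (`|M| + 1)) => //; have := ler_norm M; lra.
have MM : 0 < `|M| + 1 by rewrite ltr_wpDl.
exists (C * (2 * (`|M| + 1))) => [|x y Xx Xy]; first by rewrite !mulr_gt0.
apply: (le_trans (NC _)); rewrite ler_pM2l//.
by apply: (le_trans (ler_normB _ _)); have := HM _ Xx; have := HM _ Xy; lra.
Qed.

Lemma nearest_point (X : set 'rV[R]_k) (f : 'rV[R]_k -> 'rV[R]_k) a :
   X !=set0 -> compact X -> {within X, continuous f} ->
  exists2 y, X y & forall z, X z -> dist N a (f y) <= dist N a (f z).
Proof.
move=> X0 cX cf; have cd : {within X, continuous (dist N a \o f)}.
  apply/subspace_continuousP => x Xx; move/subspace_continuousP : cf => /(_ x Xx) cf.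
  apply: cvg_comp cf _; exact: dist_continuous.
have [y + ymin] := @EVT_min_rV R k _ X X0 cX cd; rewrite inE => Xy.
by exists y => // z Xz; apply: ymin; rewrite inE.
Qed.

End Norm.

(** * The iterated function system *)

(** An extendable word has an extendable continuation by one letter: otherwise each letter of the
    finite set C l dies out at some depth, while a word reaching the largest of these depths passes
    through one of the letters. *)
Lemma koenig (T : choiceType) (t0 : T) (C : nat -> seq T) (A : seq T -> Prop) :
  (forall z t, A (rcons z t) -> A z) ->
  (forall n, exists z, [/\ size z = n, A z &
     forall l, (l < n)%N -> nth t0 z l \in C l]) ->
  exists2 w : nat -> T, forall n, A (mkseq w n) & forall l, w l \in C l.
Proof.
move=> Apre Aex.
have Atake z n : A z -> A (take n z).
  elim/last_ind: z n => [//|z t IH] n Azt; have [nz|nz] := leqP n (size z).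
    by rewrite -cats1 takel_cat//; exact/IH/Apre/Azt.
  by rewrite take_oversize// size_rcons.
pose B z := A z /\ forall l, (l < size z)%N -> nth t0 z l \in C l.
pose ext z := forall n, (size z <= n)%N ->
  exists z', [/\ size z' = n, B z' & take (size z) z' = z].
have ext0 : ext [::].
  move=> n _; have [z [zn Az Cz]] := Aex n.
  by exists z; split => //; [split => // l; rewrite zn; exact: Cz|rewrite take0].
have extS z : exists t, ext z -> t \in C (size z) /\ ext (rcons z t).
  have [ez|nez] := pselect (ext z); last by exists t0.
  apply: contrapT => no.
  have bad t : exists n, t \in C (size z) -> (size z < n)%N /\
      ~ exists z', [/\ size z' = n, B z' & take (size z).+1 z' = rcons z t].
    have [tC|tC] := boolP (t \in C (size z)); last by exists 0%N.
    apply: contrapT => no2; apply: no; exists t => _; split => // n zn.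
    apply: contrapT => no3; apply: no2; exists n => _; move: zn no3.
    by rewrite size_rcons.
  have [f Hf] := choice bad.
  pose n := (maxn (size z).+1 (\max_(t <- C (size z)) f t)).
  have zn : (size z < n)%N by rewrite /n leq_max ltnSn.
  have [z' [z'n [Az' Cz'] zz']] := ez n (ltnW zn).
  have tC : nth t0 z' (size z) \in C (size z) by apply: Cz'; rewrite z'n.
  have [zf []] := Hf _ tC; set t := nth t0 z' (size z) in tC zf *.
  have fn : (f t <= n)%N.
    rewrite /n leq_max; apply/orP; right.
    exact: (leq_bigmax_seq t).
  exists (take (f t) z'); split.
  - by rewrite size_takel// z'n.
  - split; first exact: Atake.
    move=> l; rewrite size_takel ?z'n// => lf; rewrite nth_take//.
    by apply: Cz'; rewrite z'n (leq_trans lf).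
  - by rewrite take_takel// -[in RHS]zz' /t (take_nth t0) ?z'n.
have [f Hf] := choice extS.
pose zz := fix zz n := if n is m.+1 then rcons (zz m) (f (zz m)) else [::].
have zs n : size (zz n) = n by elim: n => //= n; rewrite size_rcons => ->.
have ez n : ext (zz n) by elim: n => //= n /Hf[].
have zE n : zz n = mkseq (f \o zz) n.
  elim: n => //= n IH; rewrite {1}IH /mkseq -[in RHS]addn1 iotaD map_cat.
  by rewrite -cats1.
exists (f \o zz) => n.
  by rewrite -zE; have [z' [_ [Az' _] <-]] := ez n _ (leqnn _); exact: Atake.
by have [] := Hf _ (ez n); rewrite zs.
Qed.

Section IFS.
Context {R : realType} {k : nat} (N : 'rV[R]_k -> R).
Hypothesis normN : is_norm N.
Variables (X : set 'rV[R]_k) (S : nat -> 'rV[R]_k -> 'rV[R]_k) (s : nat -> R).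
Hypothesis X_neq0 : X !=set0.
Hypothesis X_compact : compact X.
Hypothesis S_stable : forall j, set_fun X X (S j).
Hypothesis S_similarity : forall j, similarity_on N X (S j) (s j).
Hypothesis s_gt0 : forall j, 0 < s j.
Variable smax : R.
Hypothesis s_le : forall j, s j <= smax.
Hypothesis smax_lt1 : smax < 1.

Let smax_gt0 : 0 < smax. Proof. exact: lt_le_trans (s_gt0 0) (s_le 0). Qed.

Fixpoint smap (w : seq nat) (x : 'rV[R]_k) : 'rV[R]_k :=
  if w is j :: u then S j (smap u x) else x.

Definition sprod (w : seq nat) : R := \prod_(j <- w) s j.

Lemma sprod_cons j w : sprod (j :: w) = s j * sprod w.
Proof. by rewrite /sprod big_cons. Qed.

Lemma sprod_gt0 w : 0 < sprod w.
Proof. by rewrite /sprod prodr_gt0. Qed.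

Lemma sprod_le w : sprod w <= smax ^+ size w.
Proof.
elim: w => [|j w IH]; first by rewrite /sprod big_nil.
by rewrite sprod_cons exprS ler_pM// ltW// sprod_gt0.
Qed.

Lemma sprod_le1 w : sprod w <= 1.
Proof. by rewrite (le_trans (sprod_le w))// exprn_ile1// ltW. Qed.

Lemma smap_stable w x : X x -> X (smap w x).
Proof. by move=> Xx; elim: w => //= j w /(S_stable j). Qed.

Lemma smap_cat u v x : smap (u ++ v) x = smap u (smap v x).
Proof. by elim: u => //= j u ->. Qed.

Lemma dist_smap w x y : X x -> X y ->
  dist N (smap w x) (smap w y) = sprod w * dist N x y.
Proof.
move=> Xx Xy; elim: w => [|j w IH] /=; first by rewrite /sprod big_nil mul1r.
rewrite (S_similarity j) ?inE; [|exact: smap_stable..].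
by rewrite IH sprod_cons mulrA.
Qed.

Lemma smap_similarity w : similarity_on N X (smap w) (sprod w).
Proof. by move=> x y; rewrite !inE; exact: dist_smap. Qed.

Lemma word_mapE (w : nat -> nat) n x : word_map S w n x = smap (mkseq w n) x.
Proof.
elim: n x => [//|n IH] x.
by rewrite [LHS]/= IH mkseqS -cats1 smap_cat.
Qed.

Lemma compact_smap w : compact (smap w @` X).
Proof.
apply: continuous_compact => //.
exact: similarity_continuous (smap_similarity w).
Qed.

Lemma closed_smap w : closed (smap w @` X).
Proof.
by apply: compact_closed; [exact: norm_hausdorff|exact: compact_smap].
Qed.


Lemma smap_mkseq_sub w m n : (m <= n)%N ->
  smap (mkseq w n) @` X `<=` smap (mkseq w m) @` X.
Proof.
move=> mn _ [x Xx <-]; rewrite -(subnKC mn) /mkseq iotaD map_cat smap_cat.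
by exists (smap [seq w i | i <- iota (0 + m) (n - m)] x) => //; exact: smap_stable.
Qed.

Lemma coding_map_mem w n : (smap (mkseq w n) @` X) (coding_map S X w).
Proof.
have /xgetPex /= H : exists x, (\bigcap_(n in [set n | (1 <= n)%N])
    (word_map S w n @` X)) x.
  have smapE m : word_map S w m @` X = smap (mkseq w m) @` X.
    by apply: eq_imagel => x _; exact: word_mapE.
  suff [x Hx] : \bigcap_(n in [set n | (1 <= n)%N]) (smap (mkseq w n) @` X) !=set0.
    by exists x => m m1; rewrite smapE; exact: Hx.
  have := X_compact; rewrite compact_In0 => /(_ nat); apply.
    exists (fun m => smap (mkseq w m) @` X) => m _; first exact: closed_smap.
    apply/esym/setIidPr => x Hx.
    by have [y Xy <-] := @smap_mkseq_sub w 0%N m (leq0n _) _ Hx.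
  move=> D' D'1; have [x0 Xx0] := X_neq0.
  exists (smap (mkseq w (\max_(i <- finmap.enum_fset D') i)) x0) => m /= mD'.
  by apply: (smap_mkseq_sub (leq_bigmax_seq m mD' isT)); exists x0.
(* The intersection in [coding_map] starts at length 1, so n = 0 is reached through n + 1 and
   nesting. *)
have := H 0 n.+1 isT; rewrite (eq_imagel (f' := smap (mkseq w n.+1))).
  exact: smap_mkseq_sub.
by move=> x _; exact: word_mapE.
Qed.

Lemma eq_of_dist_le C x y :
  (forall n, dist N x y <= C * smax ^+ n + n.+1%:R^-1) -> x = y.
Proof.
move=> xy; apply: (dist_eq0 normN); apply/eqP; rewrite eq_le dist_ge0// andbT.
apply/ler_addgt0Pr => e e0; rewrite add0r.
have lim : C * smax ^+ n + n.+1%:R^-1 @[n --> \oo] --> C * 0 + 0.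
  apply: cvgD; last exact: cvg_harmonic.
  by apply: cvgMl_tmp; apply: cvg_expr; rewrite gtr0_norm.
move: lim; rewrite mulr0 addr0 => /cvgrPdist_le /(_ _ e0) [n _ /(_ n (leqnn _))].
by rewrite /= sub0r normrN => /(le_trans (ler_norm _)); apply: le_trans.
Qed.

Lemma coding_map_uniq w1 w2 :
  (forall n, exists x y, [/\ X x, X y &
     dist N (smap (mkseq w1 n) x) (smap (mkseq w2 n) y) < n.+1%:R^-1]) ->
  coding_map S X w1 = coding_map S X w2.
Proof.
move=> w12; have [D D0 XD] := compact_dist_bounded normN X_compact.
have near w n x : X x -> dist N (coding_map S X w) (smap (mkseq w n) x) <= D * smax ^+ n.
  move=> Xx; have [z Xz <-] := coding_map_mem w n.
  rewrite dist_smap// mulrC ler_pM ?(ltW (sprod_gt0 _))// ?dist_ge0// ?XD//.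
  by have := sprod_le (mkseq w n); rewrite size_mkseq.
apply: (eq_of_dist_le (C := 2 * D)) => n.
have [x [y [Xx Xy xy]]] := w12 n.
have := near w1 n x Xx; have := near w2 n y Xy; rewrite (distC normN (coding_map S X w2)).
have := dist_triangle normN (smap (mkseq w1 n) x) (coding_map S X w1) (coding_map S X w2).
have := dist_triangle normN (smap (mkseq w2 n) y) (smap (mkseq w1 n) x) (coding_map S X w2).
rewrite -mulrA; move: (D * _) (n.+1%:R^-1) xy => d e; lra.
Qed.

(** For every n both points lie in the piece of the first n + 1 letters of w, whose diameter tends
    to 0. *)
Lemma coding_map_shift w :
  coding_map S X w = S (w 0%N) (coding_map S X (fun n => w n.+1)).
Proof.
have [D D0 XD] := compact_dist_bounded normN X_compact.
apply: (eq_of_dist_le (C := D)) => n.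
have [z Xz <-] := coding_map_mem (fun n => w n.+1) n.
have [y Xy <-] := coding_map_mem w n.+1.
have -> : mkseq w n.+1 = w 0%N :: mkseq (fun n => w n.+1) n.
  by rewrite /mkseq /= -(addn0 1%N) iotaDl -map_comp.
rewrite [X in dist _ X _]/= S_similarity ?inE; [|exact: smap_stable..].
rewrite dist_smap// mulrA (le_trans (y := D * smax ^+ n))//; last first.
  by rewrite lerDl invr_ge0.
rewrite mulrC ler_pM ?XD ?dist_ge0// ?mulr_ge0// ?(ltW (sprod_gt0 _)) ?(ltW (s_gt0 _))//.
have := sprod_le (mkseq (fun n => w n.+1) n); rewrite size_mkseq.
by apply: le_trans; rewrite ler_piMl ?(ltW (sprod_gt0 _))// (le_trans (s_le _))// ltW.
Qed.

Hypothesis S_separated : strong_separation S X.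

(* A failure of the bound at all depths would produce, by Koenig's lemma, two
   codings with distinct first letters and the same image. *)
Lemma uniform_separation (M : nat) (K : nat -> nat) :
  exists L : nat, exists2 c : R, 0 < c &
  forall i j u v x y, (i < M)%N -> (j < M)%N -> i <> j ->
    box L K u -> box L K v -> X x -> X y ->
    c <= dist N (smap (i :: u) x) (smap (j :: v) y).
Proof.
apply: contrapT => no.
have far L : exists i j u v x y, [/\ ((i < M) && (j < M))%N, i <> j,
    [/\ size u = L, size v = L & forall l, (l < L)%N ->
      ((nth 0 u l < K l) && (nth 0 v l < K l))%N], X x /\ X y &
    dist N (smap (i :: u) x) (smap (j :: v) y) < L.+2%:R^-1].
  (* The index L + 2 anticipates [A] below, which asks L + 1 pairs of letters for a distance below 1
     / (L + 2). *)
  apply: contrapT => no2; apply: no; exists L, L.+2%:R^-1; first by rewrite invr_gt0.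
  move=> i j u v x y iM jM ij /andP[Lu /allP ub] /andP[Lv /allP vb] Xx Xy.
  rewrite leNgt; apply/negP => h; apply: no2.
  exists i, j, (take L u), (take L v), (smap (drop L u) x), (smap (drop L v) y).
  split => //.
  - by rewrite iM jM.
  - rewrite !size_takel//; split => // l lL.
    by rewrite !nth_take// ub ?vb// mem_iota add0n.
  - by split; exact: smap_stable.
  - by rewrite [smap (i :: _) _]/= [smap (j :: _) _]/= -!smap_cat !cat_take_drop.
pose T := (nat * nat)%type.
(* Position 0 carries the two distinct first letters, so the bounds [K] are shifted by one. *)
pose C (l : nat) : seq T :=
  let n := if l is l'.+1 then K l' else M in
  [seq (i, j) | i <- iota 0 n, j <- iota 0 n].
pose A (z : seq T) := (if z is t :: _ then t.1 <> t.2 else True) /\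
  exists x y, [/\ X x, X y &
    dist N (smap (unzip1 z) x) (smap (unzip2 z) y) < (size z).+1%:R^-1].
have Apre z t : A (rcons z t) -> A z.
  move=> [hd [x [y [Xx Xy xy]]]]; split; first by case: z hd xy.
  exists (S t.1 x), (S t.2 y); split; try exact: S_stable.
  move: xy; rewrite /unzip1 /unzip2 !map_rcons -!cats1 !smap_cat/= size_cat addn1.
  by move=> /lt_le_trans; apply; rewrite lef_pV2 ?posrE// ler_nat.
have Aex n : exists z, [/\ size z = n, A z &
    forall l, (l < n)%N -> nth (0%N, 0%N) z l \in C l].
  have [i [j [u [v [x [y [/andP[iM jM] ij [su sv uv] [Xx Xy] xy]]]]]]] := far n.
  have : A ((i, j) :: zip u v).
    split => //; exists x, y; split => //.
    by rewrite /= size_zip su sv minnn -/(unzip1 _) -/(unzip2 _)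
      unzip1_zip ?unzip2_zip ?su ?sv.
  have : forall l, (l < n.+1)%N -> nth (0%N, 0%N) ((i, j) :: zip u v) l \in C l.
    case=> [_|l /= ln]; first by apply/allpairsP; exists (i, j); rewrite !mem_iota.
    have /andP[h1 h2] := uv l ln.
    rewrite nth_zip ?su ?sv//; apply/allpairsP.
    by exists (nth 0%N u l, nth 0%N v l); rewrite !mem_iota.
  have : size ((i, j) :: zip u v) = n.+1 by rewrite /= size_zip su sv minnn.
  (* Depth n provides n + 1 pairs; the last one is dropped to reach length n, including n = 0. *)
  case/lastP: (_ :: _) => // z t; rewrite size_rcons => -[zn] Hz Az.
  exists z; split => //; first exact: Apre Az.
  by move=> l ln; have := Hz l (ltnW ln); rewrite nth_rcons zn ln.
have [w wA wC] := koenig Apre Aex.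
pose w1 n := (w n).1; pose w2 n := (w n).2.
have w12 : w1 0%N <> w2 0%N by have [] := wA 1%N.
have piE : coding_map S X w1 = coding_map S X w2.
  apply: coding_map_uniq => n; have [_ [x [y [Xx Xy xy]]]] := wA n.
  exists x, y; split => //; move: xy.
  by rewrite size_mkseq /unzip1 /unzip2 /mkseq -!map_comp.
suff : (S (w1 0%N) @` limit_set S X `&` S (w2 0%N) @` limit_set S X)
    (coding_map S X w1) by rewrite S_separated.
split; first by rewrite coding_map_shift; eexists => //; eexists.
by rewrite piE coding_map_shift; eexists => //; eexists.
Qed.

Definition near_word (c : R) (a : 'rV[R]_k) (w : seq nat) : Prop :=
  exists2 y, X y & dist N a (smap w y) < c * sprod w.

(** After a common prefix u, separation at the first differing letter puts the two points at
    distance at least c s_u, and s_u dominates the ratios of both words. Two points within c / 2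
    times these ratios of [a] would be closer. *)
Lemma near_word_uniq M K L c : (forall l, (M <= K l)%N) -> 0 < c ->
  (forall i j u v x y, (i < M)%N -> (j < M)%N -> i <> j ->
    box L K u -> box L K v -> X x -> X y ->
    c <= dist N (smap (i :: u) x) (smap (j :: v) y)) ->
  forall a w v, near_word (c / 2) a w -> near_word (c / 2) a v ->
    sim M L K w v -> w = v.
Proof.
move=> MK c0 sep a w v [x Xx ax] [y Xy ay] wv; apply: contrapT => nwv.
suff h : c * Num.max (sprod w) (sprod v) <= dist N (smap w x) (smap v y).
  have := dist_triangle normN a (smap w x) (smap v y).
  rewrite (distC normN _ a).
  have : sprod w <= Num.max (sprod w) (sprod v) by rewrite le_max lexx.
  have : sprod v <= Num.max (sprod w) (sprod v) by rewrite le_max lexx orbT.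
  by move: (Num.max _ _) h ax ay => m; have := c0; nra.
elim: w v nwv wv {ax ay} => [|i w IH] [|j v]//= nwv /andP[wv] ij.
have [eij|/eqP nij] := eqVneq i j.
  rewrite -{}eij in nwv *; rewrite S_similarity ?inE; [|exact: smap_stable..].
  rewrite !sprod_cons -maxr_pMr ?(ltW (s_gt0 _))// mulrCA ler_pM2l//.
  by apply: IH => // e; apply: nwv; rewrite e.
move: ij => /orP[/eqP//|/and3P[iM jM bw]].
have bv : box L K v by rewrite -(sim_box MK wv).
rewrite (le_trans _ (sep _ _ _ _ _ _ iM jM nij bw bv Xx Xy))//.
by rewrite ler_piMr ?(ltW c0)// ge_max !sprod_le1.
Qed.

End IFS.

(** * The self-similar measure *)

Section SelfSimilarMeasure.
Context {R : realType} {k : nat} (N : 'rV[R]_k -> R).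
Hypothesis normN : is_norm N.

Lemma closed_borel (A : set 'rV[R]_k) : closed A -> measurable (A : set (borelRk R k)).
Proof.
move=> cA; rewrite -(setCK A); apply: measurableC.
by apply: sub_sigma_algebra; exact: closed_openC.
Qed.

Lemma within_continuous_borel (X : set 'rV[R]_k) (f : 'rV[R]_k -> 'rV[R]_k) :
  closed X -> {within X, continuous f} ->
  measurable_fun (X : set (borelRk R k)) (f : borelRk R k -> borelRk R k).
Proof.
move=> cX cf.
refine (@measurability _ _ (borelRk R k) (borelRk R k) X f (@open 'rV[R]_k) _ _) => //.
move=> _ [U oU <-].
have /open_subspaceP[V oV VU] : open (f @^-1` U : set (subspace X)).
  by move/continuousP : cf; exact.
rewrite setIC -VU; apply: measurableI; last exact: closed_borel.
by apply: sub_sigma_algebra.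
Qed.

Lemma continuous_borel (f : 'rV[R]_k -> R) :
  continuous f -> measurable_fun [set: borelRk R k] (f : borelRk R k -> R).
Proof.
move=> cf; apply: (measurability _ (measurable_realfun.RGenOpens.measurableE R)) => // _ [_ [a [b ->]] <-].
rewrite setTI; apply: sub_sigma_algebra.
by move/continuousP : cf; apply; exact: interval_open.
Qed.

Variables (X : set 'rV[R]_k) (S : nat -> 'rV[R]_k -> 'rV[R]_k) (s : nat -> R).
Hypothesis X_compact : compact X.
Hypothesis S_stable : forall j, set_fun X X (S j).
Hypothesis S_similarity : forall j, similarity_on N X (S j) (s j).
Variables (p : nat -> R) (mu : probability (borelRk R k) R).
Hypothesis p_ge0 : forall j, 0 <= p j.
Hypothesis mu_self_similar : self_similar_measure S X p mu.

Let cX : closed X.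
Proof. by apply: compact_closed => //; exact: norm_hausdorff. Qed.

Let mX : measurable (X : set (borelRk R k)). Proof. exact: closed_borel. Qed.

Let mS j : measurable_fun (X : set (borelRk R k)) (S j : borelRk R k -> borelRk R k).
Proof.
apply: within_continuous_borel => //.
exact (similarity_continuous normN (S_similarity j)).
Qed.

Lemma self_similar_setC : mu (~` X) = 0%E.
Proof.
rewrite mu_self_similar; last exact: measurableC.
apply: eseries0 => j _ _; rewrite (_ : _ `&` _ = set0) ?measure0 ?mule0//.
by apply/seteqP; split => // x [Xx]; apply; exact: S_stable.
Qed.

Lemma self_similar_supp : mu X = 1%E.
Proof.
rewrite -(setCK X) probability_setC; last exact: measurableC.
by rewrite self_similar_setC sube0.
Qed.

Lemma self_similar_setI (B : set (borelRk R k)) : measurable B ->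
  mu (X `&` B) = mu B.
Proof.
move=> mB; rewrite -[in RHS](setIT B) -(setUv X) setIUr measureU; last 3 first.
- exact: measurableI.
- by apply: measurableI => //; exact: measurableC.
- by rewrite setIACA setICr setI0.
rewrite setIC [X in (_ + X)%E](_ : _ = 0%E) ?adde0//.
apply: (subset_measure0 (mu := mu) (B := ~` X)) => //.
- by apply: measurableI => //; exact: measurableC.
- exact: measurableC.
- exact: self_similar_setC.
Qed.

Lemma lexp_integral (F : 'rV[R]_k -> \bar R) :
  measurable_fun [set: borelRk R k] (F : borelRk R k -> \bar R) ->
  (forall x, 0 <= F x)%E ->
  (\int[mu]_x F x = lexp p (fun j => \int[mu]_(x in X) F (S j x)))%E.
Proof.
move=> mF F0.
(* [S j] is controlled on X only. Replacing it by the identity elsewhere gives a map measurable on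
   the whole space, and the complement of X is null. *)
pose T j (x : borelRk R k) : borelRk R k := if x \in X then S j x else x.
have mT j : measurable_fun setT (T j).
  apply: measurable_fun_if => //.
  - by apply: (measurable_fun_bool true); rewrite setTI preimage_mem_true.
  - by rewrite setTI preimage_mem_true.
pose image_measure j : {measure set (borelRk R k) -> \bar R} :=
  mscale (NngNum (p_ge0 j)) (pushforward mu (T j)).
pose m_ := image_measure mT.
transitivity (\int[mseries m_ 0]_x F x)%E.
  apply: eq_measure_integral => A mA _.
  rewrite [LHS](mu_self_similar mA); apply: eq_eseriesr => j _.
  rewrite /m_ /image_measure /= /mscale /= /pushforward; congr (_ * _)%E.
  have mTA : measurable (T j @^-1` A) by rewrite -[X in measurable X]setTI; exact: (mT j).
  rewrite -[RHS]self_similar_setI//; congr (mu _).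
  by apply/seteqP; split => x [Xx]; rewrite /preimage /T /= mem_set.
rewrite ge0_integral_measure_series//; apply: eq_eseriesr => j _.
rewrite ge0_integral_mscale// ge0_integral_pushforward//.
congr (_ * _)%E; rewrite preimage_setT.
rewrite (@ge0_negligible_integral _ _ _ mu setT (~` X))//; last 4 first.
- exact: measurableC.
- exact: measurableT_comp.
- by move=> x _; exact: F0.
- exact: self_similar_setC.
by rewrite setTD setCK; apply: eq_integral => x Xx; rewrite /= /T Xx.
Qed.

Lemma wexp_integral (F : 'rV[R]_k -> \bar R) m :
  measurable_fun [set: borelRk R k] (F : borelRk R k -> \bar R) ->
  (forall x, 0 <= F x)%E ->
  (\int[mu]_x F x = wexp p m (fun w => \int[mu]_(x in X) F (smap S w x)))%E.
Proof.
have XE (G : 'rV[R]_k -> \bar R) :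
    (\int[mu]_(x in X) G x = \int[mu]_x (G \_ X) x)%E by rewrite integral_mkcond.
elim: m F => [|m IH] F mF F0.
  rewrite [RHS]/= (@ge0_negligible_integral _ _ _ mu setT (~` X))//.
  - by rewrite setTD setCK.
  - exact: measurableC.
  - exact: self_similar_setC.
rewrite lexp_integral//=; apply: eq_lexp => j.
have mFS : measurable_fun (X : set (borelRk R k)) ((F \o S j) : borelRk R k -> \bar R).
  exact: (measurableT_comp mF (mS j)).
rewrite XE IH; last 2 first.
- by apply/(measurable_restrictT _ _).1.
- by move=> x; rewrite patchE; case: ifPn.
apply: eq_wexp => w _; apply: eq_integral => x; rewrite inE => Xx.
by rewrite patchE mem_set//; exact: smap_stable.
Qed.

Let msmap w : measurable_fun (X : set (borelRk R k)) (smap S w : borelRk R k -> borelRk R k).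
Proof.
apply: within_continuous_borel => //.
exact (similarity_continuous normN (smap_similarity S_stable S_similarity w)).
Qed.

Let indic_integral m (B : set 'rV[R]_k) : measurable (B : set (borelRk R k)) ->
  (mu B = wexp p m (fun w => \int[mu]_(x in X) (\1_B (smap S w x))%:E))%E.
Proof.
move=> mB; have := @wexp_integral (fun x => (\1_B x)%:E) m.
rewrite integral_indic// setIT => -> //.
by apply/measurable_EFinP.
Qed.

Let int1X : (\int[mu]_(x in X) 1 = 1)%E.
Proof. by rewrite integral_cst// mul1e; exact: self_similar_supp. Qed.

(** By self-similarity [mu] is an average of measures carried by the pieces S_w X: a piece inside B
    contributes 1. In the converse bound below, a piece that misses B contributes 0. *)
Lemma wprob_le_measure m (B : set 'rV[R]_k) (Q : pred (seq nat)) :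
  measurable (B : set (borelRk R k)) ->
  (forall w y, size w = m -> Q w -> X y -> B (smap S w y)) ->
  (wprob p m Q <= mu B)%E.
Proof.
move=> mB QB; rewrite (indic_integral m mB); apply: le_wexp => // w wm.
have [Qw|_] := boolP (Q w); last by apply: integral_ge0 => x _; rewrite lee_fin.
rewrite (eq_integral (fun=> 1%E)); last first.
  by move=> x; rewrite inE => Xx; rewrite indicE mem_set//; exact: QB.
by rewrite int1X.
Qed.

Lemma measure_le_wprob m (B : set 'rV[R]_k) : measurable (B : set (borelRk R k)) ->
  (mu B <= wprob p m (fun w => `[< exists2 y, X y & B (smap S w y) >]))%E.
Proof.
move=> mB; rewrite (indic_integral m mB); apply: le_wexp => // w wm.
  by apply: integral_ge0 => x _; rewrite lee_fin.
have [wB|wB] := asboolP (exists2 y, X y & B (smap S w y)); last first.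
  rewrite integral0_eq// => x Xx; rewrite indicE memNset// => Bx; apply: wB.
  by exists x.
apply: (@le_trans _ _ (\int[mu]_(x in X) 1)%E); last first.
  by rewrite int1X.
apply: ge0_le_integral => //.
- apply/measurable_EFinP; apply: (measurableT_comp _ (msmap w)).
  exact: measurable_indic.
- by move=> x _; rewrite lee_fin indicE lern1 leq_b1.
Qed.

End SelfSimilarMeasure.

(** * Probability of the words near a point *)

Lemma sum_to1_partial (R : realType) (p : nat -> R) (M0 : nat) (e : R) :
  (forall j, 0 <= p j) -> (\sum_(0 <= j <oo) (p j)%:E = 1)%E -> 0 < e ->
  exists2 M, (M0 <= M)%N & 1 - e < \sum_(0 <= j < M) p j.
Proof.
move=> p0 p1 e0.
have : (\sum_(0 <= j < n) (p j)%:E)%E @[n --> \oo] --> (1 : \bar R)%E.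
  by rewrite -p1; apply: is_cvg_nneseries => j _ _; rewrite lee_fin.
under eq_fun do rewrite sumEFin.
move=> /fine_cvgP[_ /cvgrPdist_lt /(_ _ e0)] [n _ /(_ (maxn n M0))].
rewrite /= leq_maxl => /(_ isT) h; exists (maxn n M0); first exact: leq_maxr.
by have := ler_norm (1 - \sum_(0 <= j < maxn n M0) p j); move: h; lra.
Qed.

Lemma partial_sum_le1 (R : realType) (p : nat -> R) (M : nat) :
  (forall j, 0 <= p j) -> (\sum_(0 <= j <oo) (p j)%:E = 1)%E ->
  \sum_(0 <= j < M) p j <= 1.
Proof.
move=> p0 p1; rewrite -lee_fin -sumEFin -p1; apply: nneseries_lim_ge => j _ _.
by rewrite lee_fin.
Qed.

Section Frostman.
Context {R : realType} {k : nat} (N : 'rV[R]_k -> R).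
Hypothesis normN : is_norm N.
Variables (X : set 'rV[R]_k) (S : nat -> 'rV[R]_k -> 'rV[R]_k) (s : nat -> R).
Hypothesis X_neq0 : X !=set0.
Hypothesis X_compact : compact X.
Hypothesis S_stable : forall j, set_fun X X (S j).
Hypothesis S_similarity : forall j, similarity_on N X (S j) (s j).
Hypothesis s_gt0 : forall j, 0 < s j.
Variable smax : R.
Hypothesis s_le : forall j, s j <= smax.
Hypothesis smax_lt1 : smax < 1.
Hypothesis S_separated : strong_separation S X.
Variable p : nat -> R.
Hypothesis p_gt0 : forall j, 0 < p j.
Hypothesis p_sum1 : (\sum_(0 <= j <oo) (p j)%:E = 1)%E.

Let p_ge0 j : 0 <= p j. Proof. exact: ltW. Qed.

Lemma prob_letter_le (M j : nat) : (j < M)%N -> p j <= \sum_(0 <= i < M) p i.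
Proof.
move=> jM; rewrite (bigD1_seq j) ?mem_index_iota ?iota_uniq//= lerDl.
by apply: sumr_ge0.
Qed.

(** A partial entropy stands in for h, which may be infinite. The gain of a letter is ln (P / p j),
    with P the mass of the first M letters. The words near [a] contain at most one per class, so the
    mean of exp(gain) over them is at most 1, while the gain is at least m b - kappa - C as long as
    the walk stays below kappa. *)
Lemma near_word_prob (M0 : nat) (b : R) :
  b < \sum_(0 <= j < M0) p j * - ln (p j) ->
  exists c : R, exists C : R, exists theta : R, exists xi : nat -> R,
  [/\ 0 < c <= 1, 0 < theta,
     (lexp p (fun j => (expR (- (theta * xi j)))%:E) <= 1)%E &
     forall a kappa m, (wprob p m (fun w =>
       (wmax xi w <= kappa)%R && `[< near_word N X S s c a w >]) <=
       (expR (kappa + C - m%:R * b))%:E)%E].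
Proof.
set H := \sum_(_ <= _ < _) _ => bH.
have Hb : 0 < H - b by rewrite subr_gt0.
(* M > 0 makes P positive, and 1 - P < H - b pays for the term P ln P >= P - 1 in the mean gain. *)
have [M M0M PM] := sum_to1_partial M0.+1 p_ge0 p_sum1 Hb.
set P := \sum_(_ <= _ < _) _ in PM.
have P0 : 0 < P by rewrite (lt_le_trans (p_gt0 0))// prob_letter_le// (leq_trans _ M0M).
have P1 : P <= 1 by exact: partial_sum_le1.
pose g j := ln (P / p j).
have Pp j : 0 < P / p j by rewrite divr_gt0.
have g0 j : (j < M)%N -> 0 <= g j.
  by move=> jM; rewrite ln_ge0// ler_pdivlMr// mul1r prob_letter_le.
have pg j : (j < M)%N -> p j * expR (g j) = P.
  by move=> _; rewrite /g lnK ?posrE// mulrC divfK// gt_eqF.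
have p1 j : p j <= 1.
  by rewrite (le_trans (prob_letter_le (ltnSn j)))// partial_sum_le1.
have bg : b < \sum_(0 <= j < M) p j * g j.
  have -> : \sum_(0 <= j < M) p j * g j = P * ln P + \sum_(0 <= j < M) p j * - ln (p j).
    rewrite /P mulr_suml -big_split /=; apply: eq_bigr => j _.
    by rewrite /g ln_div ?posrE// mulrBr mulrN.
  have lnP : P - 1 <= P * ln P.
    have := @le_ln1Dx R (P^-1 - 1); rewrite (_ : 1 + (P^-1 - 1) = P^-1); last by ring.
    rewrite lnV ?posrE//.
    have -> : -1 < P^-1 - 1 by rewrite ltrBrDr addNr invr_gt0.
    move=> /(_ isT) h; have := ler_wpM2l (ltW P0) h.
    by rewrite mulrBr divff ?gt_eqF// mulr1 mulrN; lra.
  have HM : H <= \sum_(0 <= j < M) p j * - ln (p j).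
    rewrite /H (big_cat_nat (n := M0) (p := M))//=; last exact: ltnW.
    rewrite lerDl sumr_ge0// => j _; rewrite mulr_ge0// oppr_ge0 ln_le0//.
  by move: PM; lra.
have [K MK HK] := gain_walk p_ge0 p_sum1 g0 bg.
have [L [c c0 sep]] := uniform_separation normN X_neq0 X_compact S_stable
  S_similarity s_gt0 s_le smax_lt1 S_separated M K.
have [xi [theta [C [theta0 xiE gainE]]]] := HK L.
(* The factor 1 / 2 is the one of [near_word_uniq]; the minimum with 1 makes - ln c nonnegative in
   the later estimates. *)
have c1 : 0 < Num.min c 1 / 2 <= 1.
  by rewrite divr_gt0 ?lt_min ?c0//= ler_pdivrMr// ge_min; apply/orP; right; lra.
exists (Num.min c 1 / 2), C, theta, xi; split => // a kappa m.
set Q := fun w => _.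
have := @overlap_weight R p p_ge0 M L K g MK pg m
  (fun w => `[< near_word N X S s (Num.min c 1 / 2) a w >]) (fun=> 1).
rewrite (wexp_cst p_ge0 p_sum1)// => h.
have {}h : (wexp p m (fun w => (expR (lgain M L K g w) * 1 *
    `[< near_word N X S s (Num.min c 1 / 2) a w >]%:R)%:E) <= 1)%E.
  apply: h => // w v /asboolP nw /asboolP nv.
  apply: (near_word_uniq normN S_stable S_similarity s_gt0 s_le smax_lt1 MK _ _ nw nv).
    by rewrite lt_min c0 ltr01.
  move=> i j u v' x y iM jM ij ub vb Xx Xy.
  by rewrite (le_trans _ (sep _ _ _ _ _ _ iM jM ij ub vb Xx Xy))// ge_min lexx.
rewrite -[leLHS]mul1e.
have -> : (1 = (expR (kappa + C - m%:R * b))%:E * (expR (m%:R * b - kappa - C))%:E)%E.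
  by rewrite -EFinM -expRD (_ : _ + _ = 0) ?expR0//; ring.
rewrite -muleA -[leRHS]mule1 lee_wpmul2l ?lee_fin ?expR_ge0//.
apply: le_trans h; rewrite /wprob -(wexpZ p_ge0)//.
apply: (le_wexp p_ge0) => w wm; first by rewrite -EFinM lee_fin mulr_ge0// expR_ge0.
rewrite -EFinM lee_fin mulr1 /Q; case: (leP (wmax xi w)) => /= hw; last first.
  by rewrite mulr0 mulr_ge0// expR_ge0.
rewrite ler_wpM2r// ler_expR; have := gainE w; rewrite wm; lra.
Qed.

End Frostman.

(** * Lower bound on the quantization error *)

Section DistSet.
Context {R : realType} {k : nat} (N : 'rV[R]_k -> R).
Hypothesis normN : is_norm N.
Implicit Types (A : set 'rV[R]_k) (x a : 'rV[R]_k).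

Lemma dist_set_le A x a : A a -> dist_set N x A <= dist N x a.
Proof.
move=> Aa; apply: ge_inf; last by exists a.
by exists 0 => _ [b Ab <-]; exact: dist_ge0.
Qed.

Lemma le_dist_set A x c : A !=set0 -> (forall a, A a -> c <= dist N x a) ->
  c <= dist_set N x A.
Proof.
move=> [a Aa] H; apply: lb_le_inf; first by exists (dist N x a), a.
by move=> _ [b Ab <-]; exact: H.
Qed.

Lemma dist_set_ge0 A x : A !=set0 -> 0 <= dist_set N x A.
Proof. by move=> A0; apply: le_dist_set => // a _; exact: dist_ge0. Qed.

Lemma dist_set_triangle A x y : A !=set0 ->
  dist_set N x A <= dist N x y + dist_set N y A.
Proof.
move=> A0; rewrite -lerBlDl; apply: le_dist_set => // a Aa.
rewrite lerBlDl (le_trans (dist_set_le x Aa))//.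
exact: dist_triangle.
Qed.

Lemma dist_set_continuous A : A !=set0 -> continuous (fun x => dist_set N x A).
Proof.
move=> A0; have [C C0 NC] := vnorm_le_norm normN.
apply/continuous_subspace_setT.
apply: (@lipschitz_within_continuous R 'rV[R]_k R _ _ C) => x y _ _.
apply: le_trans (NC (x - y)); rewrite -/(dist N x y) ler_norml.
have := dist_set_triangle x y A0; have := dist_set_triangle y x A0.
by rewrite (distC normN y x); lra.
Qed.

Lemma measurable_dist_set A : A !=set0 ->
  measurable_fun [set: borelRk R k] ((fun x => dist_set N x A) : borelRk R k -> R).
Proof. by move=> A0; apply: continuous_borel; exact: dist_set_continuous. Qed.

(* The positive part of -log d(x, A), with distances below r replaced by r. *)
Definition trunc_logdist (r : R) A x : R :=
  Num.max 0 (- ln (Num.max (dist_set N x A) r)).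

Lemma trunc_logdist_ge0 r A x : 0 <= trunc_logdist r A x.
Proof. by rewrite /trunc_logdist le_max lexx. Qed.

Lemma trunc_logdist_le r A x (c : R) : 0 <= c -> 0 < r ->
  expR (- c) <= Num.max (dist_set N x A) r -> trunc_logdist r A x <= c.
Proof.
move=> c0 r0 h; rewrite /trunc_logdist ge_max c0 /= lerNl -ler_expR lnK//.
by rewrite posrE lt_max r0 orbT.
Qed.

Lemma measurable_trunc_logdist r A : A !=set0 ->
  measurable_fun [set: borelRk R k]
    ((fun x => (trunc_logdist r A x)%:E) : borelRk R k -> \bar R).
Proof.
move=> A0; apply/measurable_EFinP; apply: measurable_maxr; first exact: measurable_cst.
apply: measurableT_comp => //; apply: measurableT_comp; first exact: measurable_ln.
apply: measurable_maxr; last exact: measurable_cst.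
exact: measurable_dist_set.
Qed.

(** The same truncation level can be kept on both sides because u * max(d, r) <= max(u * d, r) when
    u <= 1. *)
Lemma trunc_logdist_scale r A B x y (u : R) : A !=set0 -> B !=set0 -> 0 < r ->
  0 < u <= 1 ->
  (forall a, A a -> exists2 b, B b & u * dist N y b <= dist N x a) ->
  trunc_logdist r A x <= - ln u + trunc_logdist r B y.
Proof.
move=> A0 B0 r0 /andP[u0 u1] AB; set d := trunc_logdist r B y.
have lu : 0 <= - ln u by rewrite oppr_ge0 ln_le0.
have d0 : 0 <= d by exact: trunc_logdist_ge0.
apply: trunc_logdist_le => //; first exact: addr_ge0.
rewrite opprD opprK expRD lnK ?posrE//.
apply: (@le_trans _ _ (u * Num.max (dist_set N y B) r)).
  rewrite ler_wpM2l ?(ltW u0)//.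
  rewrite -[leRHS]lnK; last by rewrite posrE lt_max r0 orbT.
  by rewrite ler_expR lerNl /d /trunc_logdist le_max lexx orbT.
rewrite maxr_pMr ?(ltW u0)// ge_max !le_max; apply/andP; split; apply/orP.
  left; apply: le_dist_set => // a /AB[b Bb]; apply: le_trans.
  by rewrite ler_wpM2l ?(ltW u0)// dist_set_le.
by right; rewrite ler_piMl// ltW.
Qed.

End DistSet.

(** * Self-similar recursion for the truncated error *)

Section QuantLower.
Context {R : realType} {k : nat} (N : 'rV[R]_k -> R).
Hypothesis normN : is_norm N.
Variables (X : set 'rV[R]_k) (S : nat -> 'rV[R]_k -> 'rV[R]_k) (s : nat -> R).
Hypothesis X_neq0 : X !=set0.
Hypothesis X_compact : compact X.
Hypothesis S_stable : forall j, set_fun X X (S j).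
Hypothesis S_similarity : forall j, similarity_on N X (S j) (s j).
Hypothesis s_gt0 : forall j, 0 < s j.
Variable smax : R.
Hypothesis s_le : forall j, s j <= smax.
Hypothesis smax_lt1 : smax < 1.
Variables (p : nat -> R) (mu : probability (borelRk R k) R).
Hypothesis p_gt0 : forall j, 0 < p j.
Hypothesis p_sum1 : (\sum_(0 <= j <oo) (p j)%:E = 1)%E.
Hypothesis mu_self_similar : self_similar_measure S X p mu.
Variable chi : R.
Hypothesis chiE : lexp p (fun j => (- ln (s j))%:E) = chi%:E.

Let p_ge0 j : 0 <= p j. Proof. exact: ltW. Qed.

Let tau_ge0 j : 0 <= - ln (s j).
Proof. by rewrite oppr_ge0 ln_le0// (le_trans (s_le j))// ltW. Qed.

Lemma ln_sprod w : - ln (sprod s w) = \sum_(j <- w) - ln (s j).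
Proof.
elim: w => [|j w IH]; first by rewrite /sprod !big_nil ln1 oppr0.
by rewrite sprod_cons lnM ?posrE ?sprod_gt0// opprD IH big_cons.
Qed.

Definition admissible n (A : set 'rV[R]_k) : Prop := A !=set0 /\ (A #<= `I_n)%card.

(** Union bound for a word of length m to be near one of n points: the first term is the exceptional
    event that the walk exceeds kappa. *)
Definition near_prob_bound (c C theta b : R) (n : nat) (kappa : R) (m : nat) : R :=
  expR (- (theta * kappa)) + n%:R * expR (kappa + C - m%:R * b).

Lemma wprob_near_set (c C theta b : R) (xi : nat -> R) : 0 < theta ->
  (lexp p (fun j => (expR (- (theta * xi j)))%:E) <= 1)%E ->
  (forall a kappa m, (wprob p m (fun w =>
       (wmax xi w <= kappa)%R && `[< near_word N X S s c a w >]) <=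
       (expR (kappa + C - m%:R * b))%:E)%E) ->
  forall n A kappa m, (A #<= `I_n)%card ->
  (wprob p m (fun w => `[< exists2 a, A a & near_word N X S s c a w >]) <=
   (near_prob_bound c C theta b n kappa m)%:E)%E.
Proof.
move=> theta0 xiE nearP n A kappa m An.
have fA : finite_set A by apply/finite_set_leP; exists n.
pose l : seq 'rV[R]_k := finmap.enum_fset (fset_set A).
have ln_ : (size l <= n)%N by exact: geq_card_fset_set.
have lA a : A a -> a \in l by move=> Aa; rewrite (in_fset_set fA) inE.
pose Q a w := (wmax xi w <= kappa)%R && `[< near_word N X S s c a w >].
apply: (@le_trans _ _ (wprob p m (predU (fun w => kappa < wmax xi w)%R
    (fun w => has (Q^~ w) l)))).
  apply: le_wprob => // w wm /asboolP[a Aa aw] /=.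
  case: ltP => //= h; apply/hasP; exists a; first exact: lA.
  by rewrite /Q h; apply/asboolP.
apply: (le_trans (wprobU _ _ _ _)) => //.
rewrite EFinD leeD//; first exact: wprob_wmax_gt.
apply: (le_trans (wprob_has p_ge0 p_sum1 m l Q)).
apply: (@le_trans _ _ (\sum_(a <- l) (expR (kappa + C - m%:R * b))%:E)%E).
  by apply: lee_sum => a _; exact: nearP.
rewrite sumEFin lee_fin big_const_seq count_predT iter_addr_0 -[leLHS]mulr_natl.
by rewrite ler_wpM2r ?expR_ge0// ler_nat.
Qed.

Lemma integral_cstX (c : R) : (\int[mu]_(x in X) c%:E = c%:E)%E.
Proof.
have cX : closed X by apply: compact_closed => //; exact: norm_hausdorff.
rewrite integral_cst//; last exact: closed_borel.
rewrite [X in (_ * X)%E](_ : _ = 1%E) ?mule1//.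
exact: (self_similar_supp X_compact S_stable mu_self_similar).
Qed.

(** If no point of A is near w, distances on the piece are at least c s_w. Otherwise each b in A is
    replaced by f b in X, where S_w (f b) is the point of the piece closest to b; then d(S_w y, b)
    >= (s_w / 2) d(y, f b), and f(A) has at most n points, so V applies to it. *)
Lemma integral_trunc_logdist_smap c V r n A w : 0 < c <= 1 -> 0 < r ->
  admissible n A ->
  (forall B, admissible n B -> (\int[mu]_x (trunc_logdist N r B x)%:E <= V%:E)%E) ->
  (\int[mu]_(y in X) (trunc_logdist N r A (smap S w y))%:E <=
   (- ln (sprod s w) + (ln 2 - ln c) +
    V * `[< exists2 a, A a & near_word N X S s c a w >]%:R)%:E)%E.
Proof.
move=> /andP[c0 c1] r0 [A0 An] AV.
have cX : closed X by apply: compact_closed => //; exact: norm_hausdorff.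
have mX : measurable (X : set (borelRk R k)) by exact: closed_borel.
have sw0 := sprod_gt0 s_gt0 w; have sw1 := sprod_le1 s_gt0 s_le smax_lt1 w.
have mG B : admissible n B -> measurable_fun (X : set (borelRk R k))
    ((fun x => (trunc_logdist N r B x)%:E) : borelRk R k -> \bar R).
  by move=> [B0 _]; apply: measurable_funTS; exact: measurable_trunc_logdist.
have mGS : measurable_fun (X : set (borelRk R k))
    ((fun x => (trunc_logdist N r A (smap S w x))%:E) : borelRk R k -> \bar R).
  apply: (measurableT_comp (measurable_trunc_logdist normN r A0)).
  apply: within_continuous_borel => //.
  exact (similarity_continuous normN (smap_similarity S_stable S_similarity w)).
have G0 B x : (0 <= (trunc_logdist N r B x)%:E)%E by rewrite lee_fin trunc_logdist_ge0.
have lc0 : 0 <= - ln c by rewrite oppr_ge0 ln_le0.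
have l20 : 0 <= ln 2 :> R by rewrite ln_ge0// ler1n.
have ls0 : 0 <= - ln (sprod s w) by rewrite oppr_ge0 ln_le0.
have [[a Aa aw]|far] := asboolP (exists2 a, A a & near_word N X S s c a w); last first.
  rewrite mulr0 addr0 -integral_cstX; apply: ge0_le_integral => // x Xx.
  rewrite lee_fin; apply: trunc_logdist_le => //; first by rewrite !addr_ge0.
  apply: (@le_trans _ _ (c * sprod s w)).
    rewrite -[leRHS]lnK ?posrE ?mulr_gt0// ler_expR lnM ?posrE//; lra.
  rewrite le_max; apply/orP; left; apply: le_dist_set => // a Aa.
  rewrite leNgt; apply/negP => h; apply: far; exists a => //; exists x => //.
  by rewrite distC.
rewrite mulr1.
have /choice[f Hf] b : exists y, X y /\
    forall z, X z -> dist N b (smap S w y) <= dist N b (smap S w z).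
  have [y Xy Hy] := nearest_point normN b X_neq0 X_compact
    (similarity_continuous normN (smap_similarity S_stable S_similarity w)).
  by exists y.
have fA : admissible n (f @` A).
  split; first by exists (f a), a.
  by apply: (card_le_trans _ An); exact: card_image_le.
apply: (@le_trans _ _ (\int[mu]_(x in X)
    ((- ln (sprod s w) + (ln 2 - ln c))%:E + (trunc_logdist N r (f @` A) x)%:E))%E).
  apply: ge0_le_integral => //.
    by apply: emeasurable_funD => //; exact: mG.
  move=> y Xy; rewrite -EFinD lee_fin.
  have u01 : 0 < sprod s w / 2 <= 1.
    by rewrite divr_gt0//= ler_pdivrMr// mul1r (le_trans sw1)// ler1n.
  have := @trunc_logdist_scale R k N normN r A (f @` A) (smap S w y) y _ A0 fA.1 r0 u01.
  rewrite ln_div ?posrE// => h; apply: le_trans (h _) _; last by lra.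
  move=> b Ab; exists (f b); first by exists b.
  have [Xfb fbmin] := Hf b.
  rewrite mulrAC -(dist_smap S_stable S_similarity w Xy Xfb) ler_pdivrMr//.
  have := dist_triangle normN b (smap S w y) (smap S w (f b)).
  by have := fbmin _ Xy; rewrite (distC normN b (smap S w y)); lra.
rewrite ge0_integralD//; last 2 first.
- by move=> x Xx; rewrite lee_fin !addr_ge0.
- exact: mG.
rewrite integral_cstX (EFinD _ V) leeD2l//.
apply: le_trans (AV _ fA); apply: ge0_subset_integral => //.
exact (measurable_trunc_logdist normN r fA.1).
Qed.

(** Let V be the supremum of the truncated integrals over all admissible sets, finite because each
    integral is at most - ln r. Averaging the one-word estimate over words of length m gives V <= K
    + rho V, and solving for V yields a bound free of r. *)
Lemma integral_trunc_logdist_le (c C theta b : R) (xi : nat -> R) n kappa m r A :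
  0 < c <= 1 -> 0 < theta ->
  (lexp p (fun j => (expR (- (theta * xi j)))%:E) <= 1)%E ->
  (forall a kappa m, (wprob p m (fun w =>
       (wmax xi w <= kappa)%R && `[< near_word N X S s c a w >]) <=
       (expR (kappa + C - m%:R * b))%:E)%E) ->
  near_prob_bound c C theta b n kappa m < 1 -> 0 < r <= 1 -> admissible n A ->
  (\int[mu]_x (trunc_logdist N r A x)%:E <=
   ((m%:R * chi + (ln 2 - ln c)) / (1 - near_prob_bound c C theta b n kappa m))%:E)%E.
Proof.
move=> c01 theta0 xiE nearP; set rho := near_prob_bound _ _ _ _ _ _ _ => rho1.
move=> /andP[r0 r1] admA; have /andP[c0 c1] := c01.
have rho0 : 0 <= rho by rewrite addr_ge0 ?expR_ge0// mulr_ge0// expR_ge0.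
set K := m%:R * chi + (ln 2 - ln c).
have G0 B x : (0 <= (trunc_logdist N r B x)%:E)%E by rewrite lee_fin trunc_logdist_ge0.
pose I B := (\int[mu]_x (trunc_logdist N r B x)%:E)%E.
have Ile B : admissible n B -> (I B <= (- ln r)%:E)%E.
  move=> [B0 _]; have -> : ((- ln r)%:E = \int[mu]_x (- ln r)%:E)%E.
    rewrite integral_cst// [X in (_ * X)%E](_ : _ = 1%E) ?mule1//.
    exact: probability_setT.
  apply: ge0_le_integral => //; first exact: measurable_trunc_logdist.
  move=> x _; rewrite lee_fin; apply: trunc_logdist_le => //.
    by rewrite oppr_ge0 ln_le0.
  by rewrite opprK lnK ?posrE// le_max lexx orbT.
pose Vs := ereal_sup [set I B | B in admissible n].
have Vsub B : admissible n B -> (I B <= Vs)%E.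
  by move=> aB; apply: ereal_sup_ubound; exists B.
have Vf : Vs \is a fin_num.
  rewrite ge0_fin_numE.
    by apply: (@le_lt_trans _ _ (- ln r)%:E); [|exact: ltry];
      apply: ge_ereal_sup => _ [B aB <-]; exact: Ile.
  by apply: (le_trans _ (Vsub _ admA)); exact: integral_ge0.
pose V := fine Vs; have VE : V%:E = Vs by rewrite /V fineK.
have V0 : 0 <= V.
  by rewrite -lee_fin VE; apply: (le_trans _ (Vsub _ admA)); exact: integral_ge0.
have step B : admissible n B -> (I B <= (K + rho * V)%:E)%E.
  move=> aB; rewrite /I.
  rewrite (wexp_integral normN X_compact S_stable S_similarity p_ge0 mu_self_similar m)//; last first.
    by apply: measurable_trunc_logdist => //; case: aB.
  set Q := fun w => `[< exists2 a, B a & near_word N X S s c a w >].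
  have lc0 : 0 <= ln 2 - ln c by rewrite subr_ge0 (le_trans (ln_le0 c1))// ln_ge0// ler1n.
  apply: (@le_trans _ _ (wexp p m (fun w => (\sum_(j <- w) - ln (s j))%:E +
      (ln 2 - ln c)%:E + V%:E * (Q w)%:R%:E)%E)).
    apply: (le_wexp p_ge0) => w _; first by apply: integral_ge0.
    rewrite -EFinM -!EFinD -ln_sprod.
    apply: integral_trunc_logdist_smap aB _ => //.
    by move=> B' aB'; rewrite VE; exact: Vsub.
  have s0 w : (0 <= (\sum_(j <- w) - ln (s j))%:E)%E by rewrite lee_fin sumr_ge0.
  have vq0 w : (0 <= V%:E * (Q w)%:R%:E)%E by rewrite -EFinM lee_fin mulr_ge0.
  have s1 w : (0 <= (\sum_(j <- w) - ln (s j))%:E + (ln 2 - ln c)%:E)%E.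
    by rewrite adde_ge0// lee_fin.
  rewrite (wexpD p_ge0 _ s1 vq0) (wexpD p_ge0 _ s0 (g := fun=> (ln 2 - ln c)%:E))//.
  rewrite (wexp_sum_letters p_ge0 p_sum1 m tau_ge0 chiE) wexp_cst// (wexpZ p_ge0)//.
  rewrite /K EFinD EFinD leeD2l// mulrC EFinM lee_wpmul2l// ?lee_fin//.
  exact: (wprob_near_set theta0 xiE nearP _ _ aB.2).
have VK : V <= K + rho * V.
  by rewrite -lee_fin VE; apply: ge_ereal_sup => _ [B aB <-]; exact: step.
apply: (le_trans (Vsub _ admA)); rewrite -VE lee_fin ler_pdivlMr ?subr_gt0//.
by rewrite mulrBr mulr1; lra.
Qed.

End QuantLower.

(** * Removal of the truncation *)

Section QuantErrorLower.
Context {R : realType} {k : nat} (N : 'rV[R]_k -> R).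
Hypothesis normN : is_norm N.
Variable mu : probability (borelRk R k) R.

Lemma ln_nat_unbounded (C : R) : exists n0 : nat, forall n, (n0 <= n)%N -> C <= ln n%:R :> R.
Proof.
exists (Num.truncn (expR C)).+1 => n hn.
have h : expR C <= n%:R.
  by rewrite (le_trans (ltW (truncnS_gt _)))// ler_nat.
by rewrite -ler_expR lnK// posrE (lt_le_trans (expR_gt0 C)).
Qed.

Lemma trunc_logdist_cvg (A : set 'rV[R]_k) x : A !=set0 ->
  (trunc_logdist N n.+1%:R^-1 A x)%:E @[n --> \oo] -->
  ((fun x => lne (dist_set N x A)%:E)^\- x)%E.
Proof.
move=> A0; rewrite funenegE; have := dist_set_ge0 normN x A0.
set d := dist_set N x A; rewrite le_eqVlt => /predU1P[/esym d0|d0].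
  rewrite le0_lneNy ?d0// maxye; apply/cvgeyPge => C.
  have [n0 Hn0] := ln_nat_unbounded C.
  exists n0 => // n /= n0n; rewrite lee_fin /trunc_logdist -/d le_max; apply/orP; right.
  by rewrite d0 max_r ?invr_ge0// lnV ?posrE// opprK Hn0// leqW.
rewrite lne_EFin// -EFinN -EFin_max; apply: cvg_near_cst.
exists (Num.truncn d^-1) => // n /= hn; congr (_%:E).
rewrite /trunc_logdist -/d maxC; congr (Num.max (- ln _) _).
apply/max_idPl; rewrite -[leRHS]invrK lef_pV2 ?posrE ?invr_gt0//.
by rewrite (le_trans (ltW (truncnS_gt _)))// ler_nat.
Qed.

(** Monotone convergence along the truncation levels 1 / (n + 1) controls the negative part of the
    integrand; its positive part is dropped. *)
Lemma integral_lne_ge (A : set 'rV[R]_k) (V : R) : A !=set0 ->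
  (forall r, 0 < r <= 1 -> (\int[mu]_x (trunc_logdist N r A x)%:E <= V%:E)%E) ->
  ((- V)%:E <= \int[mu]_x lne (dist_set N x A)%:E)%E.
Proof.
move=> A0 HV; rewrite integralE.
have G0 n x : (0 <= (trunc_logdist N n.+1%:R^-1 A x)%:E)%E.
  by rewrite lee_fin trunc_logdist_ge0.
have r01 n : 0 < (n.+1%:R^-1 : R) <= 1 by apply/andP; split; [rewrite invr_gt0|rewrite invf_le1// ler1n].
have neg : (\int[mu]_x ((fun x => lne (dist_set N x A)%:E)^\- x) <= V%:E)%E.
  have -> : (\int[mu]_x ((fun x => lne (dist_set N x A)%:E)^\- x) =
      \int[mu]_x limn (fun n => (trunc_logdist N n.+1%:R^-1 A x)%:E))%E.
    by apply: eq_integral => x _; apply/esym/cvg_lim => //; exact: trunc_logdist_cvg.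
  have Gcvg : (\int[mu]_x (trunc_logdist N n.+1%:R^-1 A x)%:E)%E @[n --> \oo] -->
      (\int[mu]_x limn (fun n => (trunc_logdist N n.+1%:R^-1 A x)%:E))%E.
    apply: cvg_monotone_convergence => //.
    - by move=> n; exact (measurable_trunc_logdist normN _ A0).
    - move=> x _ m n mn; rewrite lee_fin; apply: trunc_logdist_le => //.
        exact: trunc_logdist_ge0.
      apply: (@le_trans _ _ (Num.max (dist_set N x A) n.+1%:R^-1)).
        rewrite -[leRHS]lnK ?posrE ?lt_max ?invr_gt0 ?ltr0n ?orbT//.
        by rewrite ler_expR lerNl /trunc_logdist le_max lexx orbT.
      rewrite ge_max !le_max lexx /=; apply/orP; right.
      by rewrite lef_pV2 ?posrE// ler_nat.
  rewrite -(cvg_lim _ Gcvg)//; apply: lime_le; first exact: cvgP Gcvg.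
  by apply: nearW => n; exact: HV.
have pos : (0 <= \int[mu]_x ((fun x => lne (dist_set N x A)%:E)^\+ x))%E.
  by apply: integral_ge0 => x _; exact: funepos_ge0.
by rewrite -[leLHS]add0e EFinN; exact: leeB.
Qed.

End QuantErrorLower.

Section QuantLowerBound.
Context {R : realType} {k : nat} (N : 'rV[R]_k -> R).
Hypothesis normN : is_norm N.
Variables (X : set 'rV[R]_k) (S : nat -> 'rV[R]_k -> 'rV[R]_k) (s : nat -> R).
Hypothesis X_neq0 : X !=set0.
Hypothesis X_compact : compact X.
Hypothesis S_stable : forall j, set_fun X X (S j).
Hypothesis S_similarity : forall j, similarity_on N X (S j) (s j).
Hypothesis s_gt0 : forall j, 0 < s j.
Variable smax : R.
Hypothesis s_le : forall j, s j <= smax.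
Hypothesis smax_lt1 : smax < 1.
Hypothesis S_separated : strong_separation S X.
Variables (p : nat -> R) (mu : probability (borelRk R k) R).
Hypothesis p_gt0 : forall j, 0 < p j.
Hypothesis p_sum1 : (\sum_(0 <= j <oo) (p j)%:E = 1)%E.
Hypothesis mu_self_similar : self_similar_measure S X p mu.
Variable chi : R.
Hypothesis chiE : lexp p (fun j => (- ln (s j))%:E) = chi%:E.

Let p_ge0 j : 0 <= p j. Proof. exact: ltW. Qed.

Let tau_ge0 j : 0 <= - ln (s j).
Proof. by rewrite oppr_ge0 ln_le0// (le_trans (s_le j))// ltW. Qed.

Let chi_ge0 : 0 <= chi.
Proof. by rewrite -lee_fin -chiE; apply: lexp_ge0 => // j; rewrite lee_fin. Qed.

Lemma quant_error_lower (M0 : nat) (t : R) : 0 < t ->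
  t * chi < \sum_(0 <= j < M0) p j * - ln (p j) ->
  exists n0 : nat, forall n, (n0 <= n)%N ->
    ((- (ln n%:R / t))%:E <= quant_error N mu n)%E.
Proof.
move=> t0; set H := \sum_(_ <= _ < _) _ => tH.
have [b bH tb] : exists2 b, b < H & t * chi < b.
  by exists ((t * chi + H) / 2); lra.
have b0 : 0 < b by rewrite (le_lt_trans _ tb)// mulr_ge0// ltW.
have [c [C [theta [xi [c01 theta0 xiE nearP]]]]] := near_word_prob normN X_neq0
  X_compact S_stable S_similarity s_gt0 s_le smax_lt1 S_separated p_gt0 p_sum1 bH.
have tcb : t * chi / b < 1 by rewrite ltr_pdivrMr// mul1r.
have tcb0 : 0 <= t * chi / b by rewrite divr_ge0 ?(ltW b0)// mulr_ge0// ltW.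
(* d will bound the probability rho of being near; the loss factor 1 / (1 - d) still leaves t chi /
   (b (1 - d)) < 1, and [eta] below is the resulting slack that absorbs the constants for large
   n. *)
have [d [d0 d1 hd]] : exists d, [/\ 0 < d, d < 1 & t * chi / b < 1 - d].
  by exists ((1 - t * chi / b) / 2); split; lra.
pose kappa := - ln (d / 2) / theta.
pose C2 := `|kappa + C - ln (d / 2)|.
pose K1 := ln 2 - ln c.
pose eta := t^-1 - chi / (b * (1 - d)).
have eta0 : 0 < eta.
  have bd0 : 0 < b * (1 - d) by rewrite mulr_gt0// subr_gt0.
  rewrite /eta subr_gt0 ltr_pdivrMr//.
  rewrite mulrC ltr_pdivlMr//.
  by move: hd; rewrite ltr_pdivrMr// [chi * t]mulrC; lra.
have [n0 Hn0] := @ln_nat_unbounded R ((C2 * chi / b + chi + K1) / (1 - d) / eta).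
exists (maxn 1 n0) => n; rewrite geq_max => /andP[n1 /Hn0 nlarge].
have lnn : 0 <= ln n%:R :> R by rewrite ln_ge0// ler1n.
(* The least integer above this quotient: then n * expR (kappa + C - m b) <= d / 2, while [kappa]
   makes the other term of rho equal to d / 2. *)
pose m := (Num.truncn ((ln n%:R + C2) / b)).+1.
have mb : ln n%:R + C2 < m%:R * b.
  by rewrite -ltr_pdivrMr// truncnS_gt.
have mle : m%:R <= (ln n%:R + C2) / b + 1.
  rewrite /m -addn1 natrD lerD2r truncn_le divr_ge0 ?(ltW b0)// addr_ge0//.
  exact: normr_ge0.
apply: le_ereal_inf_tmp => _ [A [A0 An] <-].
pose rho := near_prob_bound c C theta b n kappa m.
have rhod : rho <= d.
  have e1 : expR (- (theta * kappa)) = d / 2.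
    by rewrite /kappa mulrC divfK ?gt_eqF// opprK lnK// posrE divr_gt0.
  have e2 : n%:R * expR (kappa + C - m%:R * b) <= d / 2.
    have -> : d / 2 = n%:R * expR (ln (d / 2) - ln n%:R).
      rewrite expRD expRN !lnK ?posrE ?divr_gt0 ?ltr0n//.
      by rewrite [RHS]mulrC divfK// pnatr_eq0 -lt0n.
    rewrite ler_wpM2l// ler_expR; have := ler_norm (kappa + C - ln (d / 2)).
    by move: mb; rewrite /C2; lra.
  by rewrite /rho /near_prob_bound e1; lra.
apply: (@le_trans _ _ (- ((m%:R * chi + K1) / (1 - rho)))%:E).
  rewrite lee_fin lerN2 ler_pdivrMr ?subr_gt0 ?(le_lt_trans rhod)//.
  have : (C2 * chi / b + chi + K1) / (1 - d) <= eta * ln n%:R.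
    by rewrite [leRHS]mulrC -ler_pdivrMr.
  rewrite ler_pdivrMr ?subr_gt0// /eta => h.
  have hm : m%:R * chi <= ((ln n%:R + C2) / b + 1) * chi by rewrite ler_wpM2r.
  have h1 : m%:R * chi + K1 <= ln n%:R / t * (1 - d).
    have e3 : (t^-1 - chi / (b * (1 - d))) * ln n%:R * (1 - d) =
        ln n%:R / t * (1 - d) - chi / b * ln n%:R.
      by field; rewrite !gt_eqF ?subr_gt0.
    have e4 : ((ln n%:R + C2) / b + 1) * chi =
       chi / b * ln n%:R + C2 * chi / b + chi by field; rewrite gt_eqF.
    by move: h hm; rewrite e3 e4; lra.
  rewrite (le_trans h1)// ler_wpM2l ?divr_ge0 ?(ltW t0)//; lra.
apply: (integral_lne_ge normN A0) => r r01.
apply: (integral_trunc_logdist_le normN X_neq0 X_compact S_stable S_similarity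
  s_gt0 s_le smax_lt1 p_gt0 p_sum1 mu_self_similar chiE c01 theta0 xiE nearP _ r01 (conj A0 An)).
by rewrite -/rho (le_lt_trans rhod).
Qed.

End QuantLowerBound.

(** * Lower bound on the Hausdorff dimension *)

Section HausdorffLower.
Context {R : realType} {k : nat} (N : 'rV[R]_k -> R).
Hypothesis normN : is_norm N.
Variables (X : set 'rV[R]_k) (S : nat -> 'rV[R]_k -> 'rV[R]_k) (s : nat -> R).
Hypothesis X_neq0 : X !=set0.
Hypothesis X_compact : compact X.
Hypothesis S_stable : forall j, set_fun X X (S j).
Hypothesis S_similarity : forall j, similarity_on N X (S j) (s j).
Hypothesis s_gt0 : forall j, 0 < s j.
Variable smax : R.
Hypothesis s_le : forall j, s j <= smax.
Hypothesis smax_lt1 : smax < 1.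
Hypothesis S_separated : strong_separation S X.
Variables (p : nat -> R) (mu : probability (borelRk R k) R).
Hypothesis p_gt0 : forall j, 0 < p j.
Hypothesis p_sum1 : (\sum_(0 <= j <oo) (p j)%:E = 1)%E.
Hypothesis mu_self_similar : self_similar_measure S X p mu.
Variable chi : R.
Hypothesis chiE : lexp p (fun j => (- ln (s j))%:E) = chi%:E.

Let p_ge0 j : 0 <= p j. Proof. exact: ltW. Qed.

Let tau_ge0 j : 0 <= - ln (s j).
Proof. by rewrite oppr_ge0 ln_le0// (le_trans (s_le j))// ltW. Qed.

Let chi_ge0 : 0 <= chi.
Proof. by rewrite -lee_fin -chiE; apply: lexp_ge0 => // j; rewrite lee_fin. Qed.

Definition hits (V : set 'rV[R]_k) : pred (seq nat) :=
  fun w => `[< exists2 y, X y & V (smap S w y) >].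

(** For a good word, wmax xa w < x gives s > exp(- (n + 1) x) for the prefixes of every length n at
    once. A ball of radius r that it hits then makes a prefix of length about ln (c / r) / x a near
    word, and t x < b turns exp(- n b) into r^t. The first condition has probability at least q at
    all lengths, the second fails with probability at most q / 2. *)
Lemma good_words (M0 : nat) (t : R) : 0 < t ->
  t * chi < \sum_(0 <= j < M0) p j * - ln (p j) ->
  exists G : pred (seq nat), exists q : R, exists C : R,
  [/\ 0 < q, forall m, (q%:E <= wprob p m G)%E, 0 < C &
     forall a r, 0 < r <= 1 -> exists m0, forall m, (m0 <= m)%N ->
       (wprob p m (predI G (hits [set x | (dist N a x <= r)%R])) <=
        (C * expR (t * ln r))%:E)%E].
Proof.
move=> t0; set H := \sum_(_ <= _ < _) _ => tH.
have [b bH tb] : exists2 b, b < H & t * chi < b.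
  by exists ((t * chi + H) / 2); lra.
have b0 : 0 < b by rewrite (le_lt_trans _ tb)// mulr_ge0// ltW.
have [c [C [theta [xi [/andP[c0 c1] theta0 xiE nearP]]]]] := near_word_prob normN X_neq0
  X_compact S_stable S_similarity s_gt0 s_le smax_lt1 S_separated p_gt0 p_sum1 bH.
have [x [chix x0 tx]] : exists x, [/\ chi < x, 0 < x & t * x < b].
  exists ((chi + b / t) / 2).
  have h : chi < b / t by rewrite ltr_pdivlMr// mulrC.
  have e : t * (b / t) = b by rewrite mulrC divfK// gt_eqF.
  by have := chi_ge0; split; lra.
pose q := (x - chi) / x.
have q0 : 0 < q by rewrite divr_gt0// subr_gt0.
pose kappa := - ln (q / 2) / theta.
pose xa j := x - - ln (s j).
pose G w := (wmax xa w < x) && (wmax xi w <= kappa).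
have kq : expR (- (theta * kappa)) = q / 2.
  by rewrite /kappa mulrC divfK ?gt_eqF// opprK lnK// posrE divr_gt0.
(* The first summand serves l >= 1, with 2 b because the depth used exceeds l - 2. The second makes
   the bound at least 1 when l < 1. *)
exists G, (q / 2), (expR (kappa + C + 2 * b - t * ln c) + expR (t * x - t * ln c)).
split; [by rewrite divr_gt0| |by rewrite addr_gt0 ?expR_gt0|].
  move=> m; have h1 := wprob_wmax_lt p_ge0 p_sum1 m tau_ge0 chiE chix.
  have h2 := @wprob_wmax_gt R p p_ge0 p_sum1 xi theta kappa m theta0 xiE.
  have h3 : (wprob p m (fun w => wmax xa w < x)%R <=
      wprob p m G + wprob p m (fun w => kappa < wmax xi w)%R)%E.
    apply: le_trans (wprobU p_ge0 _ _ _); apply: le_wprob => // w _ /= h.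
    by rewrite /G h /=; case: ltP.
  have Gf := wprob_fin_num p_ge0 p_sum1 m G.
  have := le_trans h1 (le_trans h3 (leeD2l _ h2)).
  rewrite kq -(fineK Gf) -EFinD !lee_fin -/q; lra.
move=> a r /andP[r0 r1].
pose l := ln (c / r) / x.
have cr0 : 0 < c / r by rewrite divr_gt0.
have crE : ln (c / r) = l * x by rewrite /l divfK// gt_eqF.
have lE : ln r = ln c - l * x by rewrite -crE ln_div ?posrE//; lra.
have [l1|l1] := ltP l 1.
  exists 0%N => m _; apply: le_trans (wprob_le1 p_ge0 p_sum1 _ _) _.
  rewrite lee_fin mulrDl -expRD -[leLHS]expR0 -[leLHS]add0r lerD//.
  rewrite -expRD ler_expR lE.
  have -> : t * x - t * ln c + t * (ln c - l * x) = t * x * (1 - l) by ring.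
  by rewrite !mulr_ge0// ?(ltW t0)// ?(ltW x0)//; lra.
have /andP[] := truncn_itv (le_trans ler01 l1).
case E : (Num.truncn l) => [|n].
  by move=> _ h; move: (lt_le_trans h l1); rewrite ltxx.
(* The depth is one less than the integer part of l: at depth n the ratio is only known to exceed
   exp(- (n + 1) x), and (n + 1) x <= l x = ln (c / r). *)
move=> nl ln2; exists n => m nm.
pose Q w := (wmax xi w <= kappa) && `[< near_word N X S s c a w >].
apply: (@le_trans _ _ (wprob p m (fun w => Q (take n w)))).
  apply: le_wprob => // w wm /andP[/andP[wa wx] /asboolP[y Xy ay]].
  apply/andP; split; first by rewrite (le_trans (wmax_take_le _ _ _)).
  apply/asboolP; exists (smap S (drop n w) y); first exact: smap_stable.
  rewrite -smap_cat cat_take_drop (le_lt_trans ay)// mulrC -ltr_pdivrMr//.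
  have sp := sprod_gt0 s_gt0 (take n w).
  rewrite -ltf_pV2 ?posrE ?divr_gt0// invf_div -ltr_ln ?posrE ?invr_gt0//.
  rewrite lnV ?posrE// ln_sprod// crE.
  have := le_lt_trans (wmax_take xa w n) wa.
  have -> : \sum_(j <- take n w) xa j =
      (size (take n w))%:R * x - \sum_(j <- take n w) - ln (s j).
    elim: (take n w) => [|j u IH]; first by rewrite !big_nil /=; lra.
    by rewrite !big_cons IH /xa /= -[(size u).+1]addn1 natrD; ring.
  rewrite size_takel ?wm//; have : n.+1%:R * x <= l * x by rewrite ler_pM2r.
  by rewrite -[n.+1]addn1 natrD; lra.
have -> : wprob p m (fun w => Q (take n w)) = wprob p n Q.
  by rewrite /wprob -(@wexp_take _ p p_ge0 p_sum1 m n (fun w => (Q w)%:R%:E)).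
apply: (le_trans (nearP a kappa n)); rewrite lee_fin mulrDl -!expRD.
rewrite -[leLHS]addr0 lerD ?expR_ge0// ler_expR lE.
have : l * b <= n.+2%:R * b by rewrite ler_pM2r// ltW.
have : t * x * l <= b * l by rewrite ler_pM2r ?(lt_le_trans ltr01 l1)// ltW.
by rewrite -[n.+2]addn2 natrD; lra.
Qed.

Lemma wprob_hits_union (G : pred (seq nat)) (V : nat -> set 'rV[R]_k)
    (v : nat -> R) m n :
  (forall i, (i < n)%N -> (wprob p m (predI G (hits (V i))) <= (v i)%:E)%E) ->
  (wprob p m (predI G (hits (\big[setU/set0]_(i < n) V i))) <=
   (\sum_(0 <= i < n) v i)%:E)%E.
Proof.
move=> Vv; apply: (@le_trans _ _ (wprob p m
    (fun w => has (fun i => predI G (hits (V i)) w) (index_iota 0 n)))).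
  apply: le_wprob => // w _ /andP[Gw /asboolP[y Xy]].
  rewrite -bigcup_mkord => -[i /= ni Vy]; apply/hasP; exists i.
    by rewrite mem_index_iota.
  by rewrite /= Gw; apply/asboolP; exists y.
apply: (le_trans (wprob_has p_ge0 p_sum1 m _ (fun i => predI G (hits (V i))))).
rewrite -sumEFin big_nat [leRHS]big_nat; apply: lee_sum => i /andP[_ ni].
exact: Vv.
Qed.

(* A countable cover by balls whose radii have small t-th powers cannot carry
   full measure: finitely many of the balls would be hit by too few words. *)
Lemma cover_sum_lower (M0 : nat) (t : R) : 0 < t ->
  t * chi < \sum_(0 <= j < M0) p j * - ln (p j) ->
  exists2 eta : R, 0 < eta &
  forall (V : nat -> set 'rV[R]_k) (v : nat -> R),
    (forall i, 0 <= v i) -> (\sum_(0 <= i <oo) (v i)%:E <= eta%:E)%E ->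
    (forall i, V i = set0 \/ exists a r, [/\ 0 < r <= 1,
        V i = [set x | dist N a x <= r] & expR (t * ln r) <= v i]) ->
    (mu (\bigcup_i V i) < 1)%E.
Proof.
move=> t0 tH; have [G [q [C [q0 Gq C0 GV]]]] := good_words t0 tH.
exists (q / (4 * C)); first by rewrite divr_gt0// mulr_gt0.
move=> V v v0 vsum HV; rewrite ltNge; apply/negP => muV.
have mV i : measurable (V i : set (borelRk R k)).
  have [->|[a [r [_ -> _]]]] := HV i; first exact: measurable0.
  by apply: closed_borel; exact: closed_dball.
pose F n := \big[setU/set0]_(i < n) V i.
have mF n : measurable (F n : set (borelRk R k)).
  by rewrite /F; apply: bigsetU_measurable.
have FV : \bigcup_n F n = \bigcup_i V i.
  rewrite eqEsubset; split => [x [n _]|x [i _ Vx]].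
    by rewrite /F -bigcup_mkord => -[i _ Vx]; exists i.
  by exists i.+1 => //; rewrite /F -bigcup_mkord; exists i => /=.
have : (mu \o F) n @[n --> \oo] --> mu (\bigcup_n F n).
  apply: nondecreasing_cvg_mu => //.
    by rewrite FV; exact: bigcupT_measurable.
  by apply/nondecreasing_seqP => n; rewrite /F big_ord_recr/=; apply/subsetPset/subsetUl.
have -> : mu (\bigcup_n F n) = 1%E.
  apply/eqP; rewrite eq_le probability_le1 ?FV//=; exact: bigcupT_measurable.
move=> /fine_cvgP[_ /cvgrPdist_lt /(_ (q / 2))]; rewrite divr_gt0// => /(_ isT).
move=> [n _ /(_ n (leqnn n))] /= Fn.
have {}Fn : ((1 - q / 2)%:E < mu (F n))%E.
  rewrite -(fineK (fin_num_measure mu (F n) (mF n))) lte_fin.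
  by have := ler_norm (1 - fine (mu (F n))); lra.
have /choice[m0 Hm0] i : exists m0, forall m, (m0 <= m)%N ->
    (wprob p m (predI G (hits (V i))) <= (C * v i)%:E)%E.
  have [->|[a [r [r01 -> rv]]]] := HV i.
    exists 0%N => m _; apply: (wexp_le_cst p_ge0 p_sum1) => [w _||w _].
    - by rewrite lee_fin.
    - by rewrite mulr_ge0// ltW.
    - rewrite [predI _ _ w](_ : _ = false); first by rewrite lee_fin mulr_ge0// ltW.
      by apply/negbTE/negP => /andP[_ /asboolP[y]].
  have [m0 H0] := GV a r r01; exists m0 => m /H0 /le_trans; apply.
  by rewrite lee_fin ler_pM2l.
(* A common length at which the estimates of the n balls all hold. *)
pose m := \max_(i < n) m0 i.
have GF : (wprob p m (predI G (hits (F n))) <= (q / 4)%:E)%E.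
  apply: (@le_trans _ _ (\sum_(0 <= i < n) C * v i)%:E).
    apply: wprob_hits_union => i ni; apply: Hm0.
    by rewrite /m (bigD1 (Ordinal ni))//= leq_maxl.
  rewrite -mulr_sumr lee_fin.
  have : \sum_(0 <= i < n) v i <= q / (4 * C).
    rewrite -lee_fin (le_trans _ vsum)// -sumEFin.
    by apply: nneseries_lim_ge => i _ _; rewrite lee_fin.
  by rewrite ler_pdivlMr ?mulr_gt0//; lra.
have hF : (mu (F n) <= wprob p m (hits (F n)))%E.
  exact: (measure_le_wprob normN X_compact S_stable S_similarity p_ge0 mu_self_similar).
(* P(G) >= q and P(hits) > 1 - q / 2 force the joint event above q / 2, against the bound q / 4. *)
have h := wprobI p_ge0 p_sum1 m G (hits (F n)).
have := lt_le_trans Fn hF; move: (Gq m) h GF.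
rewrite -(fineK (wprob_fin_num p_ge0 p_sum1 m G)).
rewrite -(fineK (wprob_fin_num p_ge0 p_sum1 m (hits (F n)))).
rewrite -(fineK (wprob_fin_num p_ge0 p_sum1 m (predI G (hits (F n))))).
by rewrite -!EFinD !lee_fin lte_fin; lra.
Qed.

End HausdorffLower.

(** * From covers by balls to the Hausdorff dimension *)

Section HausdorffDimGe.
Context {R : realType} {k : nat} (N : 'rV[R]_k -> R).
Hypothesis normN : is_norm N.

Lemma dist_le_diam (U : set 'rV[R]_k) x y : U x -> U y ->
  ((dist N x y)%:E <= diam N U)%E.
Proof. by move=> Ux Uy; apply: ereal_sup_ubound; exists (x, y). Qed.

Lemma diam_pow_ge0 t (U : set 'rV[R]_k) : (0 <= diam_pow N t U)%E.
Proof. by rewrite /diam_pow; case: ifP => // _; exact: poweR_ge0. Qed.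

(** U is enclosed in the ball about one of its points of radius max(d, rho), with d its diameter and
    rho^t = min(e, 1). As d <= 1 and t' < t, d^t <= d^t'; the radius rho takes care of small or zero
    diameters. *)
Lemma ball_cover (t' t e : R) (U : set 'rV[R]_k) : t' < t -> 0 <= t' -> 0 < e ->
  (diam N U <= 1)%E ->
  exists Vv : set 'rV[R]_k * R, [/\ U `<=` Vv.1, 0 <= Vv.2,
    (Vv.2%:E <= diam_pow N t' U + e%:E)%E &
    Vv.1 = set0 \/ exists a r, [/\ 0 < r <= 1,
        Vv.1 = [set x | dist N a x <= r] & expR (t * ln r) <= Vv.2]].
Proof.
move=> tt t'0 e0 U1.
have [->|/set0P[a Ua]] := eqVneq U set0.
  exists (set0, 0); split => //=; last by left.
  by rewrite adde_ge0 ?diam_pow_ge0// lee_fin ltW.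
have D0 : (0 <= diam N U)%E.
  by apply: le_trans (dist_le_diam Ua Ua); rewrite distxx.
have Df : diam N U \is a fin_num by rewrite ge0_fin_numE// (le_lt_trans U1)// ltry.
pose d := fine (diam N U); have dE : diam N U = d%:E by rewrite /d fineK.
have d0 : 0 <= d by rewrite -lee_fin -dE.
have d1 : d <= 1 by rewrite -lee_fin -dE.
have t0 : 0 < t by exact: le_lt_trans tt.
pose e1 := Num.min e 1; have e10 : 0 < e1 by rewrite lt_min e0 ltr01.
pose rho := expR (ln e1 / t).
have rho1 : rho <= 1.
  rewrite /rho -expR0 ler_expR pmulr_lle0 ?invr_gt0//.
  by rewrite ln_le0// ge_min lexx orbT.
pose r := Num.max d rho.
have r0 : 0 < r by rewrite lt_max expR_gt0 orbT.
exists ([set x | dist N a x <= r], expR (t * ln r)); split => /=.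
- move=> x Ux /=; rewrite le_max; apply/orP; left.
  by rewrite -lee_fin -dE; exact: dist_le_diam.
- exact: expR_ge0.
- rewrite /diam_pow ifF; last by apply/negbTE/set0P; exists a.
  rewrite dE poweR_EFin -EFinD lee_fin /r.
  case: (leP d rho) => [drho|rhod].
    rewrite /rho expRK mulrC divfK ?gt_eqF// lnK ?posrE//.
    by rewrite -[leLHS]add0r lerD ?powR_ge0// ge_min lexx.
  have dpos : 0 < d by rewrite (lt_trans _ rhod)// expR_gt0.
  rewrite /powR gt_eqF// -[leLHS]addr0 lerD ?(ltW e0)// ler_expR.
  by rewrite ler_wnM2r ?ln_le0// ltW.
- right; exists a, r; split => //.
  by rewrite r0 /r ge_max d1 rho1.
Qed.

(** If some t' < t had zero measure, a cover with t'-sum below eta / 2, enlarged to balls at a total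
    cost of eta / 2, would contradict the hypothesis. *)
Lemma hausdorff_dim_ge (t eta : R) (B : set 'rV[R]_k) : 0 < eta ->
  (forall (V : nat -> set 'rV[R]_k) (v : nat -> R),
    (forall i, 0 <= v i) -> (\sum_(0 <= i <oo) (v i)%:E <= eta%:E)%E ->
    (forall i, V i = set0 \/ exists a r, [/\ 0 < r <= 1,
        V i = [set x | dist N a x <= r] & expR (t * ln r) <= v i]) ->
    ~ B `<=` \bigcup_i V i) ->
  (t%:E <= hausdorff_dim N B)%E.
Proof.
move=> eta0 HB; apply: le_ereal_inf_tmp => _ [t' [t'0 Ht'] <-].
rewrite lee_fin leNgt; apply/negP => tt.
have : (hausdorff_content N t' 1 B < (eta / 2)%:E)%E.
  apply: (@le_lt_trans _ _ 0%E); last by rewrite lte_fin divr_gt0.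
  by rewrite -Ht'; apply: ereal_sup_ubound; exists 1 => //=.
move=> /ereal_inf_ltP[_ [U [BU U1] <-] Usum].
pose e i : R := eta / 2 / (2 ^ i.+1)%:R.
have e0 i : 0 < e i by rewrite !divr_gt0// ltr0n expn_gt0.
have /choice[W HW] i := ball_cover tt t'0 (e0 i) (U1 i).
apply: (HB (fun i => (W i).1) (fun i => (W i).2)).
- by move=> i; have [] := HW i.
- apply: (@le_trans _ _ (\sum_(0 <= i <oo) (diam_pow N t' (U i) + (e i)%:E))%E).
    apply: lee_nneseries => i _; last by have [] := HW i.
    by move=> _; rewrite lee_fin; have [] := HW i.
  apply: le_trans (epsilon_trick _ _ _) _.
  + by move=> i; exact: diam_pow_ge0.
  + by rewrite divr_ge0// ltW.
  + have -> : eta%:E = ((eta / 2)%:E + (eta / 2)%:E)%E by rewrite -EFinD; congr (_%:E); lra.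
    by rewrite leeD2r// ltW.
- by move=> i; have [] := HW i.
- by move=> x /BU[i _ Ux]; exists i => //; have [+ _ _ _] := HW i; exact.
Qed.

End HausdorffDimGe.

Section HausdorffMeasureLower.
Context {R : realType} {k : nat} (N : 'rV[R]_k -> R).
Hypothesis normN : is_norm N.
Variables (X : set 'rV[R]_k) (S : nat -> 'rV[R]_k -> 'rV[R]_k) (s : nat -> R).
Hypothesis X_neq0 : X !=set0.
Hypothesis X_compact : compact X.
Hypothesis S_stable : forall j, set_fun X X (S j).
Hypothesis S_similarity : forall j, similarity_on N X (S j) (s j).
Hypothesis s_gt0 : forall j, 0 < s j.
Variable smax : R.
Hypothesis s_le : forall j, s j <= smax.
Hypothesis smax_lt1 : smax < 1.
Hypothesis S_separated : strong_separation S X.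
Variables (p : nat -> R) (mu : probability (borelRk R k) R).
Hypothesis p_gt0 : forall j, 0 < p j.
Hypothesis p_sum1 : (\sum_(0 <= j <oo) (p j)%:E = 1)%E.
Hypothesis mu_self_similar : self_similar_measure S X p mu.
Variable chi : R.
Hypothesis chiE : lexp p (fun j => (- ln (s j))%:E) = chi%:E.

Lemma hausdorff_dim_measure_lower (M0 : nat) (t : R) : 0 < t ->
  t * chi < \sum_(0 <= j < M0) p j * - ln (p j) ->
  (t%:E <= hausdorff_dim_measure N mu)%E.
Proof.
move=> t0 tH; have [eta eta0 Heta] := cover_sum_lower normN X_neq0 X_compact
  S_stable S_similarity s_gt0 s_le smax_lt1 S_separated p_gt0 p_sum1 mu_self_similar
  chiE t0 tH.
apply: le_ereal_inf_tmp => _ [B [mB muB] <-].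
apply: (hausdorff_dim_ge normN eta0) => V v v0 vsum HV BV.
have := Heta V v v0 vsum HV; rewrite ltNge => /negP; apply.
rewrite -[leLHS]muB; apply: le_measure => //; rewrite inE//.
apply: bigcupT_measurable => i; have [->|[a [r [_ -> _]]]] := HV i.
  exact: measurable0.
by apply: closed_borel; exact: closed_dball.
Qed.

End HausdorffMeasureLower.

(** * Typical words *)

Section WeakLaw.
Context {R : realType} (p : nat -> R).
Hypothesis p_ge0 : forall j, 0 <= p j.
Hypothesis p_sum1 : (\sum_(0 <= j <oo) (p j)%:E = 1)%E.
Variables (f : nat -> R) (l : R).
Hypothesis f_ge0 : forall j, 0 <= f j.
Hypothesis fE : lexp p (EFin \o f) = l%:E.

Let cut (M j : nat) : R := if (j < M)%N then f j else 0.

Let cut_ge0 M j : 0 <= cut M j. Proof. by rewrite /cut; case: ifP. Qed.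

Let lexp_cut M : lexp p (EFin \o cut M) = (\sum_(0 <= j < M) p j * f j)%:E.
Proof.
rewrite (@lexp_finite _ _ p_ge0 M) => [|j|j] /=.
- by rewrite -sumEFin; apply: congr_big_nat => // j /= jM; rewrite /cut jM.
- by rewrite lee_fin.
- by rewrite /cut ltnNge => ->.
Qed.

Let cut_mean e : 0 < e -> exists M, l - e < \sum_(0 <= j < M) p j * f j <= l.
Proof.
move=> e0.
have pf0 i : (0 <= (p i)%:E * (f i)%:E)%E by rewrite -EFinM lee_fin mulr_ge0.
have : (\sum_(0 <= j < n) (p j)%:E * (EFin \o f) j)%E @[n --> \oo] --> l%:E.
  by rewrite -fE; apply: is_cvg_nneseries.
under eq_fun do rewrite sumEFin.
move=> /fine_cvgP[_ /cvgrPdist_lt /(_ _ e0)] [n _ /(_ n (leqnn n))] /= h.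
exists n; apply/andP; split.
  by have := ler_norm (l - \sum_(0 <= j < n) p j * f j); move: h; lra.
rewrite -lee_fin -sumEFin -fE.
by apply: (nneseries_lim_ge (u_ := fun j => (p j)%:E * (f j)%:E)%E) => i _ _; exact: pf0.
Qed.

Let cut_bound M : exists2 F, 0 <= F & forall j, cut M j <= F.
Proof.
exists (\sum_(0 <= j < M) f j) => [|j]; first exact: sumr_ge0.
rewrite /cut; case: ifPn => [jM|_]; last exact: sumr_ge0.
by rewrite (bigD1_seq j) ?mem_index_iota ?iota_uniq//= lerDl sumr_ge0.
Qed.

Let sum_wmax (xi : nat -> R) w : - (\sum_(j <- w) xi j) <= wmax xi w.
Proof. by have := wmax_take xi w (size w); rewrite take_size. Qed.

Let sumB_const (a : R) (g : nat -> R) w :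
  \sum_(j <- w) (g j - a) = \sum_(j <- w) g j - (size w)%:R * a.
Proof.
elim: w => [|j w IH]; first by rewrite !big_nil /=; lra.
by rewrite !big_cons IH /= -[(size w).+1]addn1 natrD; ring.
Qed.

Let large_nat (a b : R) : 0 < a ->
  exists m0 : nat, forall m, (m0 <= m)%N -> b <= m%:R * a.
Proof.
move=> a0; exists (Num.truncn (b / a)).+1 => m hm.
rewrite -ler_pdivrMr// (le_trans (ltW (truncnS_gt _)))// ler_nat//.
Qed.

(** Only a first moment is available. Cutting f to finitely many letters costs at most e / 2 of the
    mean and leaves bounded steps; a deviation then pushes the running maximum of a walk with
    positive mean above m e / 4. *)
Lemma weak_law_lower e d : 0 < e -> 0 < d ->
  exists m0 : nat, forall m, (m0 <= m)%N ->
  (wprob p m (fun w => \sum_(j <- w) f j < m%:R * (l - e))%R <= d%:E)%E.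
Proof.
move=> e0 d0; have e2 : 0 < e / 2 by rewrite divr_gt0.
have [M /andP[Ml _]] := cut_mean e2; have [F F0 cF] := cut_bound M.
pose a := l - e; pose xi j := cut M j - (l - e / 2 - e / 4).
pose Z := F + `|l - e / 2 - e / 4|.
have xiZ j : `|xi j| <= Z.
  rewrite (le_trans (ler_normB _ _))// lerD2r ger0_norm// cF.
have Z0 : 0 <= Z by exact: le_trans (xiZ 0%N).
have e4 : 0 < e / 4 by rewrite divr_gt0.
have xiZ0 j : 0 <= xi j + Z by have := xiZ j; rewrite ler_norml => /andP[]; lra.
have mean : ((Z + e / 4)%:E <= lexp p (fun j => (xi j + Z)%:E))%E.
  have cst : 0 <= Z - (l - e / 2 - e / 4).
    by rewrite /Z; have := ler_norm (l - e / 2 - e / 4); lra.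
  have -> : lexp p (fun j => (xi j + Z)%:E) =
      lexp p (fun j => (EFin \o cut M) j + (Z - (l - e / 2 - e / 4))%:E)%E.
    by apply: eq_lexp => j /=; rewrite -EFinD; congr (_%:E); rewrite /xi; lra.
  rewrite lexpD//; last by move=> j; rewrite lee_fin.
  by rewrite lexp_cst// lexp_cut -EFinD lee_fin; lra.
have [t t0 tE] := exponential_moment_le1 p_ge0 p_sum1 xiZ e4 mean.
pose kappa := - ln d / t.
have [m0 Hm0] := large_nat kappa e4.
exists m0 => m /Hm0 hm.
apply: (@le_trans _ _ (wprob p m (fun w => kappa < wmax xi w)%R)).
  apply: le_wprob => // w wm h; apply: lt_le_trans (sum_wmax xi w).
  have : \sum_(j <- w) cut M j <= \sum_(j <- w) f j.
    by apply: ler_sum => j _; rewrite /cut; case: ifP.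
  by rewrite sumB_const wm; move: h hm; lra.
apply: (le_trans (wprob_wmax_gt p_ge0 p_sum1 kappa m t0 tE)).
by rewrite lee_fin /kappa mulrC divfK ?gt_eqF// opprK lnK.
Qed.

(** The slack e is split in thirds q. The cut part is treated by the maximal inequality; the
    remainder [f2] has mean at most q d / 2, so by Markov its sum reaches m q with probability at
    most d / 2. *)
Lemma weak_law_upper e d : 0 < e -> 0 < d ->
  exists m0 : nat, forall m, (m0 <= m)%N ->
  (wprob p m (fun w => m%:R * (l + e) < \sum_(j <- w) f j)%R <= d%:E)%E.
Proof.
move=> e0 d0; pose q := e / 3; have q0 : 0 < q by rewrite divr_gt0.
have d2 : 0 < d / 2 by rewrite divr_gt0.
have qd : 0 < q * (d / 2) by rewrite mulr_gt0.
have [M /andP[Ml Ml2]] := cut_mean qd; have [F F0 cF] := cut_bound M.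
pose f2 j : R := if (j < M)%N then 0 else f j.
have f20 j : 0 <= f2 j by rewrite /f2; case: ifP.
have fcut j : f j = cut M j + f2 j by rewrite /cut /f2; case: ifP; rewrite ?addr0 ?add0r.
set c := \sum_(0 <= j < M) p j * f j in Ml Ml2.
have f2E : lexp p (EFin \o f2) = (l - c)%:E.
  have : (l%:E = c%:E + lexp p (EFin \o f2))%E.
    rewrite -fE -lexp_cut -lexpD//; last exact: cut_ge0.
    by apply: eq_lexp => j /=; rewrite fcut.
  by case: (lexp p (EFin \o f2)) => [x| |]//= [->]; congr (_%:E); lra.
pose xi j := - (cut M j - (l + q)).
pose Z := F + `|l + q|.
have xiZ j : `|xi j| <= Z.
  by rewrite normrN (le_trans (ler_normB _ _))// lerD2r ger0_norm// cF.
have xiZ0 j : 0 <= xi j + Z by have := xiZ j; rewrite ler_norml => /andP[]; lra.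
have mean : ((Z + q)%:E <= lexp p (fun j => (xi j + Z)%:E))%E.
  have cst : 0 <= Z + (l + q).
    by rewrite /Z; have := ler_norm (- (l + q)); rewrite normrN; lra.
  have : ((Z + (l + q))%:E = c%:E + lexp p (fun j => (xi j + Z)%:E))%E.
    rewrite -lexp_cut -lexpD//; last exact: cut_ge0.
    rewrite -[LHS](lexp_cst p_ge0 p_sum1 cst).
    by apply: eq_lexp => j /=; rewrite -EFinD; congr (_%:E); rewrite /xi; lra.
  case: (lexp p _) => [x [E]| |]//=.
  by rewrite lee_fin; lra.
have [t t0 tE] := exponential_moment_le1 p_ge0 p_sum1 xiZ q0 mean.
pose kappa := - ln (d / 2) / t.
have [m0 Hm0] := large_nat kappa q0.
exists (maxn 1 m0) => m; rewrite geq_max => /andP[m1 /Hm0 hm].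
have m1' : 0 < m%:R :> R by rewrite ltr0n.
apply: (@le_trans _ _ (wprob p m (predU (fun w => kappa < wmax xi w)%R
    (fun w => m%:R * q <= \sum_(j <- w) f2 j)%R))).
  apply: le_wprob => // w wm /= h; case: (ltP kappa) => //= h2.
  have := sum_wmax xi w; rewrite /xi sumrN opprK sumB_const wm => h3.
  have E : \sum_(j <- w) f j = \sum_(j <- w) cut M j + \sum_(j <- w) f2 j.
    by rewrite -big_split; apply: eq_bigr => j _; exact: fcut.
  have : m%:R * (l + e) = m%:R * (l + q) + m%:R * q + m%:R * q by rewrite /q; field.
  by move: h; rewrite E; lra.
apply: (le_trans (wprobU p_ge0 _ _ _)).
have -> : d%:E = ((d / 2)%:E + (d / 2)%:E)%E by rewrite -EFinD; congr (_%:E); lra.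
apply: leeD.
  apply: (le_trans (wprob_wmax_gt p_ge0 p_sum1 kappa m t0 tE)).
  by rewrite lee_fin /kappa mulrC divfK ?gt_eqF// opprK lnK.
have mq : 0 < m%:R * q by rewrite mulr_gt0.
have := @wexp_markov R p p_ge0 m (fun w => \sum_(j <- w) f2 j) _ mq.
rewrite (wexp_sum_letters p_ge0 p_sum1 m f20 f2E) => h.
rewrite -(@lee_pmul2l _ (m%:R * q)%:E)// (le_trans (h _))//.
  by move=> w; exact: sumr_ge0.
by rewrite -EFinM lee_fin -mulrA ler_pM2l//; lra.
Qed.

End WeakLaw.

(** * Total weight of families of words *)

Section WordMass.
Context {R : realType} (p : nat -> R).
Hypothesis p_ge0 : forall j, 0 <= p j.
Hypothesis p_sum1 : (\sum_(0 <= j <oo) (p j)%:E = 1)%E.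

(** [sprod], taken at [p] instead of the ratios, is the weight p_w. *)
Lemma wprob_pred1 w : wprob p (size w) (pred1 w) = (sprod p w)%:E.
Proof.
elim: w => [|i w IH]; first by rewrite /wprob /sprod big_nil.
have -> : wprob p (size (i :: w)) (pred1 (i :: w)) =
    lexp p (fun j => ((j == i)%:R)%:E * wprob p (size w) (pred1 w))%E.
  rewrite /wprob [LHS]/=; apply: eq_lexp => j.
  rewrite -(wexpZ p_ge0); last by move=> u; rewrite lee_fin.
  by apply: eq_wexp => u _; rewrite -EFinM -natrM mulnb /= eqseq_cons.
rewrite IH (@lexp_finite _ _ p_ge0 i.+1); last 2 first.
- by move=> j; rewrite -EFinM lee_fin mulr_ge0// /sprod prodr_ge0.
- by move=> j ij; rewrite gtn_eqF// mul0e.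
rewrite big_nat_recr//= eqxx mul1e big_nat big1 ?add0e; last first.
  by move=> j /andP[_ ji]; rewrite ltn_eqF// mul0e mule0.
by rewrite sprod_cons EFinM.
Qed.

Lemma sum_words_le1 m (l : seq (seq nat)) : uniq l ->
  (forall w, w \in l -> size w = m) -> \sum_(w <- l) sprod p w <= 1.
Proof.
move=> ul lm; rewrite -lee_fin -sumEFin.
have -> : (\sum_(w <- l) (sprod p w)%:E = \sum_(w <- l) wprob p m (pred1 w))%E.
  by rewrite big_seq [RHS]big_seq; apply: eq_bigr => w wl; rewrite -wprob_pred1 (lm _ wl).
rewrite /wprob -(wexp_sum p_ge0); last by move=> w u; rewrite lee_fin.
apply: (wexp_le_cst p_ge0 p_sum1) => // u _.
  by apply: sume_ge0 => w _; rewrite lee_fin.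
rewrite sumEFin lee_fin -natr_sum lern1.
rewrite (eq_bigr (fun w => (w == u) : nat)); last by move=> w _ /=; rewrite eq_sym.
by rewrite -big_mkcond sum1_count count_uniq_mem// leq_b1.
Qed.

Lemma geometric_sum_le (x : R) (n m : nat) : 0 <= x < 1 ->
  \sum_(n <= i < m) x ^+ i <= x ^+ n / (1 - x).
Proof.
move=> /andP[x0 x1]; have y0 : 0 < 1 - x by rewrite subr_gt0.
rewrite ler_pdivlMr//; have [nm|mn] := leqP n m; last first.
  by rewrite big_geq ?(ltnW mn)// mul0r exprn_ge0.
suff -> : (\sum_(n <= i < m) x ^+ i) * (1 - x) = x ^+ n - x ^+ m.
  by rewrite gerBl exprn_ge0.
elim: m nm => [|m IH]; first by rewrite leqn0 => /eqP ->; rewrite big_geq// mul0r subrr.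
rewrite leq_eqVlt => /predU1P[->|nm]; first by rewrite big_geq// mul0r subrr.
by rewrite big_nat_recr//= mulrDl IH// exprS; ring.
Qed.

(** Grouped by length: distinct words of one length have total weight at most 1. *)
Lemma sum_words_geometric (x : R) (n : nat) (l : seq (seq nat)) : 0 <= x < 1 ->
  uniq l -> (forall w, w \in l -> (n <= size w)%N) ->
  \sum_(w <- l) sprod p w * x ^+ size w <= x ^+ n / (1 - x).
Proof.
move=> x01 ul ln; pose K := (\max_(w <- l) size w).+1.
apply: le_trans (geometric_sum_le n K x01).
have -> : \sum_(w <- l) sprod p w * x ^+ size w =
    \sum_(w <- l) \sum_(n <= i < K) (if size w == i then sprod p w * x ^+ i else 0).
  rewrite big_seq [RHS]big_seq; apply: eq_bigr => w wl.
  have wK : size w \in index_iota n K.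
    by rewrite mem_index_iota ln// ltnS; exact: (leq_bigmax_seq w).
  rewrite (bigD1_seq (size w))//= ?iota_uniq// eqxx big1 ?addr0// => i.
  by rewrite eq_sym => /negbTE ->.
rewrite exchange_big; apply: ler_sum => i _.
rewrite -big_mkcond -big_filter -mulr_suml ler_piMl ?exprn_ge0//.
  by case/andP: x01.
apply: (sum_words_le1 (m := i)); first exact: filter_uniq.
by move=> w; rewrite mem_filter => /andP[/eqP].
Qed.

Lemma card_le_of_seq (T : choiceType) (A : set T) n :
  (forall l : seq T, uniq l -> (forall x, x \in l -> A x) -> (size l <= n)%N) ->
  (A #<= `I_n)%card.
Proof.
move=> H; have [fA|/(infinite_set_fset n.+1)[B BA]] := pselect (finite_set A); last first.
  move=> nB; have := H (finmap.enum_fset B) (finmap.fset_uniq B) BA.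
  by rewrite leqNgt nB.
have /finite_setP[m Am] := fA.
rewrite (card_le_eql Am) card_le_II -(card_fset_set Am).
apply: H; first exact: finmap.fset_uniq.
by move=> x; rewrite (in_fset_set fA) inE.
Qed.

End WordMass.

(** * Upper bounds *)

Section QuantUpper.
Context {R : realType} {k : nat} (N : 'rV[R]_k -> R).
Hypothesis normN : is_norm N.
Variables (X : set 'rV[R]_k) (S : nat -> 'rV[R]_k -> 'rV[R]_k) (s : nat -> R).
Hypothesis X_neq0 : X !=set0.
Hypothesis X_compact : compact X.
Hypothesis S_stable : forall j, set_fun X X (S j).
Hypothesis S_similarity : forall j, similarity_on N X (S j) (s j).
Hypothesis s_gt0 : forall j, 0 < s j.
Variables (p : nat -> R) (mu : probability (borelRk R k) R).
Hypothesis p_gt0 : forall j, 0 < p j.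
Hypothesis p_sum1 : (\sum_(0 <= j <oo) (p j)%:E = 1)%E.
Hypothesis mu_self_similar : self_similar_measure S X p mu.

Let p_ge0 j : 0 <= p j. Proof. exact: ltW. Qed.

Definition words m (Q : pred (seq nat)) : set (seq nat) :=
  [set w | size w = m /\ Q w].

Lemma card_words m n (Q : pred (seq nat)) : (0 < n)%N ->
  (forall w, size w = m -> Q w -> n%:R^-1 <= sprod p w) ->
  (words m Q #<= `I_n)%card.
Proof.
move=> n0 Qn; apply: card_le_of_seq => l ul lQ.
have n0' : 0 < n%:R :> R by rewrite ltr0n.
rewrite -(ler_nat R) -(ler_pM2r (x := n%:R^-1)) ?invr_gt0// divff ?gt_eqF//.
apply: le_trans (sum_words_le1 p_ge0 p_sum1 ul (fun w wl => (lQ w wl).1)).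
rewrite mulr_natl -iter_addr_0 -count_predT -big_const_seq big_seq [leRHS]big_seq.
by apply: ler_sum => w wl; have [wm Qw] := lQ w wl; exact: Qn.
Qed.

Lemma measurable_words m (Q : pred (seq nat)) :
  measurable (\bigcup_(w in words m Q) (smap S w @` X) : set (borelRk R k)).
Proof.
rewrite bigcup_mkcond; apply: countable_bigcupT_measurable => [|w]; first exact: countableP.
case: ifP => // _; apply: closed_borel.
exact: (closed_smap normN X_compact S_stable S_similarity).
Qed.

(** The quantizer takes one point S_w x0 per selected piece. On X the log-distance is at most K; on
    the union of these pieces, of measure at least q, it is at most K - beta <= 0. *)
Lemma quant_error_le_words : exists2 K : R, 0 <= K &
  forall m n (Q : pred (seq nat)) (beta q : R), (0 < n)%N -> K <= beta -> 0 < q ->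
  (forall w, size w = m -> Q w -> n%:R^-1 <= sprod p w) ->
  (forall w, size w = m -> Q w -> beta <= - ln (sprod s w)) ->
  (q%:E <= wprob p m Q)%E ->
  (quant_error N mu n <= (K - (beta - K) * q)%:E)%E.
Proof.
have [D D0 XD] := compact_dist_bounded normN X_compact.
pose K := `|ln D|.
exists K => [|m n Q beta q n0 Kb q0 Qn Qb Qq]; first exact: normr_ge0.
have [x0 Xx0] := X_neq0.
pose A : set 'rV[R]_k := (fun w => smap S w x0) @` words m Q.
have cQ : (words m Q #<= `I_n)%card by exact: card_words.
have cA : (A #<= `I_n)%card by apply: card_le_trans cQ; exact: card_image_le.
have A0 : A !=set0.
  apply: contrapT => nA; have : (wprob p m Q <= 0)%E.
    apply: (wexp_le_cst p_ge0 p_sum1) => // w wm; rewrite lee_fin.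
    case: (boolP (Q w)) => // Qw; exfalso; apply: nA.
    by exists (smap S w x0); exists w.
  by move=> /(le_trans Qq); rewrite lee_fin leNgt q0.
apply: (@le_trans _ _ (\int[mu]_x lne (dist_set N x A)%:E)%E).
  by apply: ereal_inf_lbound; exists A.
pose E := \bigcup_(w in words m Q) (smap S w @` X).
have mE : measurable (E : set (borelRk R k)) by exact: measurable_words.
have cX : closed X by apply: compact_closed => //; exact: norm_hausdorff.
have mX : measurable (X : set (borelRk R k)) by exact: closed_borel.
have qE : (q%:E <= mu E)%E.
  apply: (le_trans Qq).
  apply: (wprob_le_measure normN X_compact S_stable S_similarity p_ge0 mu_self_similar) => // w y wm Qw Xy.
  by exists w => //; exists y.
pose f (x : borelRk R k) := lne (dist_set N x A)%:E.
have fX x : X x -> (f x <= K%:E)%E.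
  move=> Xx; rewrite /f; have [d0|d0] := leP (dist_set N x A) 0.
    by rewrite le0_lneNy ?leNye// lee_fin.
  rewrite lne_EFin// lee_fin (le_trans _ (ler_norm _))// ler_ln ?posrE//.
  have [_ [w [wm Qw] _]] := A0.
  apply: (@le_trans _ _ (dist N x (smap S w x0))).
    by apply: dist_set_le => //; exists w.
  by apply: XD => //; exact: smap_stable.
have fE x : E x -> (f x <= (K - beta)%:E)%E.
  move=> [w [wm Qw] [y Xy <-]]; rewrite /f.
  have [d0|d0] := leP (dist_set N (smap S w y) A) 0; first by rewrite le0_lneNy ?leNye// lee_fin.
  rewrite lne_EFin// lee_fin.
  have sw := sprod_gt0 s_gt0 w.
  have : dist_set N (smap S w y) A <= sprod s w * D.
    apply: (@le_trans _ _ (dist N (smap S w y) (smap S w x0))).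
      by apply: dist_set_le => //; exists w.
    by rewrite (dist_smap S_stable S_similarity)// ler_pM2l// XD.
  rewrite -ler_ln ?posrE ?mulr_gt0// => /le_trans; apply.
  rewrite lnM ?posrE//; have := Qb w wm Qw; have := ler_norm (ln D); rewrite -/K; lra.
have mf : measurable_fun [set: borelRk R k] f.
  have md := measurable_dist_set normN A0.
  have -> : f = fun x => if dist_set N x A <= 0 then -oo%E else (ln (dist_set N x A))%:E.
    by [].
  apply: (@measurable_fun_ifT _ _ _ _ _ _ (fun x : borelRk R k => dist_set N x A <= 0)) => //.
    exact: measurable_fun_ler.
  by apply/measurable_EFinP; apply: measurableT_comp md; exact: measurable_ln.
rewrite integralE EFinB; apply: leeB.
  rewrite (@ge0_negligible_integral _ _ _ mu setT (~` X))//; first last.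
    exact: (self_similar_setC X_compact S_stable mu_self_similar).
    exact: measurable_funepos.
    exact: measurableC.
  rewrite setTD setCK -(integral_cstX X_compact S_stable mu_self_similar).
  apply: ge0_le_integral => //.
  - by apply: measurable_funTS; exact: measurable_funepos.
  - by move=> x Xx; rewrite funeposE ge_max fX// lee_fin normr_ge0.
apply: (@le_trans _ _ (\int[mu]_(x in E) (f^\- x))%E); last first.
  apply: ge0_subset_integral => //; exact: measurable_funeneg.
apply: (@le_trans _ _ (\int[mu]_(x in E) (beta - K)%:E)%E).
  rewrite integral_cst// EFinM lee_wpmul2l// lee_fin; lra.
apply: ge0_le_integral => //.
- by move=> x _; rewrite lee_fin; lra.
- by apply: measurable_funTS; exact: measurable_funeneg.
- move=> x Ex; rewrite funenegE le_max; apply/orP; left.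
  by rewrite -[leLHS]oppeK leeN2 -EFinN opprB fE.
Qed.

End QuantUpper.

Lemma one_sub_expn (R : realDomainType) (x : R) m : 0 <= x <= 1 ->
  1 - m%:R * (1 - x) <= x ^+ m.
Proof.
move=> /andP[x0 x1]; elim: m => [|m IH]; first by rewrite mul0r subr0 expr0.
rewrite exprS; apply: le_trans (ler_wpM2l x0 IH).
have : 0 <= m%:R * ((1 - x) * (1 - x)) by rewrite !mulr_ge0 ?ler0n ?subr_ge0.
by rewrite -natr1; nra.
Qed.

Section TypicalWords.
Context {R : realType}.
Variables (p s : nat -> R).
Hypothesis p_gt0 : forall j, 0 < p j.
Hypothesis p_le1 : forall j, p j <= 1.
Hypothesis p_sum1 : (\sum_(0 <= j <oo) (p j)%:E = 1)%E.
Hypothesis s_gt0 : forall j, 0 < s j.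
Hypothesis s_le1 : forall j, s j <= 1.
Variables chi h : R.
Hypothesis chiE : lexp p (fun j => (- ln (s j))%:E) = chi%:E.
Hypothesis hE : lexp p (fun j => (- ln (p j))%:E) = h%:E.

Definition typical (e : R) (w : seq nat) : bool :=
  ((size w)%:R * (chi - e) <= - ln (sprod s w)) &&
  (- ln (sprod p w) <= (size w)%:R * (h + e)).

Lemma wprob_typical e d : 0 < e -> 0 < d ->
  exists m0 : nat, forall m, (m0 <= m)%N -> ((1 - d)%:E <= wprob p m (typical e))%E.
Proof.
move=> e0 d0; have d20 : 0 < d / 2 by rewrite divr_gt0.
have p_ge0 j : 0 <= p j by exact: ltW.
have lns j : 0 <= - ln (s j) by rewrite oppr_ge0 ln_le0.
have lnp j : 0 <= - ln (p j) by rewrite oppr_ge0 ln_le0.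
have [m1 H1] := weak_law_lower p_ge0 p_sum1 lns chiE e0 d20.
have [m2 H2] := weak_law_upper p_ge0 p_sum1 lnp hE e0 d20.
exists (maxn m1 m2) => m; rewrite geq_max => /andP[/H1 {}H1 /H2 {}H2].
set Q1 := fun w => _ in H1; set Q2 := fun w => _ in H2.
have H : (1 <= wprob p m (typical e) + (wprob p m Q1 + wprob p m Q2))%E.
  apply: (@le_trans _ _ (wprob p m (predU (typical e) (predU Q1 Q2)))).
    rewrite -[leLHS](wexp_cst p_ge0 p_sum1 m ler01); apply: le_wexp => // w wm.
    rewrite lee_fin (_ : predU _ _ w = true)//= /typical /Q1 /Q2 wm !ln_sprod//.
    by case: leP => //= _; case: leP.
  by rewrite (le_trans (wprobU p_ge0 _ _ _))// leeD2l// wprobU.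
have {H1 H2} H12 : (wprob p m Q1 + wprob p m Q2 <= d%:E)%E.
  by rewrite (splitr d) EFinD leeD.
have := le_trans H (leeD2l _ H12).
by rewrite EFinB leeBlDr.
Qed.

End TypicalWords.

Section QuantUpperRate.
Context {R : realType} {k : nat} (N : 'rV[R]_k -> R).
Hypothesis normN : is_norm N.
Variables (X : set 'rV[R]_k) (S : nat -> 'rV[R]_k -> 'rV[R]_k) (s : nat -> R).
Hypothesis X_neq0 : X !=set0.
Hypothesis X_compact : compact X.
Hypothesis S_stable : forall j, set_fun X X (S j).
Hypothesis S_similarity : forall j, similarity_on N X (S j) (s j).
Hypothesis s_gt0 : forall j, 0 < s j.
Variable smax : R.
Hypothesis s_le : forall j, s j <= smax.
Hypothesis smax_lt1 : smax < 1.
Variables (p : nat -> R) (mu : probability (borelRk R k) R).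
Hypothesis p_gt0 : forall j, 0 < p j.
Hypothesis p_sum1 : (\sum_(0 <= j <oo) (p j)%:E = 1)%E.
Hypothesis mu_self_similar : self_similar_measure S X p mu.

Let p_ge0 j : 0 <= p j. Proof. exact: ltW. Qed.

Let p_le1 j : p j <= 1.
Proof.
by rewrite (le_trans (prob_letter_le p_gt0 (ltnSn j)))// partial_sum_le1.
Qed.

Let s_le1 j : s j <= 1. Proof. by rewrite (le_trans (s_le j))// ltW. Qed.

Let smax_gt0 : 0 < smax. Proof. exact: lt_le_trans (s_gt0 0) (s_le 0). Qed.

Let lexp_lt J : lexp p (fun j => (j < J)%N%:R%:E) = (\sum_(0 <= j < J) p j)%:E.
Proof.
rewrite (@lexp_finite _ _ p_ge0 J) => [|j|j] /=.
- rewrite -sumEFin; apply: congr_big_nat => // j /= jJ.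
  by rewrite jJ -EFinM mulr1.
- by rewrite lee_fin.
- by rewrite ltnNge => ->.
Qed.

(** Valid also for infinite entropy: words of a fixed length m over a large finite alphabet carry
    probability 1 / 2, and their weights are bounded below. It makes the denominators of the
    quotients positive. *)
Lemma quant_error_unbounded (V : R) : exists n0 : nat, forall n, (n0 <= n)%N ->
  (quant_error N mu n <= (- V)%:E)%E.
Proof.
have [K K0 HK] := quant_error_le_words normN X_neq0 X_compact S_stable
  S_similarity s_gt0 p_gt0 p_sum1 mu_self_similar.
have l0 : 0 < - ln smax by rewrite oppr_gt0 ln_lt0// smax_gt0.
(* Chosen so that K - (B - K) / 2 = - |V|, where 1 / 2 is the probability of [Q] below. *)
pose B := `|V| * 2 + K * 3.
pose m := (Num.truncn (B / - ln smax)).+1.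
have Bm : B <= m%:R * - ln smax by rewrite -ler_pdivrMr// ltW// truncnS_gt.
(* By Bernoulli's inequality, a mass above 1 - 1 / (2 m) per letter leaves at least 1 / 2 for m
   letters. *)
have [J _ HJ] := sum_to1_partial 0 p_ge0 p_sum1 (e := (2 * m%:R)^-1) (ltac:(by rewrite invr_gt0 mulr_gt0 ?ltr0n)).
have [c c0 cp] : exists2 c : R, 0 < c & forall j, (j < J)%N -> c <= p j.
  elim: J {HJ} => [|J [c c0 IH]]; first by exists 1.
  exists (Num.min c (p J)) => [|j]; first by rewrite lt_min c0 p_gt0.
  by rewrite ltnS leq_eqVlt => /predU1P[->|/IH cj]; rewrite ge_min ?lexx ?orbT// cj.
exists (Num.truncn (c ^- m)).+1 => n hn.
have cn : n%:R^-1 <= c ^+ m.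
  rewrite -[leRHS]invrK lef_pV2 ?posrE ?invr_gt0 ?exprn_gt0 ?ltr0n ?(leq_ltn_trans _ hn)//.
  by rewrite (le_trans (ltW (truncnS_gt _)))// ler_nat.
pose Q := all (fun j => (j < J)%N).
have KB : K <= B by have := normr_ge0 V; rewrite /B; lra.
apply: (@le_trans _ _ (K - (B - K) * 2^-1)%:E); last first.
  by rewrite lee_fin /B; have := ler_norm V; lra.
apply: (HK m n Q) => //; first exact: leq_ltn_trans hn.
- move=> w wm Qw; apply: (le_trans cn); rewrite -wm {wm}.
  elim: w Qw => [_|j w IH /= /andP[jJ Qw]]; first by rewrite /sprod big_nil.
  by rewrite sprod_cons exprS ler_pM ?cp ?IH ?exprn_ge0// ltW.
- move=> w wm _; rewrite (le_trans Bm)// mulrN lerN2 mulr_natl -lnXn//.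
  by rewrite ler_ln ?posrE ?exprn_gt0 ?sprod_gt0// -wm sprod_le.
- rewrite /Q (wprob_all p_ge0 m (lexp_lt J)) lee_fin.
  apply: le_trans (one_sub_expn m _); last first.
    by rewrite (partial_sum_le1 _ p_ge0 p_sum1) sumr_ge0.
  have : m%:R * (1 - \sum_(0 <= j < J) p j) <= m%:R * (2 * m%:R)^-1.
    by rewrite ler_wpM2l//; lra.
  by rewrite invfM mulrCA divff ?pnatr_eq0// mulr1; lra.
Qed.

Lemma quant_error_upper (chi h t : R) :
  lexp p (fun j => (- ln (s j))%:E) = chi%:E ->
  lexp p (fun j => (- ln (p j))%:E) = h%:E ->
  0 < t -> h < t * chi ->
  exists n0 : nat, forall n, (n0 <= n)%N ->
    (quant_error N mu n <= (- (ln n%:R / t))%:E)%E.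
Proof.
move=> chiE hE t0 htchi.
have h0 : 0 <= h.
  by rewrite -lee_fin -hE lexp_ge0// => j; rewrite lee_fin oppr_ge0 ln_le0.
have chi0 : 0 < chi by rewrite -(pmulr_rgt0 _ t0) (le_lt_trans h0).
have [K K0 HK] := quant_error_le_words normN X_neq0 X_compact S_stable
  S_similarity s_gt0 p_gt0 p_sum1 mu_self_similar.
pose g := t * chi - h.
have g0 : 0 < g by rewrite subr_gt0.
(* Both (t + 1) e and t chi d equal g / 4, whence t (chi - e) (1 - d) > h + e. *)
pose e := g / (4 * (t + 1)); pose d := g / (4 * (t * chi)).
have e0 : 0 < e by rewrite divr_gt0// mulr_gt0// addr_gt0.
have tchi0 : 0 < t * chi by rewrite mulr_gt0.
have d0 : 0 < d by rewrite divr_gt0// mulr_gt0.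
have dE : t * chi * d = g / 4 by rewrite /d; field; rewrite !gt_eqF.
have eE : (t + 1) * e = g / 4 by rewrite /e; field; rewrite gt_eqF// addr_gt0.
have echi : e < chi.
  by rewrite -(ltr_pM2l t0) -/g; move: eE h0; rewrite /g; nra.
have d1 : d < 1.
  by rewrite -(ltr_pM2l tchi0) dE /g; lra.
have [m0 Hm0] := wprob_typical p_gt0 p_le1 p_sum1 s_gt0 s_le1 chiE hE e0 d0.
have he0 : 0 < h + e by rewrite ltr_pwDr.
pose eta := (chi - e) * (1 - d) / (h + e) - t^-1.
have eta0 : 0 < eta.
  rewrite /eta subr_gt0 ltr_pdivlMr// mulrC ltr_pdivrMr//.
  have : t * e * d >= 0 by exact: mulr_ge0 (mulr_ge0 (ltW t0) (ltW e0)) (ltW d0).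
  by move: dE eE; rewrite /g; nra.
(* The three bounds on ln n give m >= m0, m (chi - e) >= K, and room for the additive constants. *)
pose B := Num.max (m0%:R * (h + e)) (Num.max ((K / (chi - e) + 1) * (h + e)) ((K * 2 + chi) / eta)).
have [n1 Hn1] := @ln_nat_unbounded R B.
exists (maxn 1 n1) => n; rewrite geq_max => /andP[n_gt0 /Hn1].
rewrite !ge_max => /and3P[L1 L2 L3].
have lnn : 0 <= ln n%:R :> R by rewrite ln_ge0// ler1n.
(* The greatest length at which the weight exp(- m (h + e)) guaranteed for typical words is still at
   least 1 / n. *)
pose m := Num.truncn (ln n%:R / (h + e)).
have mn : m%:R <= ln n%:R / (h + e) by rewrite truncn_le// divr_ge0// ltW.
have mn1 : ln n%:R / (h + e) - 1 <= m%:R.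
  by rewrite lerBlDr natr1 ltW// truncnS_gt.
have m0m : (m0 <= m)%N.
  rewrite /m truncn_ge_nat; last by rewrite divr_ge0// ltW.
  by rewrite ler_pdivlMr.
have che : 0 < chi - e by rewrite subr_gt0.
apply: (@le_trans _ _ (K - (m%:R * (chi - e) - K) * (1 - d))%:E); last first.
  rewrite lee_fin.
  have : (K * 2 + chi) <= eta * ln n%:R by rewrite [leRHS]mulrC -ler_pdivrMr.
  rewrite /eta mulrBl.
  have -> : (chi - e) * (1 - d) / (h + e) * ln n%:R =
    ln n%:R / (h + e) * ((chi - e) * (1 - d)) by field; rewrite gt_eqF.
  have c1 : 0 <= (chi - e) * (1 - d) by rewrite mulr_ge0 ?subr_ge0 ?ltW.
  have c2 : (chi - e) * (1 - d) <= chi by nra.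
  have := ler_wpM2r c1 mn1; rewrite mulrBl mul1r (mulrC t^-1); have := mulr_ge0 K0 (ltW d0).
  lra.
apply: (HK m n (typical p s chi h e)) => //; last exact: Hm0.
- rewrite -ler_pdivrMr//; apply: le_trans mn1.
  by rewrite lerBrDr ler_pdivlMr.
- by rewrite subr_gt0.
- move=> w wm /andP[_ Pw].
  rewrite -[leLHS]lnK ?posrE ?invr_gt0 ?ltr0n// -[leRHS]lnK ?posrE ?sprod_gt0//.
  rewrite ler_expR lnV ?posrE ?ltr0n// lerNl (le_trans Pw)// wm.
  by rewrite -ler_pdivlMr.
- by move=> w wm /andP[]; rewrite wm.
Qed.


End QuantUpperRate.

Lemma geometric_small (R : realType) (x : R) : 0 <= x -> x < 1 -> forall C e : R, 0 < e ->
  exists n0 : nat, forall n, (n0 <= n)%N -> x ^+ n * C <= e.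
Proof.
move=> x0 x1 C e e0.
have /cvgrPdist_le/(_ (e / (`|C| + 1))) : x ^+ n @[n --> \oo] --> (0 : R).
  by apply: cvg_expr; rewrite ger0_norm.
have C1 : 0 < `|C| + 1 by rewrite ltr_wpDl.
rewrite divr_gt0// => /(_ isT)[n0 _ H]; exists n0 => n /H /=.
rewrite sub0r normrN ger0_norm ?exprn_ge0// ler_pdivlMr//; apply: le_trans.
by rewrite ler_wpM2l ?exprn_ge0// (le_trans (ler_norm C))// lerDl.
Qed.

(** * Upper bound on the Hausdorff dimension of the measure *)

Section HausdorffMeasureUpper.
Context {R : realType} {k : nat} (N : 'rV[R]_k -> R).
Hypothesis normN : is_norm N.

Lemma hausdorff_measure_eq0 (t : R) (A : set 'rV[R]_k) :
  (forall delta e : R, 0 < delta -> 0 < e -> exists U : nat -> set 'rV[R]_k,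
    [/\ A `<=` \bigcup_i U i, forall i, (diam N (U i) <= delta%:E)%E &
       (\sum_(0 <= i <oo) diam_pow N t (U i) <= e%:E)%E]) ->
  hausdorff_measure N t A = 0%E.
Proof.
move=> H.
have content_ge0 delta : (0 <= hausdorff_content N t delta A)%E.
  apply: le_ereal_inf_tmp => _ [U _ <-].
  by apply: nneseries_ge0 => i _ _; exact: diam_pow_ge0.
apply/eqP; rewrite eq_le; apply/andP; split; last first.
  by apply: le_trans (content_ge0 1) _; apply: ereal_sup_ubound; exists 1 => //=.
apply: ge_ereal_sup => _ [delta /= d0 <-].
apply/lee_addgt0Pr => e e0; rewrite add0e.
have [U [AU Ud Us]] := H delta e d0 e0.
by apply: le_trans Us; apply: ereal_inf_lbound; exists U.
Qed.

Variables (X : set 'rV[R]_k) (S : nat -> 'rV[R]_k -> 'rV[R]_k) (s : nat -> R).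
Hypothesis X_compact : compact X.
Hypothesis S_stable : forall j, set_fun X X (S j).
Hypothesis S_similarity : forall j, similarity_on N X (S j) (s j).
Hypothesis s_gt0 : forall j, 0 < s j.
Variable smax : R.
Hypothesis s_le : forall j, s j <= smax.
Hypothesis smax_lt1 : smax < 1.
Variables (p : nat -> R) (mu : probability (borelRk R k) R).
Hypothesis p_gt0 : forall j, 0 < p j.
Hypothesis p_sum1 : (\sum_(0 <= j <oo) (p j)%:E = 1)%E.
Hypothesis mu_self_similar : self_similar_measure S X p mu.

Let p_ge0 j : 0 <= p j. Proof. exact: ltW. Qed.

Let p_le1 j : p j <= 1.
Proof.
by rewrite (le_trans (prob_letter_le p_gt0 (ltnSn j)))// partial_sum_le1.
Qed.

Let s_le1 j : s j <= 1. Proof. by rewrite (le_trans (s_le j))// ltW. Qed.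

Let smax_gt0 : 0 < smax. Proof. exact: lt_le_trans (s_gt0 0) (s_le 0). Qed.

Lemma diam_smap (D : R) w : (forall x y, X x -> X y -> dist N x y <= D) ->
  (diam N (smap S w @` X) <= (sprod s w * D)%:E)%E.
Proof.
move=> XD; apply: ge_ereal_sup => _ [[_ _] /= [[x Xx <-] [y Xy <-]] <-].
rewrite lee_fin (dist_smap S_stable S_similarity)// ler_wpM2l ?XD//.
by rewrite ltW// sprod_gt0.
Qed.

Lemma diam_pow_smap (t D : R) w : 0 <= t -> (forall x y, X x -> X y -> dist N x y <= D) ->
  (diam_pow N t (smap S w @` X) <= ((sprod s w * D) `^ t)%:E)%E.
Proof.
move=> t0 XD; rewrite /diam_pow; case: ifP => [_|/negbT/set0P[y Uy]].
  by rewrite lee_fin powR_ge0.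
have D0 : (0 <= diam N (smap S w @` X))%E.
  by apply: le_trans (dist_le_diam N Uy Uy); rewrite distxx.
have DD := diam_smap w XD.
by rewrite -poweR_EFin gt0_ler_poweR// in_itv /= leey andbT// (le_trans D0).
Qed.

(** Each tail union contains E m for all large m, hence has full measure. Convergence in probability
    thus suffices, with no summability of the exceptional probabilities. *)
Lemma limsup_full_measure (E : nat -> set (borelRk R k)) :
  (forall m, measurable (E m)) ->
  (forall d, 0 < d -> exists m0 : nat, forall m, (m0 <= m)%N -> ((1 - d)%:E <= mu (E m))%E) ->
  mu (\bigcap_n \bigcup_(m in [set m | (n <= m)%N]) E m) = 1%E.
Proof.
move=> mE HE; set B := \bigcap_n _.
pose U n := \bigcup_(m in [set m | (n <= m)%N]) E m.
have mU n : measurable (U n) by apply: bigcup_measurable.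
have mB : measurable B by exact: bigcapT_measurable.
have : mu (~` B) = 0%E.
  apply: measure_negligible; first exact: measurableC.
  rewrite /B setC_bigcap; apply: negligible_bigcup => n.
  exists (~` U n); split => //; first exact: measurableC.
  apply/eqP; rewrite eq_le measure_ge0 andbT.
  have/eqP := probability_setC mu (mU n); rewrite eq_le => /andP[+ _].
  move=> /le_trans; apply.
  rewrite sube_le0; apply/lee_addgt0Pr => d d0.
  have [m0 /(_ (maxn n m0) (leq_maxr _ _))] := HE d d0.
  rewrite EFinB leeBlDr// => /le_trans; apply; rewrite leeD2r//.
  apply: le_measure; rewrite ?inE// => x Ex; exists (maxn n m0) => //=.
  exact: leq_maxl.
rewrite probability_setC// => /eqP; rewrite sube_eq// ?add0e; first by move/eqP.
Qed.

(** Typical words w satisfy s_w^t <= p_w x^m with m their length and x = exp(- g / 2) < 1. The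
    typical pieces of length at least n cover the limsup set B, and their t-sum is at most D^t x^n /
    (1 - x). *)
Lemma hausdorff_dim_measure_upper (chi h t : R) :
  lexp p (fun j => (- ln (s j))%:E) = chi%:E ->
  lexp p (fun j => (- ln (p j))%:E) = h%:E ->
  0 < t -> h < t * chi -> (hausdorff_dim_measure N mu <= t%:E)%E.
Proof.
move=> chiE hE t0 htchi.
pose g := t * chi - h; have g0 : 0 < g by rewrite subr_gt0.
have [e e0 eg] : exists2 e, 0 < e & t * (chi - e) - (h + e) = g / 2.
  have t10 : 0 < t + 1 by rewrite addr_gt0.
  exists (g / (2 * (t + 1))); first by rewrite divr_gt0// mulr_gt0.
  by rewrite /g; field; rewrite gt_eqF.
have [D D0 XD] := compact_dist_bounded normN X_compact.
pose x := expR (- (g / 2)).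
have x1 : x < 1 by rewrite /x -expR0 ltr_expR oppr_lt0 divr_gt0.
have x01 : 0 <= x < 1 by rewrite x1 expR_ge0.
pose Q := typical p s chi h e.
have sQ w : Q w -> (sprod s w * D) `^ t <= D `^ t * (sprod p w * x ^+ size w).
  move=> /andP[Q1 Q2].
  have sw := sprod_gt0 s_gt0 w; have pw := sprod_gt0 p_gt0 w.
  rewrite powRM ?(ltW sw) ?(ltW D0)// mulrC ler_wpM2l ?powR_ge0//.
  rewrite -[X in X * _]lnK ?posrE// -expRM_natl -expRD /powR gt_eqF// ler_expR.
  have := ler_wpM2l (ltW t0) Q1; move: eg Q2; rewrite -mulr_natl; nra.
pose B := \bigcap_n \bigcup_(m in [set m | (n <= m)%N])
  \bigcup_(w in words m Q) (smap S w @` X).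
have mE m := measurable_words normN X_compact S_stable S_similarity m Q.
have muB : mu B = 1%E.
  apply: limsup_full_measure => // d d0.
  have [m0 Hm0] := wprob_typical p_gt0 p_le1 p_sum1 s_gt0 s_le1 chiE hE e0 d0.
  exists m0 => m /Hm0 /le_trans; apply.
  apply: (wprob_le_measure normN X_compact S_stable S_similarity p_ge0 mu_self_similar) => // w y wm Qw Xy.
  by exists w => //; exists y.
apply: (@le_trans _ _ (hausdorff_dim N B)).
  apply: ereal_inf_lbound; exists B => //; split => //.
  apply: bigcapT_measurable => n; apply: bigcup_measurable => m _; exact: mE.
apply: ereal_inf_lbound; exists t => //; split; first exact: ltW.
apply: hausdorff_measure_eq0 => delta eps delta0 eps0.
have [n nD nx] : exists2 n, smax ^+ n * D <= delta & D `^ t * (x ^+ n / (1 - x)) <= eps.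
  have [n1 Hn1] := geometric_small (ltW smax_gt0) smax_lt1 D delta0.
  have [n2 Hn2] := geometric_small (expR_ge0 _) x1 (D `^ t / (1 - x)) eps0.
  exists (maxn n1 n2); first exact: Hn1 (leq_maxl _ _).
  by rewrite mulrCA; exact: Hn2 (leq_maxr _ _).
pose ok (w : seq nat) := (n <= size w)%N && Q w.
(* Integers that encode no suitable word yield the empty set, which adds nothing to the sum. *)
pose G (o : option (seq nat)) : set 'rV[R]_k :=
  if o is Some w then if ok w then smap S w @` X else set0 else set0.
exists (fun i => G (pickle_inv i)); split.
- move=> y /(_ n I)[m /= nm [w [wm Qw] Uy]].
  by exists (pickle w) => //; rewrite /G pickleK_inv /ok wm nm Qw.
- move=> i; have D00 : (diam N (set0 : set 'rV[R]_k) <= delta%:E)%E.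
    by rewrite /diam set0X image_set0 ereal_sup0 leNye.
  rewrite /G; case: (pickle_inv i) => // w; case: ifP => // /andP[nw _].
  apply: le_trans (diam_smap w XD) _; rewrite lee_fin (le_trans _ nD)//.
  rewrite ler_wpM2r ?(ltW D0)// (le_trans (sprod_le s_gt0 s_le w))//.
  by rewrite ler_wiXn2l// ltW.
apply: lime_le; first by apply: is_cvg_nneseries => i _ _; exact: diam_pow_ge0.
apply: nearW => K.
pose l := [seq w <- pmap (@pickle_inv (seq nat)) (index_iota 0 K) | ok w].
apply: (@le_trans _ _ (\sum_(w <- l) ((D `^ t) * (sprod p w * x ^+ size w))%:E)%E).
  rewrite /l; elim: (index_iota 0 K) => [|i r IH]; first by rewrite !big_nil.
  rewrite big_cons /=; case: (pickle_inv i) => [w|] /=; last first.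
    by rewrite {1}/diam_pow eqxx add0e.
  case: ifP => okw; last by rewrite {1}/diam_pow eqxx add0e.
  rewrite big_cons leeD//; apply: le_trans (diam_pow_smap w (ltW t0) XD) _.
  by rewrite lee_fin sQ//; have /andP[] := okw.
rewrite sumEFin lee_fin -mulr_sumr (le_trans _ nx)// ler_wpM2l ?powR_ge0//.
apply: (sum_words_geometric p_ge0 p_sum1 x01).
- rewrite /l filter_uniq// (pmap_uniq (@pickle_invK _))// iota_uniq//.
- by move=> w; rewrite mem_filter => /andP[/andP[]].
Qed.

End HausdorffMeasureUpper.

(** * Conclusion *)

Section EventualBounds.
Context {R : realType}.
Implicit Types (u : nat -> \bar R) (x y : \bar R).

Lemma limn_esup_le u x n0 : (forall n, (n0 <= n)%N -> (u n <= x)%E) -> (limn_esup u <= x)%E.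
Proof.
move=> ux; apply: (@le_trans _ _ (ereal_sup (u @` [set n | (n0 <= n)%N]))).
  by apply: ereal_inf_lbound; exists [set n | (n0 <= n)%N] => //; exists n0.
by apply: ge_ereal_sup => _ [n n0n <-]; exact: ux.
Qed.

Lemma le_limn_einf u x n0 : (forall n, (n0 <= n)%N -> (x <= u n)%E) -> (x <= limn_einf u)%E.
Proof.
by move=> ux; rewrite /limn_einf leeNr; apply: (@limn_esup_le _ _ n0) => n /ux; rewrite leeN2.
Qed.

Lemma le_of_pos_lt (a : R) x : 0 < a -> (forall t, 0 < t -> t < a -> (t%:E <= x)%E) ->
  (a%:E <= x)%E.
Proof.
move=> a0 H; apply/lee_subgt0Pr => e e0.
pose b := Num.min (e / 2) (a / 2).
have b0 : 0 < b by rewrite lt_min !divr_gt0.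
have [be ba] : b <= e / 2 /\ b <= a / 2 by split; rewrite ge_min lexx ?orbT.
apply: le_trans (H (a - b) _ _); [|lra|lra].
by rewrite -EFinB lee_fin; lra.
Qed.

Lemma le_of_gt (a : R) x : (forall t, a < t -> (x <= t%:E)%E) -> (x <= a%:E)%E.
Proof.
by move=> H; apply/lee_addgt0Pr => e e0; rewrite -EFinD H// ltrDl.
Qed.

Lemma lexp_gt_partial (p f : nat -> R) (t : R) : (forall j, 0 <= p j) ->
  (forall j, 0 <= f j) -> (t%:E < lexp p (EFin \o f))%E ->
  exists M, t < \sum_(0 <= j < M) p j * f j.
Proof.
move=> p0 f0; apply: contraPP => /forallNP H; apply/negP; rewrite -leNgt.
apply: lime_le; first by apply: is_cvg_nneseries => j _ _; rewrite mule_ge0 ?lee_fin.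
apply: nearW => M; under eq_bigr do rewrite -EFinM.
by rewrite sumEFin lee_fin leNgt; apply/negP; exact: H.
Qed.

Lemma nneseries_EFin (f : nat -> R) (l : R) : series f @ \oo --> l ->
  (\sum_(0 <= j <oo) (f j)%:E = l%:E)%E.
Proof.
move=> fl; apply/cvg_lim => //.
under eq_fun do rewrite sumEFin.
by apply: cvg_EFin => //; exact: nearW.
Qed.

Lemma ediv_ge (a t : R) x : 0 < t -> ((- (a / t))%:E <= x)%E -> (x < 0)%E ->
  (t%:E <= a%:E / - x)%E.
Proof.
move=> t0; case: x => [r| |]//; rewrite lee_fin lte_fin => ar r0.
have r0' : 0 < - r by rewrite oppr_gt0.
rewrite -EFinN inver gt_eqF// -EFinM lee_fin ler_pdivlMr//.
by move: ar; rewrite lerNl ler_pdivlMr// mulrC.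
Qed.

Lemma ediv_le (a t : R) x : 0 < t -> 0 < a -> (x <= (- (a / t))%:E)%E ->
  (a%:E / - x <= t%:E)%E.
Proof.
move=> t0 a0; case: x => [r| |]//=.
  rewrite lee_fin lerNr => ar.
  have r0' : 0 < - r by rewrite (lt_le_trans _ ar)// divr_gt0.
  rewrite inver gt_eqF// -EFinM lee_fin ler_pdivrMr//.
  by rewrite mulrC -ler_pdivrMr.
(* For x = -oo the quotient is 0. *)
by move=> _; rewrite invey mule0 lee_fin ltW.
Qed.

End EventualBounds.

Theorem theorem3p1 (R : realType) (k : nat)
  (N : 'rV[R]_k -> R) (normN : is_norm N)
  (X : set 'rV[R]_k) (X_neq0 : X !=set0) (X_compact : compact X)
  (X_regular : X = closure (interior X))
  (S : nat -> 'rV[R]_k -> 'rV[R]_k) (s : nat -> R)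
  (S_stable : forall j, set_fun X X (S j))
  (S_similarity : forall j, similarity_on N X (S j) (s j))
  (s_itv : forall j, 0 < s j < 1)
  (s_sup : sup (range s) < 1)
  (S_separated : strong_separation S X)
  (p : nat -> R) (p_gt0 : forall j, 0 < p j)
  (p_sum1 : series p @ \oo --> (1 : R))
  (mu : probability (borelRk R k) R)
  (mu_self_similar : self_similar_measure S X p mu)
  (p_ln_s_cvg : cvgn (series (fun j => p j * ln (s j)))) :
  has_quant_dim N mu (hausdorff_dim_measure N mu).
Proof.
have s_gt0 j : 0 < s j by have /andP[] := s_itv j.
have s_le j : s j <= sup (range s).
  apply: ub_le_sup; last by exists j.
  by exists 1 => _ [i _ <-]; have /andP[_ /ltW] := s_itv i.
have p_ge0 j : 0 <= p j by exact: ltW.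
have pE : (\sum_(0 <= j <oo) (p j)%:E = 1)%E by exact: nneseries_EFin p_sum1.
have p_lt1 j : p j < 1.
  have := partial_sum_le1 j.+2 p_ge0 pE; apply: lt_le_trans.
  rewrite big_nat_recr//= (le_lt_trans (prob_letter_le p_gt0 (ltnSn j)))//.
  by rewrite ltrDl.
have lns_ge0 j : 0 <= - ln (s j).
  by rewrite oppr_ge0 ln_le0//; have /andP[_ /ltW] := s_itv j.
have lnp_ge0 j : 0 <= - ln (p j) by rewrite oppr_ge0 ln_le0// ltW.
have [chi chiE] : exists chi, lexp p (fun j => (- ln (s j))%:E) = chi%:E.
  exists (- limn (series (fun j => p j * ln (s j)))).
  rewrite /lexp; under eq_eseriesr do rewrite -EFinM mulrN.
  apply: nneseries_EFin.
  have -> : series (fun j => - (p j * ln (s j))) = - series (fun j => p j * ln (s j)).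
    by apply/funext => n; rewrite /series /= sumrN.
  exact: cvgN.
have smax0 : 0 < sup (range s) by exact: lt_le_trans (s_gt0 0) (s_le 0).
have chi0 : 0 < chi.
  have l0 : 0 < - ln (sup (range s)) by rewrite oppr_gt0 ln_lt0// smax0.
  rewrite (lt_le_trans l0)// -lee_fin -chiE -(lexp_cst p_ge0 pE (ltW l0)).
  apply: le_lexp => // j; rewrite lee_fin ?(ltW l0)//.
  by rewrite lerN2 ler_ln ?posrE.
(* From n1 on the error is at most -1, so it can be divided by. *)
have [n1 Hn1] := quant_error_unbounded normN X_neq0 X_compact S_stable
  S_similarity s_gt0 s_le s_sup p_gt0 pE mu_self_similar 1.
(* Lower bounds stated with partial entropies serve both finite and infinite entropy. *)
pose H M := \sum_(0 <= j < M) p j * - ln (p j).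
have lower t M : 0 < t -> t * chi < H M ->
  (t%:E <= lower_quant_dim N mu)%E /\ (t%:E <= hausdorff_dim_measure N mu)%E.
  move=> t0 tH; split; last first.
    exact: (hausdorff_dim_measure_lower normN X_neq0 X_compact S_stable
      S_similarity s_gt0 s_le s_sup S_separated p_gt0 pE mu_self_similar chiE t0 tH).
  have [n0 Hn0] := quant_error_lower normN X_neq0 X_compact S_stable
    S_similarity s_gt0 s_le s_sup S_separated p_gt0 pE mu_self_similar chiE t0 tH.
  apply: (@le_limn_einf _ _ _ (maxn n0 n1)) => n; rewrite geq_max => /andP[/Hn0 l /Hn1 u].
  apply: ediv_ge => //; apply: le_lt_trans u _.
  by rewrite lte_fin oppr_lt0.
have einf_esup : (lower_quant_dim N mu <= upper_quant_dim N mu)%E by exact: limn_einf_sup.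
case hE : (lexp p (fun j => (- ln (p j))%:E)) => [h| |].
- have H_gt t : t < h -> exists M, t < H M.
    by move=> th; apply: lexp_gt_partial => //; rewrite [X in (_ < X)%E]hE lte_fin.
  (* The lower bounds concern t > 0 only, so h / chi must be positive to be approached from
     below. *)
  have h0 : 0 < h.
    apply: (@lt_le_trans _ _ (p 0 * - ln (p 0))).
      by rewrite mulr_gt0// oppr_gt0 ln_lt0// p_gt0 p_lt1.
    rewrite -lee_fin -hE -[leLHS](_ : (\sum_(0 <= j < 1) (p j)%:E * (- ln (p j))%:E)%E = _).
      by apply: nneseries_lim_ge => j _ _; rewrite mule_ge0 ?lee_fin.
    by rewrite big_nat1 EFinM.
  have low t : 0 < t -> t < h / chi ->
      (t%:E <= lower_quant_dim N mu)%E /\ (t%:E <= hausdorff_dim_measure N mu)%E.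
    by move=> t0; rewrite ltr_pdivlMr// => /H_gt[M]; exact: lower.
  have D0 : 0 < h / chi by rewrite divr_gt0.
  have up t : h / chi < t ->
      (upper_quant_dim N mu <= t%:E)%E /\ (hausdorff_dim_measure N mu <= t%:E)%E.
    move=> ht; have t0 : 0 < t by rewrite (lt_trans D0).
    move: ht; rewrite ltr_pdivrMr// => ht; split; last first.
      exact: (hausdorff_dim_measure_upper normN X_compact S_stable S_similarity
        s_gt0 s_le s_sup p_gt0 pE mu_self_similar chiE hE t0 ht).
    have [n0 Hn0] := quant_error_upper normN X_neq0 X_compact S_stable
      S_similarity s_gt0 s_le s_sup p_gt0 pE mu_self_similar chiE hE t0 ht.
    apply: (@limn_esup_le _ _ _ (maxn 2 n0)) => n; rewrite geq_max => /andP[n2 /Hn0 u].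
    by apply: ediv_le => //; rewrite ln_gt0// ltr1n.
  have hdE : hausdorff_dim_measure N mu = (h / chi)%:E.
    apply/eqP; rewrite eq_le; apply/andP; split.
      by apply: le_of_gt => t /up[].
    by apply: le_of_pos_lt => // t t0 /(low t t0)[].
  have lowE : ((h / chi)%:E <= lower_quant_dim N mu)%E.
    by apply: le_of_pos_lt => // t t0 /(low t t0)[].
  have upE : (upper_quant_dim N mu <= (h / chi)%:E)%E by apply: le_of_gt => t /up[].
  rewrite hdE; split; apply/eqP; rewrite eq_le.
    by rewrite lowE (le_trans einf_esup).
  by rewrite upE (le_trans lowE).
(* Infinite entropy: every t > 0 is a lower bound, so all the dimensions equal +oo. *)
- have low t : 0 < t ->
      (t%:E <= lower_quant_dim N mu)%E /\ (t%:E <= hausdorff_dim_measure N mu)%E.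
    move=> t0; have [M tM] : exists M, t * chi < H M.
      by apply: lexp_gt_partial => //; rewrite [X in (_ < X)%E]hE ltry.
    exact: lower tM.
  have lowE : lower_quant_dim N mu = +oo%E by apply/eqyP => t /low[].
  have -> : hausdorff_dim_measure N mu = +oo%E by apply/eqyP => t /low[].
  by split => //; apply/eqP; rewrite -leye_eq -lowE.
- have := lexp_ge0 p_ge0 (fun j => (_ : 0 <= (- ln (p j))%:E)%E); rewrite hE => /(_ _) h.
  by have /h : forall j, (0 <= (- ln (p j))%:E)%E by move=> j; rewrite lee_fin.
Qed.
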